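(* Let $\phi\in L^{2}(\mathbb{R}^{2n})$. Then $\{T^{t}_{(k,l)}\phi : k,l\in\mathbb{Z}^{n}\}$ is a Riesz sequence (that is, a Riesz basis for its closed linear span $V^{t}(\phi)$) if and only if there exist constants $A,B$ such that $$0<A\leq[\phi,\phi](\xi,\xi')\leq B<\infty\quad\text{for a.e. }\xi,\xi'\in\mathbb{T}^{n}.$$
   Context: Notation: $\mathbb{T}^{n}$ is identified with $[0,1)^{n}$ with Lebesgue measure. Twisted translation: for $\phi\in L^{2}(\mathbb{R}^{2n})$ and $(k,l)\in\mathbb{Z}^{n}\times\mathbb{Z}^{n}$, $T^{t}_{(k,l)}\phi(x,y)=e^{\pi i(x\cdot l-y\cdot k)}\phi(x-k,y-l)$ for $(x,y)\in\mathbb{R}^{n}\times\mathbb{R}^{n}$. The principal twisted shift-invariant space is $V^{t}(\phi)=\overline{\operatorname{span}}\{T^{t}_{(k,l)}\phi : k,l\in\mathbb{Z}^{n}\}$. Weyl kernel: for $\phi\in L^{1}\cap L^{2}(\mathbb{R}^{2n})$, $K_{\phi}(\xi,\eta)=\int_{\mathbb{R}^{n}}\phi(x,\eta-\xi)e^{\pi i x\cdot(\xi+\eta)}\,dx$, $\xi,\eta\in\mathbb{R}^{n}$ (the integral kernel of the Weyl transform of $\phi$). The map $\phi\mapsto K_{\phi}$ is isometric for the $L^{2}(\mathbb{R}^{2n})$ norm and is extended by density to all of $L^{2}(\mathbb{R}^{2n})$. Weyl-Zak transform: $Z_{W}:L^{2}(\mathbb{R}^{2n})\to L^{2}(\mathbb{T}^{n}\times\mathbb{T}^{n}\times\mathbb{R}^{n})$,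 $Z_{W}\phi(\xi,\xi',\eta)=\sum_{m\in\mathbb{Z}^{n}}K_{\phi}(m+\xi,\eta)e^{-2\pi i m\cdot\xi'}$. Bracket: for $\phi,\psi\in L^{2}(\mathbb{R}^{2n})$, $[\phi,\psi](\xi,\xi')=\int_{\mathbb{R}^{n}}Z_{W}\phi(\xi,\xi',\eta)\overline{Z_{W}\psi(\xi,\xi',\eta)}\,d\eta$ for a.e. $(\xi,\xi')\in\mathbb{T}^{n}\times\mathbb{T}^{n}$. A countable family $\{f_{j}\}$ is a Riesz basis for a Hilbert space $\mathcal{H}$ if it is the image of an orthonormal basis of $\mathcal{H}$ under a bounded invertible operator on $\mathcal{H}$; equivalently, it is complete in $\mathcal{H}$ and there are $A,B>0$ with $A\sum|c_{j}|^{2}\leq\|\sum c_{j}f_{j}\|^{2}\leq B\sum|c_{j}|^{2}$ for all finite scalar sequences $\{c_{j}\}$. It is a Riesz sequence if it is a Riesz basis for its closed linear span. *)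

(* Defs.v *)
From HB Require Import structures.
From mathcomp Require Import all_boot all_order all_algebra finmap.
From mathcomp Require Import all_classical all_reals all_analysis.
From mathcomp Require Import complex.

Set Implicit Arguments.
Unset Strict Implicit.
Unset Printing Implicit Defensive.
Import Order.TTheory GRing.Theory Num.Theory.
Import numFieldNormedType.Exports.

Local Open Scope classical_set_scope.
Local Open Scope ring_scope.
Local Open Scope complex_scope.

(* Points of R^n are n-tuples with the product Borel sigma-algebra; R^(2n) is
   Rn R n * Rn R n. *)
Notation Rn R n := (n.-tuple (measurableTypeR R)).
Notation Zn n := (n.-tuple int).

(* The library only gives m1 \x m2 a sigma-finite structure when m1 and m2 are
   subprobabilities; this copy carries it for all sigma-finite measures, so
   that products can be iterated. *)
Section prod_measure.
Context d1 d2 (T1 : measurableType d1) (T2 : measurableType d2) (R : realType).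
Variable m1 : {sigma_finite_measure set T1 -> \bar R}.
Variable m2 : {sigma_finite_measure set T2 -> \bar R}.
Local Open Scope ereal_scope.

Definition prod_measure : set (T1 * T2) -> \bar R := m1 \x m2.

HB.instance Definition _ := Measure.on prod_measure.

Let prod_measure_sigma_finite : sigma_finite setT prod_measure.
Proof.
have /sigma_finiteP[F [TF ndF Foo]] := sigma_finiteT m1.
have /sigma_finiteP[G [TG ndG Goo]] := sigma_finiteT m2.
exists (fun n => F n `*` G n) => [|k].
  rewrite -setXTT TF TG predeqE => -[x y]; split.
    move=> [/= [n _ Fnx] [k _ Gky]]; exists (maxn n k) => //; split.
    - by move: x Fnx; exact/subsetPset/ndF/leq_maxl.
    - by move: y Gky; exact/subsetPset/ndG/leq_maxr.
  by move=> [n _ []/= ? ?]; split; exists n.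
have [? ?] := Foo k; have [? ?] := Goo k.
split; first exact: measurableX.
by rewrite /prod_measure product_measure1E// lte_mul_pinfty// ge0_fin_numE.
Qed.

HB.instance Definition _ := Measure_isSigmaFinite.Build _ _ _ prod_measure
  prod_measure_sigma_finite.

End prod_measure.

Section lebesgue_cons.
Context {R : realType} {n : nat}.
Variable nu : {sigma_finite_measure set (Rn R n) -> \bar R}.
Local Open Scope ereal_scope.

Definition tuple_cons (p : measurableTypeR R * Rn R n) : Rn R n.+1 :=
  [tuple of p.1 :: p.2].

Lemma measurable_tuple_cons : measurable_fun [set: _] tuple_cons.
Proof. exact: (@measurable_cons _ _ _ _ fst n snd). Qed.

HB.instance Definition _ :=
  isMeasurableFun.Build _ _ _ _ tuple_cons measurable_tuple_cons.

Definition lebesgue_cons : set (Rn R n.+1) -> \bar R :=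
  pushforward (prod_measure (@lebesgue_measure R) nu) tuple_cons.

Let lebesgue_cons0 : lebesgue_cons set0 = 0.
Proof. exact: measure0. Qed.

Let lebesgue_cons_ge0 A : 0 <= lebesgue_cons A.
Proof. exact: measure_ge0. Qed.

Let lebesgue_cons_sigma_additive : semi_sigma_additive lebesgue_cons.
Proof. exact: measure_semi_sigma_additive. Qed.

HB.instance Definition _ := isMeasure.Build _ _ _ lebesgue_cons
  lebesgue_cons0 lebesgue_cons_ge0 lebesgue_cons_sigma_additive.

Let tuple_uncons (x : Rn R n.+1) : measurableTypeR R * Rn R n :=
  (thead x, [tuple of behead x]).

Let measurable_tuple_uncons : measurable_fun [set: _] tuple_uncons.
Proof.
apply: measurable_fun_pair; first exact: measurable_tnth.
exact: measurable_behead.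
Qed.

Let tuple_consK : cancel tuple_cons tuple_uncons.
Proof. by move=> [x y]; congr pair; exact: val_inj. Qed.

Let lebesgue_cons_sigma_finite : sigma_finite setT lebesgue_cons.
Proof.
have [F FT Foo] := sigma_finiteT (prod_measure (@lebesgue_measure R) nu).
exists (fun i => tuple_uncons @^-1` F i) => [|i].
  by rewrite -preimage_bigcup -FT preimage_setT.
have [mF ltF] := Foo i; split.
  by rewrite -[X in measurable X]setTI; exact: measurable_tuple_uncons.
rewrite /lebesgue_cons /pushforward -comp_preimage.
rewrite (_ : _ \o _ = id) ?preimage_id//.
by apply/funext => p; exact: tuple_consK.
Qed.

HB.instance Definition _ := Measure_isSigmaFinite.Build _ _ _ lebesgue_cons
  lebesgue_cons_sigma_finite.

End lebesgue_cons.

(* Lebesgue measure on R^n: the point mass on R^0, and the product of Lebesgue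
   measures transported along R * R^n ~ R^(n+1) on R^(n+1). *)
Fixpoint lebesgue_tuple (R : realType) (n : nat) :
    {sigma_finite_measure set (Rn R n) -> \bar R} :=
  match n with
  | 0 => \d_([tuple] : Rn R 0)
  | n'.+1 => lebesgue_cons (lebesgue_tuple R n')
  end.

Section torus_measure.
Variables (R : realType) (n : nat).

Definition unit_cube : set (Rn R n) :=
  [set x | forall i, 0 <= (tnth x i : R) < 1].

Lemma measurable_unit_cube : measurable unit_cube.
Proof.
rewrite (_ : unit_cube =
    \bigcap_(i in setT) (fun x : Rn R n => tnth x i) @^-1` `[0%R, 1%R[).
  apply: fin_bigcap_measurable => // i _.
  by rewrite -[X in measurable X]setTI; exact: measurable_tnth.
apply/seteqP; split=> x h i => [_|]; first by rewrite /= in_itv; exact: h.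
by have := h i I; rewrite /= in_itv.
Qed.

(* The torus T^n is [0,1)^n, and functions on it are functions on R^n of which
   only the values on [0,1)^n matter. *)
Definition torus_measure : set (Rn R n) -> \bar R :=
  mrestr (lebesgue_tuple R n) measurable_unit_cube.

HB.instance Definition _ := Measure.on torus_measure.

Let torus_measure_sigma_finite : sigma_finite setT torus_measure.
Proof.
have [F FT Foo] := sigma_finiteT (lebesgue_tuple R n).
exists F => // i; have [mF ltF] := Foo i; split => //.
rewrite /torus_measure /mrestr (le_lt_trans _ ltF)//.
by apply: le_measure; rewrite ?inE//; apply: measurableI => //;
  exact: measurable_unit_cube.
Qed.

HB.instance Definition _ := Measure_isSigmaFinite.Build _ _ _ torus_measure
  torus_measure_sigma_finite.

End torus_measure.
Arguments torus_measure : clear implicits.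

Section complex_functions.
Context d (T : measurableType d) (R : realType).
Variable mu : {measure set T -> \bar R}.
Implicit Types f : T -> R[i].

Definition cmeasurable f : Prop :=
  measurable_fun [set: T] (fun x => complex.Re (f x)) /\
  measurable_fun [set: T] (fun x => complex.Im (f x)).

Definition cLnorm (p : \bar R) f : \bar R :=
  Lnorm mu p (fun x => (Normc.normc (f x))%:E).

Definition inLp (p : \bar R) f : Prop := cmeasurable f /\ (cLnorm p f < +oo)%E.

Definition cintegral f : R[i] :=
  (\int[mu]_x complex.Re (f x)) +i* (\int[mu]_x complex.Im (f x)).

End complex_functions.

Section riesz.
Context d (T : measurableType d) (R : realType).
Variables (mu : {measure set T -> \bar R}) (J : choiceType).
Implicit Types (f : J -> T -> R[i]) (c : J -> R[i]).

Definition lin_comb f (F : {fset J}) c : T -> R[i] :=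
  fun x => \sum_(j <- F) c j * f j x.

(* Elements of L^2(mu) are represented by measurable functions, without taking
   the quotient by a.e. equality. *)
Definition closed_span f : set (T -> R[i]) :=
  [set g | inLp mu 2%:E g /\
    forall e : R, 0 < e -> exists (F : {fset J}) (c : J -> R[i]),
      (cLnorm mu 2%:E (fun x => g x - lin_comb f F c x)%R < e%:E)%E].

Definition riesz_basis (H : set (T -> R[i])) f : Prop :=
  closed_span f = H /\
  exists A B : R, [/\ 0 < A, 0 < B &
    forall (F : {fset J}) (c : J -> R[i]),
      ((A * \sum_(j <- F) Normc.normc (c j) ^+ 2)%R%:E
         <= cLnorm mu 2%:E (lin_comb f F c) ^+ 2
         <= (B * \sum_(j <- F) Normc.normc (c j) ^+ 2)%R%:E)%E].

Definition riesz_sequence f : Prop := riesz_basis (closed_span f) f.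

End riesz.

Section weyl_zak.
Context {R : realType} {n : nat}.
Local Notation Rn := (Rn R n).
Local Notation Zn := (Zn n).
Local Notation lambda := (lebesgue_tuple R n).
Local Notation TT := (torus_measure R n).
Local Notation lambda2 := (prod_measure lambda lambda).
Local Notation TT2 := (prod_measure TT TT).

Definition vadd (x y : Rn) : Rn :=
  [tuple (tnth x i : R) + (tnth y i : R) | i < n].
Definition vsub (x y : Rn) : Rn :=
  [tuple (tnth x i : R) - (tnth y i : R) | i < n].
Definition vdot (x y : Rn) : R := \sum_(i < n) (tnth x i : R) * (tnth y i : R).
Definition vec_of_Zn (k : Zn) : Rn := [tuple (tnth k i)%:~R : R | i < n].

(* expi t = e^(it) *)
Definition expi (t : R) : R[i] := cos t +i* sin t.

Definition twisted_translation (kl : Zn * Zn) (phi : Rn * Rn -> R[i]) :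
    Rn * Rn -> R[i] :=
  fun xy =>
    let k := vec_of_Zn kl.1 in let l := vec_of_Zn kl.2 in
    expi (pi * (vdot xy.1 l - vdot xy.2 k)) * phi (vsub xy.1 k, vsub xy.2 l).

(* The integral formula for the Weyl kernel, meaningful on L^1 `&` L^2. *)
Definition weyl_integral (phi : Rn * Rn -> R[i]) : Rn * Rn -> R[i] :=
  fun p => cintegral lambda (fun x =>
    phi (x, vsub p.2 p.1) * expi (pi * vdot x (vadd p.1 p.2))).

(* K represents the value at phi of the extension by density of weyl_integral
   from L^1 `&` L^2 to L^2. *)
Definition is_weyl_kernel (phi K : Rn * Rn -> R[i]) : Prop :=
  inLp lambda2 2%:E K /\
  exists phi_ : nat -> Rn * Rn -> R[i],
    [/\ forall j, inLp lambda2 1%:E (phi_ j) /\ inLp lambda2 2%:E (phi_ j),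
       (fun j => cLnorm lambda2 2%:E (fun p => phi_ j p - phi p)) @ \oo --> 0%E &
       (fun j => cLnorm lambda2 2%:E (fun p => weyl_integral (phi_ j) p - K p))
         @ \oo --> 0%E].

Definition weyl_kernel (phi : Rn * Rn -> R[i]) : Rn * Rn -> R[i] :=
  xget (fun=> 0) [set K | is_weyl_kernel phi K].

Definition zak_term (K : Rn * Rn -> R[i]) (m : Zn) : Rn * Rn * Rn -> R[i] :=
  fun p => let: (xi, xi', eta) := p in
    K (vadd (vec_of_Zn m) xi, eta) * expi (- (2 * pi * vdot (vec_of_Zn m) xi')).

(* The series over Z^n defining Z_W converges unconditionally in
   L^2(T^n x T^n x R^n), in general not pointwise. *)
Definition is_weyl_zak (phi : Rn * Rn -> R[i]) (Z : Rn * Rn * Rn -> R[i]) :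
    Prop :=
  inLp (prod_measure TT2 lambda) 2%:E Z /\
  forall e : R, 0 < e -> exists F0 : {fset Zn}, forall F : {fset Zn},
    (F0 `<=` F)%fset ->
    (cLnorm (prod_measure TT2 lambda) 2%:E
      (fun p => Z p - \sum_(m <- F) zak_term (weyl_kernel phi) m p)%R
      < e%:E)%E.

Definition weyl_zak (phi : Rn * Rn -> R[i]) : Rn * Rn * Rn -> R[i] :=
  xget (fun=> 0) [set Z | is_weyl_zak phi Z].

Definition bracket (phi psi : Rn * Rn -> R[i]) : Rn * Rn -> R[i] :=
  fun p => cintegral lambda (fun eta =>
    weyl_zak phi (p, eta) * (weyl_zak psi (p, eta))^*).

End weyl_zak.

(* Main.v *)
(* In the coordinates (xi, u = eta - xi) the Weyl kernel is a Fourier transform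
   in the first variable, so it is isometric by Plancherel's theorem, which is
   reduced to Parseval's identity on the torus: the values on a coset v + Z^n of
   the Fourier transform of a function g with bounded support are the Fourier
   coefficients of a quasi-periodization of g, and integration over v in the
   torus gives back the norm of g.  The Zak transform turns the twisted
   translation by (k, l) into the multiplication by a unimodular constant times
   the character chi_(k,l)(xi, xi') = e^(2 i pi (k.xi + l.xi')).  Hence
     || sum_(k,l) c_(k,l) T_(k,l) phi ||^2
       = \int_(T^n x T^n) | sum_(k,l) c'_(k,l) chi_(k,l) |^2 [phi, phi],
   with |c'| = |c|, whereas the same integral without the weight [phi, phi] is
   the sum of the |c_(k,l)|^2.  Bounds on [phi, phi] thus give the Riesz bounds.
   Conversely, an integrable function u whose integral against every |P|^2, P a
   trigonometric polynomial, is nonnegative is itself nonnegative a.e., because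
   [0, 1]-valued trigonometric polynomials approximate the indicator function of
   {u < 0} in L^1(|u|); this applies to [phi, phi] - A and B - [phi, phi]. *)

(* Functions stand for their classes, and [weyl_kernel] and [weyl_zak] are choices with default 0,
   so nothing can be said of the bracket before existence is proved; this is where completeness of
   L^2 enters. Squared norms live in the extended reals, as integrals of nonnegative functions:
   Tonelli's theorem and Fatou's lemma then apply without integrability conditions, and limits rest
   on |z + w|^2 <= (1 + e) |z|^2 + (1 + 1/e) |w|^2 in place of the triangle inequality.
   Trigonometric approximation is obtained by measure theory. For an integrable weight g, the sets
   whose indicators are L^1(g)-limits of [0, 1]-valued polynomials form a sigma-algebra, because the
   bound by 1 makes products and dominated limits harmless. Arcs belong to it through the
   polynomials (1 - s^j)^(j 2^j) in a trigonometric polynomial s with values in [0, 1]. The result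
   is used twice: with g = 1 for the L^2 density behind Parseval's identity, and with g = |u| for
   the positivity criterion, where u is only integrable. *)
Require Import Defs.
From mathcomp Require Import all_boot all_order all_algebra finmap.
From mathcomp Require Import all_classical all_reals all_analysis.
From mathcomp Require Import complex ring lra measurable_realfun.

Set Implicit Arguments.
Unset Strict Implicit.
Unset Printing Implicit Defensive.
Import Order.TTheory GRing.Theory Num.Theory.
Import numFieldNormedType.Exports.
Local Open Scope classical_set_scope.
Local Open Scope complex_scope.
Local Open Scope ring_scope.

(** * Square-integrable complex functions *)

Section complex_algebra.
Context {R : realType}.
Implicit Types (z w : R[i]) (t s : R).
Local Notation Re := complex.Re.
Local Notation Im := complex.Im.

(** The squared modulus as a polynomial in the coordinates, free of the square root in
    [Normc.normc], so that identities are left to [ring]. *)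
Definition sqc z : R := Re z ^+ 2 + Im z ^+ 2.

Lemma ReD z w : Re (z + w) = Re z + Re w. Proof. by case: z; case: w. Qed.
Lemma ImD z w : Im (z + w) = Im z + Im w. Proof. by case: z; case: w. Qed.
Lemma ReN z : Re (- z) = - Re z. Proof. by case: z. Qed.
Lemma ImN z : Im (- z) = - Im z. Proof. by case: z. Qed.
Lemma ReM z w : Re (z * w) = Re z * Re w - Im z * Im w.
Proof. by case: z; case: w. Qed.
Lemma ImM z w : Im (z * w) = Re z * Im w + Im z * Re w.
Proof. by case: z; case: w. Qed.
Lemma ReJ z : Re z^* = Re z. Proof. by case: z. Qed.
Lemma ImJ z : Im z^* = - Im z. Proof. by case: z. Qed.
Lemma complexP z w : Re z = Re w -> Im z = Im w -> z = w.
Proof. by case: z => a b; case: w => c d /= -> ->. Qed.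

Lemma conjM z w : (z * w)^* = z^* * w^*.
Proof. by apply: complexP; rewrite ?ReM ?ImM !ReJ !ImJ ?ReM ?ImM; ring. Qed.
Lemma conjB z w : (z - w)^* = z^* - w^*.
Proof. by apply: complexP; rewrite ?ReJ ?ImJ ?ReD ?ImD ?ReN ?ImN ?ReJ ?ImJ//; ring. Qed.
Lemma conjK z : z^*^* = z.
Proof. by apply: complexP; rewrite ?ReJ ?ImJ ?ReJ ?ImJ ?opprK. Qed.

Lemma Re_sum (I : Type) (r : seq I) (F : I -> R[i]) :
  Re (\sum_(i <- r) F i) = \sum_(i <- r) Re (F i).
Proof. by elim/big_rec2: _ => //= i x y _ <-; rewrite ReD. Qed.
Lemma Im_sum (I : Type) (r : seq I) (F : I -> R[i]) :
  Im (\sum_(i <- r) F i) = \sum_(i <- r) Im (F i).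
Proof. by elim/big_rec2: _ => //= i x y _ <-; rewrite ImD. Qed.

Lemma sqc_ge0 z : 0 <= sqc z.
Proof. by rewrite addr_ge0// sqr_ge0. Qed.

Lemma sqc0 : sqc 0 = 0. Proof. by rewrite /sqc /= expr0n addr0. Qed.

Lemma sqcN z : sqc (- z) = sqc z.
Proof. by rewrite /sqc ReN ImN !sqrrN. Qed.

Lemma sqcM z w : sqc (z * w) = sqc z * sqc w.
Proof. by rewrite /sqc ReM ImM; ring. Qed.

Lemma sqcJ z : sqc z^* = sqc z.
Proof. by rewrite /sqc ReJ ImJ sqrrN. Qed.

Lemma sqc_real t : sqc t%:C = t ^+ 2.
Proof. by rewrite /sqc /= expr0n addr0. Qed.

Lemma sqcE z : z * z^* = (sqc z)%:C.
Proof. by apply: complexP; rewrite ?ReM ?ImM ReJ ImJ /sqc /=; ring. Qed.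

(* [(e a - b)^2 / e >= 0], coordinatewise *)
Lemma sqcD_eps z w (e : R) : 0 < e ->
  sqc (z + w) <= (1 + e) * sqc z + (1 + e^-1) * sqc w.
Proof.
move=> e0; rewrite /sqc ReD ImD.
suff H a b : (a + b) ^+ 2 <= (1 + e) * a ^+ 2 + (1 + e^-1) * b ^+ 2.
  by have := H (Re z) (Re w); have := H (Im z) (Im w); lra.
rewrite -subr_ge0 (_ : _ - _ = (e * a - b) ^+ 2 / e); last by field; lra.
by rewrite divr_ge0 ?sqr_ge0// ltW.
Qed.

Lemma sqcD2 z w : sqc (z + w) <= 2 * (sqc z + sqc w).
Proof. by have := @sqcD_eps z w 1 ltr01; rewrite invr1; lra. Qed.

Lemma sqcB2 z w : sqc (z - w) <= 2 * (sqc z + sqc w).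
Proof. by rewrite -(sqcN w) sqcD2. Qed.

Lemma sqc_eq0 z : sqc z = 0 -> z = 0.
Proof.
move/eqP; rewrite paddr_eq0 ?sqr_ge0// !sqrf_eq0 => /andP[/eqP a /eqP b].
exact: complexP.
Qed.

Lemma normc_sqrt z : Normc.normc z = Num.sqrt (sqc z).
Proof. by case: z. Qed.

Lemma normc_ge0 z : 0 <= Normc.normc z.
Proof. by rewrite normc_sqrt sqrtr_ge0. Qed.

Lemma normc_sqr z : Normc.normc z ^+ 2 = sqc z.
Proof. by rewrite normc_sqrt sqr_sqrtr// sqc_ge0. Qed.

Lemma normc_Re z : `|Re z| <= Normc.normc z.
Proof.
rewrite -(@ler_pXn2r _ 2) ?nnegrE ?normc_ge0// normc_sqr real_normK ?num_real//.
by rewrite lerDl sqr_ge0.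
Qed.

Lemma normc_Im z : `|Im z| <= Normc.normc z.
Proof.
rewrite -(@ler_pXn2r _ 2) ?nnegrE ?normc_ge0// normc_sqr real_normK ?num_real//.
by rewrite lerDr sqr_ge0.
Qed.

Lemma expiD t s : expi (t + s) = expi t * expi s.
Proof.
apply: complexP; rewrite ?ReM ?ImM /= ?cosD ?sinD //.
by rewrite addrC (mulrC (sin t)) addrC.
Qed.

Lemma expi0 : expi (0 : R) = 1.
Proof. by rewrite /expi cos0 sin0. Qed.

Lemma expiN t : expi (- t) = (expi t)^*.
Proof. by rewrite /expi cosN sinN. Qed.

Lemma sqc_expi t : sqc (expi t) = 1.
Proof. by rewrite /sqc /= cos2Dsin2. Qed.

Lemma expi_2piz (k : int) : expi (2 * pi * k%:~R : R) = 1.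
Proof.
have H (m : nat) : expi (2 * pi * m%:R : R) = 1.
  elim: m => [|m IH]; first by rewrite mulr0 expi0.
  rewrite -(addn1 m) (natrD _ m 1) mulrDr expiD IH mul1r mulr1 mulr_natl /expi.
  by rewrite cos2pi sin2pi.
case: k => m; first by rewrite -pmulrn H.
by rewrite NegzE mulrNz mulrN expiN -pmulrn H; apply: complexP => //=; rewrite oppr0.
Qed.

End complex_algebra.

Section cmeasurable_theory.
Context d (T : measurableType d) (R : realType).
Implicit Types f g : T -> R[i].

Lemma cmeasurable_cst (c : R[i]) : cmeasurable (fun _ : T => c).
Proof. by split; exact: measurable_cst. Qed.

Lemma cmeasurable_real (f : T -> R) :
  measurable_fun setT f -> cmeasurable (fun x => (f x)%:C).
Proof. by move=> mf; split => //; exact: measurable_cst. Qed.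

Lemma cmeasurableD f g :
  cmeasurable f -> cmeasurable g -> cmeasurable (fun x => f x + g x).
Proof.
move=> [f1 f2] [g1 g2]; split.
  under eq_fun do rewrite ReD; exact: measurable_funD.
under eq_fun do rewrite ImD; exact: measurable_funD.
Qed.

Lemma cmeasurableN f : cmeasurable f -> cmeasurable (fun x => - f x).
Proof.
move=> [f1 f2]; split.
  by under eq_fun do rewrite ReN; exact: measurableT_comp f1.
by under eq_fun do rewrite ImN; exact: measurableT_comp f2.
Qed.

Lemma cmeasurableB f g :
  cmeasurable f -> cmeasurable g -> cmeasurable (fun x => f x - g x).
Proof. by move=> mf mg; apply: cmeasurableD => //; exact: cmeasurableN. Qed.

Lemma cmeasurableM f g :
  cmeasurable f -> cmeasurable g -> cmeasurable (fun x => f x * g x).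
Proof.
move=> [f1 f2] [g1 g2]; split.
  by under eq_fun do rewrite ReM; apply: measurable_funB; exact: measurable_funM.
by under eq_fun do rewrite ImM; apply: measurable_funD; exact: measurable_funM.
Qed.

Lemma cmeasurableJ f : cmeasurable f -> cmeasurable (fun x => (f x)^*).
Proof.
move=> [f1 f2]; split; first by under eq_fun do rewrite ReJ.
by under eq_fun do rewrite ImJ; exact: measurableT_comp f2.
Qed.

Lemma cmeasurable_expi (f : T -> R) :
  measurable_fun setT f -> cmeasurable (fun x => expi (f x)).
Proof.
move=> mf; split; rewrite /=.
  by apply: measurableT_comp mf; apply: continuous_measurable_fun;
    exact: continuous_cos.
by apply: measurableT_comp mf; apply: continuous_measurable_fun;
  exact: continuous_sin.
Qed.

Lemma cmeasurable_sum (I : Type) (r : seq I) (F : I -> T -> R[i]) :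
  (forall i, cmeasurable (F i)) -> cmeasurable (fun x => \sum_(i <- r) F i x).
Proof.
move=> mF; elim: r => [|i r IH].
  by under eq_fun do rewrite big_nil; exact: cmeasurable_cst.
by under eq_fun do rewrite big_cons; exact: cmeasurableD.
Qed.

Lemma cmeasurable_comp d' (S : measurableType d') (h : S -> T) f :
  cmeasurable f -> measurable_fun setT h -> cmeasurable (fun x => f (h x)).
Proof.
by move=> [f1 f2] mh; split; [exact: measurableT_comp f1 mh|
  exact: measurableT_comp f2 mh].
Qed.

Lemma measurable_sqc f :
  cmeasurable f -> measurable_fun setT (fun x => sqc (f x)).
Proof. by move=> [f1 f2]; apply: measurable_funD; exact: measurable_funX. Qed.

Lemma emeasurable_sqc f :
  cmeasurable f -> measurable_fun setT (fun x => (sqc (f x))%:E).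
Proof. by move=> /measurable_sqc/measurable_EFinP. Qed.

Lemma measurable_normc f :
  cmeasurable f -> measurable_fun setT (fun x => Normc.normc (f x)).
Proof.
move=> mf; under eq_fun do rewrite normc_sqrt -powR12_sqrt ?sqc_ge0//.
by apply: (measurableT_comp (measurable_powR _)); exact: measurable_sqc.
Qed.

End cmeasurable_theory.

(** * The squared L^2 norm *)

Section nsq.
Context d (T : measurableType d) (R : realType).
Variable mu : {measure set T -> \bar R}.
Implicit Types f g : T -> R[i].
Local Open Scope ereal_scope.

(** Extended-real valued, so that it makes sense for every measurable [f] and finiteness can be
    established afterwards. *)
Definition nsq f : \bar R := \int[mu]_x (sqc (f x))%:E.

Lemma nsq_ge0 f : 0 <= nsq f.
Proof. by apply: integral_ge0 => x _; rewrite lee_fin sqc_ge0. Qed.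

Lemma cLnorm2E f : cLnorm mu 2%:E f = nsq f `^ 2^-1.
Proof.
rewrite /cLnorm unlock /nsq; congr (_ `^ _); apply: eq_integral => x _.
by rewrite abse_EFin poweR_EFin powR_mulrn// ger0_norm ?normc_ge0// normc_sqr.
Qed.

Lemma cLnorm2_sqr f : cLnorm mu 2%:E f ^+ 2 = nsq f.
Proof.
rewrite cLnorm2E; have := nsq_ge0 f; case: (nsq f) => [r|_|//].
  rewrite lee_fin => r0; rewrite poweR_EFin -EFin_expe.
  by rewrite powR12_sqrt// sqr_sqrtr.
by rewrite poweRyr ?invr_neq0// expe2 mulyy.
Qed.

Lemma cLnorm2_lt f (e : R) : (0 < e)%R ->
  (cLnorm mu 2%:E f < e%:E) = (nsq f < (e ^+ 2)%:E).
Proof.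
move=> e0; have := nsq_ge0 f; rewrite cLnorm2E.
case: (nsq f) => [r|_|//]; last by rewrite poweRyr ?invr_neq0// !ltNge !leey.
rewrite lee_fin => r0; rewrite poweR_EFin !lte_fin powR12_sqrt//.
by rewrite -[X in (_ < X)%R = _](gtr0_norm e0) -sqrtr_sqr ltr_sqrt// exprn_gt0.
Qed.

Lemma cLnorm2_lty f : (cLnorm mu 2%:E f < +oo) = (nsq f < +oo).
Proof.
have := nsq_ge0 f; rewrite cLnorm2E; case: (nsq f) => [r|_|//].
  by move=> _; rewrite poweR_EFin !ltry.
by rewrite poweRyr ?invr_neq0// !ltxx.
Qed.

Lemma le_nsq f g : cmeasurable f -> cmeasurable g ->
  (forall x, sqc (f x) <= sqc (g x))%R -> nsq f <= nsq g.
Proof.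
move=> mf mg fg; apply: ge0_le_integral => //.
- by move=> x _; rewrite lee_fin sqc_ge0.
- exact: emeasurable_sqc.
- exact: emeasurable_sqc.
- by move=> x _; rewrite lee_fin fg.
Qed.

Lemma eq_nsq f g : (forall x, sqc (f x) = sqc (g x)) -> nsq f = nsq g.
Proof. by move=> fg; apply: eq_integral => x _; rewrite fg. Qed.

Lemma ae_eq_nsq f g : cmeasurable f -> cmeasurable g ->
  {ae mu, forall x, f x = g x} -> nsq f = nsq g.
Proof.
move=> mf mg fg; apply: ge0_ae_eq_integral => //.
- exact: emeasurable_sqc.
- exact: emeasurable_sqc.
- by move=> x _; rewrite lee_fin sqc_ge0.
- by move=> x _; rewrite lee_fin sqc_ge0.
- by apply: filterS fg => x -> _.
Qed.

Lemma nsqZ (c : R[i]) f : cmeasurable f ->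
  nsq (fun x => c * f x)%R = (sqc c)%:E * nsq f.
Proof.
move=> mf; rewrite /nsq -ge0_integralZl ?lee_fin ?sqc_ge0//.
- by apply: eq_integral => x _; rewrite sqcM EFinM.
- exact: emeasurable_sqc.
- by move=> x _; rewrite lee_fin sqc_ge0.
Qed.

Lemma nsqN f : nsq (fun x => - f x)%R = nsq f.
Proof. by apply: eq_nsq => x; rewrite sqcN. Qed.

Lemma nsqC f g : nsq (fun x => f x - g x)%R = nsq (fun x => g x - f x)%R.
Proof. by rewrite -nsqN; apply: eq_nsq => x; rewrite opprB. Qed.

(** Stands in for Minkowski's inequality: when [nsq g] tends to 0, a small [e] fixed beforehand
    gives continuity of [nsq]. *)
Lemma nsqD_eps f g (e : R) : cmeasurable f -> cmeasurable g -> (0 < e)%R ->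
  nsq (fun x => f x + g x)%R <= (1 + e)%:E * nsq f + (1 + e^-1)%:E * nsq g.
Proof.
move=> mf mg e0.
have e1 : (0 <= 1 + e)%R by rewrite addr_ge0// ltW.
have e2 : (0 <= 1 + e^-1)%R by rewrite addr_ge0// invr_ge0 ltW.
rewrite /nsq -!ge0_integralZl ?lee_fin//; first last.
- by move=> x _; rewrite lee_fin sqc_ge0.
- exact: emeasurable_sqc.
- by move=> x _; rewrite lee_fin sqc_ge0.
- exact: emeasurable_sqc.
rewrite -ge0_integralD//; first last.
- by apply: measurable_funeM; exact: emeasurable_sqc.
- by move=> x _; rewrite mule_ge0 ?lee_fin ?sqc_ge0.
- by apply: measurable_funeM; exact: emeasurable_sqc.
- by move=> x _; rewrite mule_ge0 ?lee_fin ?sqc_ge0.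
apply: ge0_le_integral => //.
- by move=> x _; rewrite lee_fin sqc_ge0.
- by apply: emeasurable_sqc; exact: cmeasurableD.
- by apply: emeasurable_funD; apply: measurable_funeM; exact: emeasurable_sqc.
- by move=> x _; rewrite -!EFinM -EFinD lee_fin sqcD_eps.
Qed.

Lemma nsqD2 f g : cmeasurable f -> cmeasurable g ->
  nsq (fun x => f x + g x)%R <= 2%:E * (nsq f + nsq g).
Proof.
move=> mf mg; rewrite ge0_muleDr ?nsq_ge0//.
by have := nsqD_eps mf mg ltr01; rewrite invr1.
Qed.

Lemma nsqD_lty f g : cmeasurable f -> cmeasurable g ->
  nsq f < +oo -> nsq g < +oo -> nsq (fun x => f x + g x)%R < +oo.
Proof.
move=> mf mg fy gy; apply: (le_lt_trans (nsqD2 mf mg)).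
by rewrite lte_mul_pinfty// ?adde_ge0 ?nsq_ge0// lte_add_pinfty.
Qed.

Lemma nsqB_lty f g : cmeasurable f -> cmeasurable g ->
  nsq f < +oo -> nsq g < +oo -> nsq (fun x => f x - g x)%R < +oo.
Proof.
by move=> mf mg fy gy; apply: nsqD_lty; rewrite ?nsqN//; exact: cmeasurableN.
Qed.

Lemma nsqZ_lty (c : R[i]) f : cmeasurable f ->
  nsq f < +oo -> nsq (fun x => c * f x)%R < +oo.
Proof.
by move=> mf fy; rewrite nsqZ// lte_mul_pinfty// lee_fin sqc_ge0.
Qed.

Lemma nsq_triangle f g h : cmeasurable f -> cmeasurable g -> cmeasurable h ->
  nsq (fun x => f x - h x)%R <=
    2%:E * (nsq (fun x => f x - g x)%R + nsq (fun x => g x - h x)%R).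
Proof.
move=> mf mg mh; rewrite (_ : (fun x => f x - h x)%R =
    (fun x => (f x - g x) + (g x - h x))%R); last first.
  by apply/funext => x; rewrite addrA subrK.
by apply: nsqD2; exact: cmeasurableB.
Qed.

Lemma nsq_sum_lty (I : Type) (r : seq I) (F : I -> T -> R[i]) :
  (forall i, cmeasurable (F i)) -> (forall i, nsq (F i) < +oo) ->
  nsq (fun x => \sum_(i <- r) F i x)%R < +oo.
Proof.
move=> mF Fy; elim: r => [|i r IH].
  rewrite /nsq; under eq_integral do rewrite big_nil sqc0.
  by rewrite integral0.
under eq_fun do rewrite big_cons.
by apply: nsqD_lty => //; exact: cmeasurable_sum.
Qed.

Lemma inLp2P f : inLp mu 2%:E f <-> cmeasurable f /\ nsq f < +oo.
Proof. by rewrite /inLp cLnorm2_lty. Qed.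

End nsq.

(** * Fatou's lemma and completeness of L^2 *)

Section nsq_limits.
Context d (T : measurableType d) (R : realType).
Variable mu : {measure set T -> \bar R}.
Implicit Types f g : T -> R[i].

Lemma limn_einf_le (u : nat -> \bar R) (C : \bar R) (N : nat) :
  (forall n, (N <= n)%N -> (u n <= C)%E) -> (limn_einf u <= C)%E.
Proof.
move=> uC; rewrite limn_einf_lim; apply: lime_le; first exact: is_cvg_einfs.
apply: nearW => n; apply: (@le_trans _ _ (u (maxn n N))).
  by apply: ereal_inf_lbound; exists (maxn n N) => //=; rewrite leq_maxl.
by apply: uC; rewrite leq_maxr.
Qed.

Lemma fatou_le (f_ : nat -> T -> \bar R) (f : T -> \bar R) (C : \bar R) (N : nat) :
  (forall j, measurable_fun setT (f_ j)) -> measurable_fun setT f ->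
  (forall j x, (0 <= f_ j x)%E) -> (forall x, (0 <= f x)%E) ->
  {ae mu, forall x, f_ ^~ x @ \oo --> f x} ->
  (forall j, (N <= j)%N -> (\int[mu]_x f_ j x <= C)%E) ->
  (\int[mu]_x f x <= C)%E.
Proof.
move=> mf_ mf f_0 f0 cvf f_C.
apply: (@le_trans _ _ (limn_einf (fun n => \int[mu]_x f_ n x)%E)); last first.
  exact: limn_einf_le f_C.
apply: le_trans (fatou mu measurableT mf_ (fun n x _ => f_0 n x)).
(* Almost everywhere the lower limit is the limit [f], so the two integrals are equal. *)
rewrite le_eqVlt; apply/orP; left; apply/eqP.
have e0 x : (0 <= limn_einf (f_^~ x))%E.
  rewrite limn_einf_lim; apply: lime_ge; first exact: is_cvg_einfs.
  apply: nearW => n; by apply/ereal_infP => _ [m _ <-].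
apply: ge0_ae_eq_integral => //; first last.
- by apply: filterS cvf => x cvx _; rewrite is_cvg_limn_einfE; [apply/esym/cvg_lim|apply/cvg_ex; exists (f x)].
- rewrite (_ : (fun x => _) = (fun x => - limn_esup (fun n => - f_ n x))%E); last first.
    by apply/funext => x; rewrite -[LHS]oppeK -limn_esupN.
  apply: measurableT_comp => //; apply: measurable_fun_limn_esup => n.
  exact: measurableT_comp.
Qed.

Lemma fatou_nsq (f_ : nat -> T -> R[i]) f (C : \bar R) (N : nat) :
  (forall j, cmeasurable (f_ j)) -> cmeasurable f ->
  {ae mu, forall x, (fun j => complex.Re (f_ j x)) @ \oo --> complex.Re (f x) /\
                    (fun j => complex.Im (f_ j x)) @ \oo --> complex.Im (f x)} ->
  (forall j, (N <= j)%N -> (nsq mu (f_ j) <= C)%E) -> (nsq mu f <= C)%E.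
Proof.
move=> mf_ mf cvf f_C; apply: fatou_le f_C => //.
- by move=> j; exact: emeasurable_sqc.
- exact: emeasurable_sqc.
- by move=> j x; rewrite lee_fin sqc_ge0.
- by move=> x; rewrite lee_fin sqc_ge0.
apply: filterS cvf => x [cr ci]; apply: cvg_EFin; first exact: nearW.
have -> : sqc (f x) = complex.Re (f x) * complex.Re (f x) + complex.Im (f x) * complex.Im (f x).
  by rewrite /sqc !expr2.
under eq_fun do rewrite /= /sqc !expr2.
by apply: cvgD; apply: cvgM.
Qed.

Lemma sum_halfpow (n : nat) : \sum_(0 <= j < n) (2^-1 : R) ^+ j <= 2.
Proof.
suff -> : \sum_(0 <= j < n) (2^-1 : R) ^+ j = 2 - 2 * 2^-1 ^+ n.
  by rewrite lerBlDr lerDl mulr_ge0// exprn_ge0.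
elim: n => [|n IH]; first by rewrite big_nil expr0; lra.
by rewrite big_nat_recr//= IH exprS; lra.
Qed.

(* [a <= c + a^2 / c] with [c = 2^-j] makes the increments summable. *)
Lemma cvg_fast_increments (a : nat -> R) (M : R) :
  (forall n, \sum_(0 <= j < n) 2 ^+ j * (a j.+1 - a j) ^+ 2 <= M) -> cvgn a.
Proof.
move=> aM.
have H : cvgn (series (fun j => a j.+1 - a j)).
  apply: normed_cvg.
  suff : cvgn (series (fun j => `|a j.+1 - a j|)) by [].
  apply: nondecreasing_is_cvgn.
    by apply/nondecreasing_seqP => n; rewrite !seriesEnat/= big_nat_recr//= lerDl.
  exists (2 + M) => _ [n _ <-].
  apply: (@le_trans _ _ (\sum_(0 <= j < n) (2^-1 ^+ j + 2 ^+ j * (a j.+1 - a j) ^+ 2))).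
    apply: ler_sum => j _ /=; set c := a _ - a _.
    have p0 : 0 < (2 : R) ^+ j by rewrite exprn_gt0.
    rewrite -[c ^+ 2]real_normK ?num_real// exprVn; move: p0 (normr_ge0 c).
    move: (2 ^+ j) `|c| => p z p0 z0.
    rewrite -(@ler_pM2l _ p)// mulrDr divff ?gt_eqF//.
    by have := sqr_ge0 (p * z - 1); rewrite !expr2; nra.
  by rewrite big_split/= lerD// sum_halfpow.
rewrite (_ : a = (fun n => series (fun j => a j.+1 - a j) n + a 0%N)).
  by apply: is_cvgD => //; exact: is_cvg_cst.
by apply/funext => n; rewrite /series/= telescope_sumr// subrK.
Qed.

Lemma ae_lty_integral (h : T -> \bar R) : measurable_fun setT h ->
  (forall x, (0 <= h x)%E) -> (\int[mu]_x h x < +oo)%E ->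
  {ae mu, forall x, (h x < +oo)%E}.
Proof.
move=> mh h0 hy; have : mu.-integrable setT h.
  apply/integrableP; split => //.
  by under eq_integral do rewrite gee0_abs//.
move/(integrable_ae measurableT); apply: filterS => x /(_ I).
by rewrite ge0_fin_numE.
Qed.

(** Weighting the squared increments by [2 ^+ j] leaves a series whose integral is at most the sum
    of [2^-1 ^+ j]. It is finite almost everywhere, and there [cvg_fast_increments] applies to both
    coordinates. *)
Lemma fast_cauchy_nsq (f_ : nat -> T -> R[i]) :
  (forall j, cmeasurable (f_ j)) ->
  (forall j, (nsq mu (fun x => f_ j.+1 x - f_ j x)%R <= (4^-1 ^+ j)%:E)%E) ->
  exists f, cmeasurable f /\
  {ae mu, forall x, (fun j => complex.Re (f_ j x)) @ \oo --> complex.Re (f x) /\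
                    (fun j => complex.Im (f_ j x)) @ \oo --> complex.Im (f x)}.
Proof.
move=> mf fast.
pose t j x := (2 ^+ j * sqc (f_ j.+1 x - f_ j x))%:E.
have t0 j x : (0 <= t j x)%E by rewrite lee_fin mulr_ge0 ?sqc_ge0// exprn_ge0.
have mt j : measurable_fun setT (t j).
  apply/measurable_EFinP; apply: measurable_funM => //.
  by apply: measurable_sqc; exact: cmeasurableB.
pose h x := (\sum_(j <oo) t j x)%E.
have h0 x : (0 <= h x)%E by apply: nneseries_ge0.
have mh : measurable_fun setT h by apply: ge0_emeasurable_sum.
have hy : (\int[mu]_x h x < +oo)%E.
  rewrite /h integral_nneseries//.
  apply: (@le_lt_trans _ _ 2%:E); last by rewrite ltry.
  apply: lime_le; first by apply: is_cvg_nneseries => n _ _; apply: integral_ge0.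
  apply: nearW => n.
  apply: (@le_trans _ _ (\sum_(0 <= j < n) ((2^-1 : R) ^+ j)%:E)%E); last first.
    by rewrite sumEFin lee_fin sum_halfpow.
  apply: lee_sum => j _; rewrite /t; under eq_integral do rewrite EFinM.
  rewrite ge0_integralZl//; last 2 first.
  - by apply: emeasurable_sqc; exact: cmeasurableB.
  - by move=> x _; rewrite lee_fin sqc_ge0.
  apply: (@le_trans _ _ ((2 ^+ j)%:E * (4^-1 ^+ j)%:E)%E).
    by apply: lee_wpmul2l; [rewrite lee_fin exprn_ge0|exact: fast].
  rewrite -EFinM lee_fin -exprMn; suff -> : 2 / 4 = 2^-1 :> R by [].
  by lra.
have hfin : {ae mu, forall x, (h x < +oo)%E} by exact: ae_lty_integral.
pose E := [set x | (h x < +oo)%E].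
have mE : measurable E.
  by rewrite -[E]setTI; apply: emeasurable_fun_infty_o => //; exact: mh.
have bnd (p : R[i] -> R) : (forall z w, p (z - w) = p z - p w) ->
    (forall z, p z ^+ 2 <= sqc z) -> forall x, E x -> cvgn (fun j => p (f_ j x)).
  move=> pB psq x Ex; apply: (@cvg_fast_increments _ (fine (h x))) => n.
  rewrite -lee_fin fineK ?ge0_fin_numE//.
  apply: (@le_trans _ _ (\sum_(0 <= j < n) t j x)%E).
    by rewrite sumEFin lee_fin; apply: ler_sum => j _; rewrite -pB ler_wpM2l// exprn_ge0.
  exact: nneseries_lim_ge.
have cR x : E x -> cvgn (fun j => complex.Re (f_ j x)).
  apply: bnd => [z w|z]; first by rewrite ReD ReN.
  by rewrite lerDl sqr_ge0.
have cI x : E x -> cvgn (fun j => complex.Im (f_ j x)).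
  apply: bnd => [z w|z]; first by rewrite ImD ImN.
  by rewrite lerDr sqr_ge0.
have main (p : T -> nat -> R) : (forall j, measurable_fun setT (p ^~ j)) ->
    (forall x, E x -> cvgn (p x)) ->
    exists2 q : T -> R, measurable_fun setT q & forall x, E x -> p x @ \oo --> q x.
  (* Multiplying by the indicator of [E] makes the sequence converge everywhere, so that its limit
     is measurable. *)
  move=> mp cp; exists (fun x => limn (fun j => p x j * \1_E x)).
    apply: (@measurable_fun_cvg _ _ _ _ (fun j x => p x j * \1_E x)).
      by move=> j; apply: measurable_funM => //; exact: measurable_indic.
    move=> x _; have [xE|xE] := pselect (E x).
      by rewrite indicE mem_set//; under eq_fun do rewrite mulr1; exact: cp.
    rewrite indicE memNset//; under eq_fun do rewrite mulr0.
    exact: is_cvg_cst.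
  move=> x xE; rewrite indicE mem_set//; under [X in limn X]eq_fun do rewrite mulr1.
  exact: cp.
have [q mq cq] := main _ (fun j => (mf j).1) cR.
have [r mr cr] := main _ (fun j => (mf j).2) cI.
exists (fun x => q x +i* r x); split => //.
by apply: filterS hfin => x Ex /=; split; [exact: cq|exact: cr].
Qed.

Definition nsq_cauchy (f_ : nat -> T -> R[i]) := forall e : R, 0 < e ->
  exists N, forall j k, (N <= j)%N -> (N <= k)%N ->
    (nsq mu (fun x => f_ j x - f_ k x)%R <= e%:E)%E.

Definition nsq_cvg (f_ : nat -> T -> R[i]) f := forall e : R, 0 < e ->
  exists N, forall j, (N <= j)%N ->
    (nsq mu (fun x => f x - f_ j x)%R <= e%:E)%E.

(** The Riesz-Fischer argument: a fast subsequence converges almost everywhere, and Fatou's lemma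
    along it carries the Cauchy bound over to the limit. *)
Lemma nsq_complete (f_ : nat -> T -> R[i]) :
  (forall j, cmeasurable (f_ j)) -> nsq_cauchy f_ ->
  exists f, [/\ cmeasurable f, nsq_cvg f_ f &
    exists2 s : nat -> nat, (forall j, (j <= s j)%N) &
    {ae mu, forall x, (fun j => complex.Re (f_ (s j) x)) @ \oo --> complex.Re (f x) /\
                    (fun j => complex.Im (f_ (s j) x)) @ \oo --> complex.Im (f x)}].
Proof.
move=> mf cauchy.
have e4 (j : nat) : 0 < (4^-1 : R) ^+ j by rewrite exprn_gt0.
have /choice[N HN] := fun j => cauchy _ (e4 j).
(* Three constraints at once: [s j >= N j] for fast increments, [s] nondecreasing so that [s j.+1]
   also passes [N j], and [s j >= j] so that the subsequence is cofinal. *)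
pose s := fix s j := if j is i.+1 then maxn j (maxn (N j) (s i)) else N 0%N.
have sN j : (N j <= s j)%N.
  by case: j => //= j; rewrite !leq_max leqnn orbT.
have sS j : (s j <= s j.+1)%N by rewrite /= !leq_max leqnn !orbT.
have sj j : (j <= s j)%N by case: j => //= j; rewrite leq_max leqnn.
have smono i j : (i <= j)%N -> (s i <= s j)%N.
  by apply: (@homo_leq _ s _ leqnn leq_trans sS).
have [f [mf' cvf]] := @fast_cauchy_nsq (fun j => f_ (s j)) (fun j => mf _)
  (fun j => HN j _ _ (leq_trans (sN j) (sS j)) (sN j)).
exists f; split => //; last by exists s.
move=> e e0.
have [N1 HN1] := cauchy _ e0; exists N1 => k Nk.
apply: (@fatou_nsq (fun j x => f_ (s j) x - f_ k x) _ _ N1) => //.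
- by move=> j; exact: cmeasurableB.
- exact: cmeasurableB.
- apply: filterS cvf => x [cr ci]; rewrite ReD ReN ImD ImN.
  split.
    by under eq_fun do rewrite ReD ReN; apply: cvgB => //; exact: cvg_cst.
  by under eq_fun do rewrite ImD ImN; apply: cvgB => //; exact: cvg_cst.
- by move=> j Nj; apply: HN1 => //; exact: leq_trans Nj (sj j).
Qed.

End nsq_limits.

(** * Passing norm identities to the limit *)

Section nsq_transfer.
Context d1 (T1 : measurableType d1) d2 (T2 : measurableType d2) (R : realType).
Variables (mu : {measure set T1 -> \bar R}) (nu : {measure set T2 -> \bar R}).

(** The bound is what two applications of [nsqD_eps] produce. First [e] is chosen to control the
    multiples of [b], then [k], which may depend on [e], to control the terms in [1 + e^-1]. *)
Lemma ler_addeps2 (a b : R) : 0 <= b ->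
  (forall e k : R, 0 < e < 1 -> 0 < k ->
     a <= (1 + e) * ((1 + e) * b + (1 + e^-1) * k) + (1 + e^-1) * k) -> a <= b.
Proof.
move=> b0 H; apply/ler_addgt0Pr => c c0.
have cb : 0 < c / (6 * b + c + 1).
  by rewrite divr_gt0//; lra.
(* Expanding leaves six errors of at most [c / 6]: [e * b] twice, [e * (e * b)], [(1 + e^-1) * k]
   twice, and [e] times the latter. The summand [c + 1] keeps [e] below 1. *)
set e := c / (6 * b + c + 1).
have e1 : 0 < e < 1 by rewrite cb/= ltr_pdivrMr; lra.
have k0 : 0 < c / (6 * (1 + e^-1)).
  rewrite divr_gt0// mulr_gt0// ltr_wpDr ?invr_ge0//; by case/andP: e1 => /ltW.
have := H e _ e1 k0; set k := c / _.
have ke : (1 + e^-1) * k = c / 6.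
  by rewrite /k; field; rewrite ?gt_eqF//=; lra.
have eb : e * b <= c / 6.
  rewrite /e mulrAC ler_pdivrMr; last lra.
  by nra.
rewrite !ke; case/andP: e1 => e0 e1.
have : e * (e * b) <= c / 6.
  apply: le_trans eb; apply: ler_piMl (ltW e1); exact: mulr_ge0 (ltW e0) b0.
have : e * c <= c by apply: ler_piMl; exact: ltW.
lra.
Qed.

(** The two norms may live on different spaces: this is how an isometry known on a dense class
    extends to its closure. *)
Lemma nsq_transfer_le (f : T1 -> R[i]) (f' : T2 -> R[i]) :
  cmeasurable f -> cmeasurable f' -> (nsq nu f' < +oo)%E ->
  (forall e : R, 0 < e -> exists g g', [/\ cmeasurable g, cmeasurable g',
     (nsq mu (fun x => f x - g x)%R <= e%:E)%E,
     (nsq nu (fun x => f' x - g' x)%R <= e%:E)%E & (nsq mu g <= nsq nu g')%E]) ->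
  (nsq mu f <= nsq nu f')%E.
Proof.
move=> mf mf' f'y H.
have fE (e k : R) : 0 < e -> 0 < k -> (nsq mu f <=
    ((1 + e) * ((1 + e) * fine (nsq nu f') + (1 + e^-1) * k) + (1 + e^-1) * k)%:E)%E.
  move=> e0 k0; have [g [g' [mg mg' fg fg' gg']]] := H _ k0.
  have e1 : 0 < 1 + e by rewrite addr_gt0.
  have e2 : 0 < 1 + e^-1 by rewrite addr_gt0// invr_gt0.
  have nf : nsq nu f' = (fine (nsq nu f'))%:E by rewrite fineK// ge0_fin_numE ?nsq_ge0.
  have step d (T : measurableType d) (m : {measure set T -> \bar R}) (u v : T -> R[i]) :
      cmeasurable u -> cmeasurable v ->
      (nsq m (fun x => v x - u x)%R <= k%:E)%E ->
      (nsq m v <= (1 + e)%:E * nsq m u + ((1 + e^-1) * k)%:E)%E.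
    move=> mu' mv' uv.
    have -> : v = (fun x => u x + (v x - u x)).
      by apply/funext => x; rewrite addrC subrK.
    apply: le_trans (nsqD_eps m mu' (cmeasurableB mv' mu') e0) _.
    by rewrite EFinM leeD2l// lee_pmul2l ?lte_fin.
  have := step _ _ mu g f mg mf fg.
  have := step _ _ nu f' g' mf' mg'; rewrite nsqC => /(_ fg').
  rewrite [nsq nu f']nf -EFinM -EFinD => g'le /le_trans; apply.
  rewrite [leRHS]EFinD leeD2r// [leRHS]EFinM lee_pmul2l ?lte_fin//.
  exact: le_trans gg' g'le.
have fy : (nsq mu f < +oo)%E by apply: le_lt_trans (fE 1 1 ltr01 ltr01) (ltry _).
have nf : nsq mu f = (fine (nsq mu f))%:E by rewrite fineK// ge0_fin_numE ?nsq_ge0.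
have nf' : nsq nu f' = (fine (nsq nu f'))%:E by rewrite fineK// ge0_fin_numE ?nsq_ge0.
rewrite nf nf' lee_fin; apply: ler_addeps2; first by rewrite fine_ge0// nsq_ge0.
by move=> e k /andP[e0 _] k0; rewrite -lee_fin -nf; exact: fE.
Qed.

End nsq_transfer.

Lemma nsq_transfer d1 (T1 : measurableType d1) d2 (T2 : measurableType d2)
    (R : realType) (mu : {measure set T1 -> \bar R}) (nu : {measure set T2 -> \bar R})
    (f : T1 -> R[i]) (f' : T2 -> R[i]) :
  cmeasurable f -> cmeasurable f' -> (nsq mu f < +oo)%E -> (nsq nu f' < +oo)%E ->
  (forall e : R, 0 < e -> exists g g', [/\ cmeasurable g, cmeasurable g',
     (nsq mu (fun x => f x - g x)%R <= e%:E)%E,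
     (nsq nu (fun x => f' x - g' x)%R <= e%:E)%E & nsq mu g = nsq nu g']) ->
  nsq mu f = nsq nu f'.
Proof.
move=> mf mf' fy f'y H; apply/eqP; rewrite eq_le; apply/andP; split.
  apply: nsq_transfer_le => // e /H[g [g' [mg mg' fg fg' gg']]].
  by exists g, g'; split; rewrite ?gg'.
apply: nsq_transfer_le => // e /H[g [g' [mg mg' fg fg' gg']]].
by exists g', g; split; rewrite ?gg'.
Qed.

(** * Lebesgue measure on R^n and on the torus *)

Section integral_mrestr.
Context d (T : measurableType d) (R : realType).
Variables (mu : {measure set T -> \bar R}) (D : set T) (mD : measurable D).
Local Open Scope ereal_scope.

Lemma ge0_integral_mrestr (f : T -> \bar R) :
  measurable_fun setT f -> (forall x, 0 <= f x) ->
  \int[mrestr mu mD]_x f x = \int[mu]_(x in D) f x.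
Proof.
move=> mf f0; rewrite (@ge0_negligible_integral _ _ _ _ setT (~` D))//; last 2 first.
- exact: measurableC.
- by rewrite /= /mrestr setICl measure0.
rewrite setTD setCK; apply: eq_measure_integral => A mA AD.
by rewrite /= /mrestr setIidl.
Qed.

End integral_mrestr.

Section lebesgue1.
Context {R : realType}.
Local Notation leb := (@lebesgue_measure R).

(** The image of Lebesgue measure under the translation gives every half-open interval its length,
    hence is Lebesgue measure by uniqueness. *)
Lemma ge0_integral_translate1 (f : measurableTypeR R -> \bar R) (a : R) :
  measurable_fun setT f -> (forall x, (0 <= f x)%E) ->
  (\int[leb]_x f (x + a)%R = \int[leb]_x f x)%E.
Proof.
move=> mf f0.
have mt : measurable_fun setT ((fun x => x + a) : measurableTypeR R -> measurableTypeR R).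
  exact: measurable_funD.
transitivity (\int[pushforward leb (fun x : measurableTypeR R => (x + a)%R : measurableTypeR R)]_x f x)%E.
  by rewrite ge0_integral_pushforward// preimage_setT.
apply: eq_measure_integral => A mA _; apply/esym; apply: lebesgue_measure_unique => // _ [[b c]] _ <-.
rewrite /= /pushforward (_ : _ @^-1` _ = `]b - a, c - a]%classic).
  rewrite !lebesgue_measure_itv/= !lte_fin ltrD2r; case: ifPn => // _.
  by rewrite -!EFinB opprB addrA subrK.
by apply/seteqP; split => x /=; rewrite !in_itv/= ltrBlDr lerBrDr.
Qed.

End lebesgue1.

Section vectors.
Context {R : realType} {n : nat}.
Implicit Types (x y a : Rn R n) (k l : Zn n).

Lemma tnth_vadd x y i : tnth (vadd x y) i = (tnth x i : R) + (tnth y i : R).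
Proof. by rewrite tnth_mktuple. Qed.
Lemma tnth_vsub x y i : tnth (vsub x y) i = (tnth x i : R) - (tnth y i : R).
Proof. by rewrite tnth_mktuple. Qed.
Lemma tnth_vec k i : tnth (vec_of_Zn k : Rn R n) i = (tnth k i)%:~R :> R.
Proof. by rewrite tnth_mktuple. Qed.

Definition vopp x : Rn R n := [tuple - (tnth x i : R) | i < n].
Lemma tnth_vopp x i : tnth (vopp x) i = - (tnth x i : R).
Proof. by rewrite tnth_mktuple. Qed.

Definition zadd k l : Zn n := [tuple tnth k i + tnth l i | i < n].
Definition zsub k l : Zn n := [tuple tnth k i - tnth l i | i < n].

Definition vE := (tnth_vadd, tnth_vsub, tnth_vec, tnth_vopp).

Lemma vaddC x y : vadd x y = vadd y x.
Proof. by apply: eq_from_tnth => i; rewrite !vE addrC. Qed.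
Lemma vaddK x y : vsub (vadd x y) y = x.
Proof. by apply: eq_from_tnth => i; rewrite !vE addrK. Qed.
Lemma vsubE x y : vsub x y = vadd x (vopp y).
Proof. by apply: eq_from_tnth => i; rewrite !vE. Qed.
Lemma vec_zadd k l : vec_of_Zn (zadd k l) = vadd (vec_of_Zn k) (vec_of_Zn l) :> Rn R n.
Proof. by apply: eq_from_tnth => i; rewrite !vE tnth_mktuple intrD. Qed.
Lemma vec_zsub k l : vec_of_Zn (zsub k l) = vsub (vec_of_Zn k) (vec_of_Zn l) :> Rn R n.
Proof. by apply: eq_from_tnth => i; rewrite !vE tnth_mktuple intrB. Qed.
Lemma zaddK k l : zsub (zadd k l) l = k.
Proof. by apply: eq_from_tnth => i; rewrite !tnth_mktuple addrK. Qed.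
Lemma zsubK k l : zadd (zsub k l) l = k.
Proof. by apply: eq_from_tnth => i; rewrite !tnth_mktuple subrK. Qed.

Lemma vdotC x y : vdot x y = vdot y x.
Proof. by apply: eq_bigr => i _; rewrite mulrC. Qed.
Lemma vdotDr x y a : vdot x (vadd y a) = vdot x y + vdot x a.
Proof. by rewrite /vdot -big_split/=; apply: eq_bigr => i _; rewrite vE mulrDr. Qed.
Lemma vdotBr x y a : vdot x (vsub y a) = vdot x y - vdot x a.
Proof. by rewrite /vdot -sumrB; apply: eq_bigr => i _; rewrite vE mulrBr. Qed.
Lemma vdotDl x y a : vdot (vadd y a) x = vdot y x + vdot a x.
Proof. by rewrite !(vdotC _ x) vdotDr. Qed.
Lemma vdotBl x y a : vdot (vsub y a) x = vdot y x - vdot a x.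
Proof. by rewrite !(vdotC _ x) vdotBr. Qed.

Lemma vdot_int k l : exists z : int, vdot (vec_of_Zn k) (vec_of_Zn l) = z%:~R :> R.
Proof.
exists (\sum_(i < n) tnth k i * tnth l i).
by rewrite rmorph_sum/=; apply: eq_bigr => i _; rewrite !vE intrM.
Qed.

Lemma expi_2pi_vdot_int k l :
  expi (2 * pi * vdot (vec_of_Zn k) (vec_of_Zn l) : R) = 1.
Proof. by have [z ->] := vdot_int k l; exact: expi_2piz. Qed.

Section measurability.
Context d (T : measurableType d).
Implicit Types f g : T -> Rn R n.

Lemma measurable_tnth_comp f i : measurable_fun setT f ->
  measurable_fun setT (fun t => (tnth (f t) i : R)).
Proof. by move=> mf; exact: (measurableT_comp (measurable_tnth i) mf). Qed.

Lemma measurable_vadd f g : measurable_fun setT f -> measurable_fun setT g ->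
  measurable_fun setT (fun t => vadd (f t) (g t)).
Proof.
move=> mf mg; apply/measurable_fun_tnthP => i; rewrite /comp.
under eq_fun do rewrite vE.
by apply: measurable_funD; exact: measurable_tnth_comp.
Qed.

Lemma measurable_vsub f g : measurable_fun setT f -> measurable_fun setT g ->
  measurable_fun setT (fun t => vsub (f t) (g t)).
Proof.
move=> mf mg; apply/measurable_fun_tnthP => i; rewrite /comp.
under eq_fun do rewrite vE.
by apply: measurable_funB; exact: measurable_tnth_comp.
Qed.

Lemma measurable_vdot f g : measurable_fun setT f -> measurable_fun setT g ->
  measurable_fun setT (fun t => vdot (f t) (g t)).
Proof.
move=> mf mg; apply: measurable_sum => i.
by apply: measurable_funM; exact: measurable_tnth_comp.
Qed.

End measurability.
End vectors.

Section lebesgue_tuple_theory.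
Context {R : realType}.
Local Notation leb := (@lebesgue_measure R).
Local Notation lam := (lebesgue_tuple R).
Local Open Scope ereal_scope.

Lemma ge0_integral_cons n (f : Rn R n.+1 -> \bar R) :
  measurable_fun setT f -> (forall x, 0 <= f x) ->
  \int[lam n.+1]_x f x = \int[leb]_x \int[lam n]_y f [tuple of x :: y].
Proof.
move=> mf f0; rewrite [LHS](ge0_integral_pushforward (measurable_tuple_cons (n := n)))//.
rewrite preimage_setT (fubini_tonelli1 (f \o _)).
- by [].
- by apply: measurableT_comp mf (measurable_tuple_cons (n := n)).
- by move=> x; exact: f0.
Qed.

Lemma vadd_cons n (x : R) (y : Rn R n) (a : Rn R n.+1) :
  vadd [tuple of x :: y] a = [tuple of (x + thead a)%R :: vadd y [tuple of behead a]].
Proof.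
apply: eq_from_tnth => i; rewrite vE; case: (unliftP ord0 i) => [j ->|->].
  by rewrite !tnthS vE; congr (_ + _)%R; rewrite [in LHS](tuple_eta a) tnthS.
by rewrite !tnth0.
Qed.

Lemma measurable_tcons n d (T : measurableType d) (f : T -> measurableTypeR R) (g : T -> Rn R n) :
  measurable_fun setT f -> measurable_fun setT g ->
  measurable_fun setT (fun t => [tuple of f t :: g t] : Rn R n.+1).
Proof. exact: measurable_cons. Qed.

Lemma ge0_integral_translate n (f : Rn R n -> \bar R) (a : Rn R n) :
  measurable_fun setT f -> (forall x, 0 <= f x) ->
  \int[lam n]_x f (vadd x a) = \int[lam n]_x f x.
Proof.
elim: n f a => [|n IH] f a mf f0.
  by apply: eq_integral => x _; congr f; rewrite (tuple0 x) (tuple0 (vadd _ _)).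
rewrite (ge0_integral_cons mf f0) ge0_integral_cons; last 2 first.
- by apply: measurableT_comp mf _; exact: measurable_vadd.
- by move=> x; exact: f0.
under eq_integral => x _.
  under eq_integral do rewrite vadd_cons.
  rewrite (IH (fun y => f [tuple of (x + thead a)%R :: y]))//; last first.
    by apply: measurableT_comp mf _; exact: measurable_tcons.
  over.
rewrite (ge0_integral_translate1 (f := fun x => \int[lam n]_y f [tuple of x :: y]))//.
- apply: (measurable_fun_fubini_tonelli_F (fun p : measurableTypeR R * Rn R n => f [tuple of p.1 :: p.2])) => //.
  by apply: measurableT_comp mf _; exact: measurable_tcons.
- by move=> x; apply: integral_ge0.
Qed.

Lemma integral_translate n (f : Rn R n -> \bar R) (a : Rn R n) :
  measurable_fun setT f ->
  \int[lam n]_x f (vadd x a) = \int[lam n]_x f x.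
Proof.
move=> mf; rewrite integralE [RHS]integralE; congr (_ - _).
  rewrite -(ge0_integral_translate a (measurable_funepos mf) (funepos_ge0 f)).
  by apply: eq_integral => x _; rewrite !funeposE.
rewrite -(ge0_integral_translate a (measurable_funeneg mf) (funeneg_ge0 f)).
by apply: eq_integral => x _; rewrite !funenegE.
Qed.

Section unfolding.
Variable n : nat.
Local Notation TT := (torus_measure R n).

Lemma ge0_integral_torus (f : Rn R n -> \bar R) :
  measurable_fun setT f -> (forall x, 0 <= f x) ->
  \int[TT]_x f x = \int[lam n]_(x in @unit_cube R n) f x.
Proof. exact: ge0_integral_mrestr. Qed.

Definition cube (k : Zn n) : set (Rn R n) :=
  [set x | @unit_cube R n (vsub x (vec_of_Zn k))].

Lemma measurable_cube k : measurable (cube k).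
Proof.
rewrite -[cube k]setTI; apply: (measurable_vsub (f := id)) => //.
exact: measurable_unit_cube.
Qed.

(** Having [k] determined as the vector of integer parts yields both the covering ([cube_floor]) and
    the disjointness ([cube_inj]) of the cubes. *)
Lemma cubeP (k : Zn n) x :
  cube k x <-> forall i, tnth k i = Num.floor (tnth x i : R).
Proof.
split => H i.
  have := H i; rewrite !vE subr_ge0 ltrBlDr => /andP[h1 h2].
  by apply/esym/floor_def; rewrite h1/= intrD addrC.
rewrite !vE H subr_ge0 floor_le/= ltrBlDr addrC.
by have := floorD1_gt (tnth x i : R); rewrite intrD.
Qed.

Lemma cube_floor x : cube [tuple Num.floor (tnth x i : R) | i < n] x.
Proof. by apply/cubeP => i; rewrite tnth_mktuple. Qed.

Lemma cube_inj x k l : cube k x -> cube l x -> k = l.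
Proof. by move=> /cubeP xk /cubeP xl; apply: eq_from_tnth => i; rewrite xk xl. Qed.

Lemma ge0_integral_cube (f : Rn R n -> \bar R) k :
  measurable_fun setT f -> (forall x, 0 <= f x) ->
  \int[lam n]_(x in cube k) f x = \int[TT]_x f (vadd x (vec_of_Zn k)).
Proof.
move=> mf f0; rewrite ge0_integral_torus//; last first.
  by apply: measurableT_comp mf _; exact: measurable_vadd.
rewrite integral_mkcond [RHS]integral_mkcond.
rewrite -(@ge0_integral_translate _ _ (vec_of_Zn k))//; last 2 first.
- by apply/(measurable_restrictT _ _).1 => //; [exact: measurable_cube|exact: measurable_funTS].
- by move=> x; apply: erestrict_ge0.
apply: eq_integral => x _; rewrite /patch.
suff -> : (vadd x (vec_of_Zn k) \in cube k) = (x \in @unit_cube R n) by [].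
by apply/idP/idP; rewrite !inE /cube/= vaddK.
Qed.

(* The sum over Z^n is indexed by nat through [pickle_inv], with zero terms at
   the naturals that encode no element. *)
Lemma unfolding (f : Rn R n -> \bar R) :
  measurable_fun setT f -> (forall x, 0 <= f x) ->
  \int[lam n]_x f x =
  \sum_(i <oo) oapp (fun k : Zn n => \int[TT]_x f (vadd x (vec_of_Zn k))) 0
                    (pickle_inv i).
Proof.
move=> mf f0; pose F i := oapp cube set0 (pickle_inv i : option (Zn n)).
have FT : \bigcup_i F i = setT.
  apply/seteqP; split => // x _; exists (choice.pickle [tuple Num.floor (tnth x i : R) | i < n]) => //.
  by rewrite /F pickleK_inv/=; exact: cube_floor.
have mF i : measurable (F i).
  by rewrite /F; case: pickle_inv => //= k; exact: measurable_cube.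
have -> : \int[lam n]_x f x = \int[lam n]_(x in \bigcup_i F i) f x by rewrite FT.
rewrite ge0_integral_bigcup//; last 2 first.
- by rewrite FT.
- move=> i j _ _ [x []]; rewrite /F.
  have := @pickle_invK (Zn n) i; have := @pickle_invK (Zn n) j.
  case: pickle_inv => //= k <-; case: pickle_inv => //= l <-.
  by move=> xl xk; rewrite (cube_inj xk xl).
apply: eq_eseriesr => i _; rewrite /F; case: pickle_inv => [k|] /=.
  exact: ge0_integral_cube.
by rewrite integral_set0.
Qed.

End unfolding.
End lebesgue_tuple_theory.

(** * Integrals of characters over the torus *)

Section torus_integrals.
Context {R : realType}.
Local Notation leb := (@lebesgue_measure R).
Local Notation lam := (lebesgue_tuple R).
Local Notation TT := (torus_measure R).

(** The added 1 keeps the integrand nonnegative, so that Tonelli's theorem can iterate the identity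
    over the coordinates. The free phase [t] absorbs the other coordinates, and later yields sines
    as well as cosines. *)
Lemma integral_cos1 (k : int) (t : R) : k != 0 ->
  (\int[leb]_(x in `[0%R, 1%R[) (1 + cos (2 * pi * k%:~R * x + t))%:E = 1)%E.
Proof.
move=> k0; set c := 2 * pi * k%:~R.
have c0 : c != 0 :> R by rewrite !mulf_neq0 ?intr_eq0// gt_eqF ?pi_gt0.
pose F x : R := x + c^-1 * sin (c * x + t).
have dF (x : R) : is_derive x 1 F (1 + cos (c * x + t)).
  have da : is_derive x 1 (fun x : R => c * x + t) c.
    by apply: is_derive_eq; rewrite addr0 /GRing.scale/= mulr1.
  have := @is_derive1_comp _ sin (fun x : R => c * x + t) x _ _ (is_derive_sin _) da.
  move=> ds; have -> : F = id + c^-1 *: (sin \o (fun x : R => c * x + t)) by [].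
  apply: (@is_derive_eq _ _ _ _ _ _ _ _ (is_deriveD (is_derive_id x 1) (is_deriveZ c^-1 ds))).
  by rewrite /GRing.scale/= mulrC mulfK.
have cF : continuous F.
  by move=> x; apply: differentiable_continuous; apply/derivable1_diffP.
have mf : measurable_fun setT (fun x : R => (1 + cos (c * x + t))%:E).
  apply/measurable_EFinP; apply: measurable_funD => //.
  apply: measurableT_comp; first by apply: continuous_measurable_fun; exact: continuous_cos.
  by apply: measurable_funD => //; exact: measurable_funM.
rewrite integral_itv_bndo_bndc; last exact: measurable_funTS.
rewrite (@continuous_FTC2 _ _ F)//.
- rewrite /F mulr0 add0r mulr1 add0r -EFinB; congr EFin.
  have : expi (c + t) = expi t by rewrite expiD expi_2piz mul1r.
  by move=> /(congr1 (@complex.Im R))/= ->; rewrite addrK.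
- apply: continuous_subspaceT => x; apply: cvgD; first exact: cvg_cst.
  apply: (@continuous_comp _ _ _ (fun x => c * x + t) cos); last exact: continuous_cos.
  by apply: cvgD; [apply: cvgM; [exact: cvg_cst|exact: cvg_id]|exact: cvg_cst].
- split; first by move=> x _; exact: ex_derive.
    exact: cvg_at_right_filter (cF 0).
  exact: cvg_at_left_filter (cF 1).
- by move=> x _; rewrite derive1E derive_val.
Qed.

Lemma measurable_phase n (k : Zn n) :
  measurable_fun setT (fun x : Rn R n => 2 * pi * vdot (vec_of_Zn k) x : R).
Proof. by apply: measurable_funM => //; exact: measurable_vdot. Qed.

Lemma measurable_1cos d (T : measurableType d) (f : T -> R) :
  measurable_fun setT f -> measurable_fun setT (fun x => (1 + cos (f x))%:E).
Proof.
move=> mf; apply/measurable_EFinP; apply: measurable_funD => //.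
by apply: measurableT_comp mf; apply: continuous_measurable_fun; exact: continuous_cos.
Qed.

Lemma onecos_ge0 (t : R) : (0 <= (1 + cos t)%:E)%E.
Proof. by rewrite lee_fin addrC -lerBlDr sub0r cos_geN1. Qed.

Local Open Scope ereal_scope.

Lemma ge0_integral_torus_cons n (f : Rn R n.+1 -> \bar R) :
  measurable_fun setT f -> (forall x, 0 <= f x) ->
  \int[TT n.+1]_x f x =
  \int[leb]_(x in `[0%R, 1%R[) \int[TT n]_y f [tuple of x :: y].
Proof.
move=> mf f0; rewrite ge0_integral_torus// integral_mkcond ge0_integral_cons; last 2 first.
- by apply/(measurable_restrictT _ _).1 => //; [exact: measurable_unit_cube|exact: measurable_funTS].
- by move=> x; apply: erestrict_ge0.
rewrite [RHS]integral_mkcond; apply: eq_integral => x _.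
rewrite [RHS]patchE ge0_integral_torus//; last first.
  by apply: measurableT_comp mf _; exact: measurable_tcons.
rewrite [X in _ = if _ then X else _]integral_mkcond; case: ifPn => xI.
  apply: eq_integral => y _; rewrite !patchE.
  suff -> : ([tuple of x :: y] \in @unit_cube R n.+1) = (y \in @unit_cube R n) by [].
  apply/idP/idP; rewrite !inE => H i.
    by have := H (lift ord0 i); rewrite tnthS.
  case: (unliftP ord0 i) => [j ->|->]; first by rewrite tnthS.
  by move: xI; rewrite inE /= in_itv tnth0.
apply: integral0_eq => y _; rewrite patchE memNset// => H.
by move/negP: xI; apply; rewrite inE /= in_itv/=; have := H ord0; rewrite tnth0.
Qed.

Lemma torus_measureT n : TT n setT = 1.
Proof.
suff : \int[TT n]_x 1 = 1 by rewrite integral_cst// mul1e.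
elim: n => [|n IH].
  rewrite ge0_integral_torus// integral_cst ?mul1e; last exact: measurable_unit_cube.
  by rewrite /= diracE mem_set// => -[].
rewrite ge0_integral_torus_cons//.
under eq_integral do rewrite IH.
by rewrite integral_cst//= lebesgue_measure_itv/= lte_fin ltr01 oppr0 adde0 mule1.
Qed.

Lemma integral_torus_cst n (c : R) : (0 <= c)%R -> \int[TT n]_x c%:E = c%:E.
Proof. by move=> c0; rewrite integral_cst//= torus_measureT mule1. Qed.

Lemma vdot_vec_cons n (k : Zn n.+1) (x : R) (y : Rn R n) :
  vdot (vec_of_Zn k) [tuple of x :: y] =
  ((thead k)%:~R * x + vdot (vec_of_Zn [tuple of behead k]) y)%R.
Proof.
rewrite /vdot big_ord_recl tnth0 !vE; congr (_ + _)%R.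
apply: eq_bigr => i _; rewrite tnthS !vE; congr (_ * _)%R.
by rewrite [in LHS](tuple_eta k) tnthS.
Qed.

Definition zzero n : Zn n := [tuple 0%R | i < n].

Lemma vdot_zzero n (y : Rn R n) : vdot (vec_of_Zn (zzero n)) y = 0%R.
Proof. by rewrite /vdot big1// => i _; rewrite !vE tnth_mktuple mul0r. Qed.

Lemma integral_torus_cos n (k : Zn n) (t : R) : k != zzero n ->
  \int[TT n]_x (1 + cos (2 * pi * vdot (vec_of_Zn k) x + t))%:E = 1.
Proof.
elim: n k t => [|n IH] k t k0.
  by move: k0; rewrite (tuple0 k) (tuple0 (zzero 0)) eqxx.
rewrite ge0_integral_torus_cons; last 2 first.
- by apply: measurable_1cos; apply: measurable_funD => //; exact: measurable_phase.
- by move=> x; exact: onecos_ge0.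
have E (x : R) (y : Rn R n) : (2 * pi * vdot (vec_of_Zn k) [tuple of x :: y] + t =
    2 * pi * vdot (vec_of_Zn [tuple of behead k]) y + (2 * pi * (thead k)%:~R * x + t))%R.
  by rewrite vdot_vec_cons; ring.
under eq_integral do under eq_integral do rewrite E.
(* If the tail of [k] is nonzero, the inner integral is already 1, with the head term as part of the
   phase. Otherwise the tail contributes nothing and the head is nonzero. *)
have [kz|kz] := eqVneq [tuple of behead k] (zzero n); last first.
  under eq_integral do rewrite IH//.
  by rewrite integral_cst//= lebesgue_measure_itv/= lte_fin ltr01 oppr0 adde0 mule1.
rewrite kz; under eq_integral.
  move=> x _; under eq_integral do rewrite vdot_zzero mulr0 add0r.
  rewrite integral_torus_cst -?lee_fin ?onecos_ge0//.
  over.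
rewrite integral_cos1//; apply: contra_neq k0 => h.
apply: eq_from_tnth => i; rewrite [in LHS](tuple_eta k); case: (unliftP ord0 i) => [j ->|->].
  rewrite tnthS; transitivity (tnth (zzero n) j); last by rewrite !tnth_mktuple.
  exact: (congr1 (fun t => tnth t j) kz).
by rewrite tnth0 h tnth_mktuple.
Qed.

End torus_integrals.

Section torus2.
Context {R : realType} {n : nat}.
Local Notation TT := (torus_measure R n).
Local Notation TT2 := (prod_measure TT TT).
Local Open Scope ereal_scope.

Lemma ge0_integral_prod d1 d2 (T1 : measurableType d1) (T2 : measurableType d2)
    (m1 : {sigma_finite_measure set T1 -> \bar R})
    (m2 : {sigma_finite_measure set T2 -> \bar R}) (f : T1 * T2 -> \bar R) :
  measurable_fun setT f -> (forall x, 0 <= f x) ->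
  \int[prod_measure m1 m2]_x f x = \int[m1]_x \int[m2]_y f (x, y).
Proof. exact: fubini_tonelli1. Qed.

Lemma ge0_integral_prod2 d1 d2 (T1 : measurableType d1) (T2 : measurableType d2)
    (m1 : {sigma_finite_measure set T1 -> \bar R})
    (m2 : {sigma_finite_measure set T2 -> \bar R}) (f : T1 * T2 -> \bar R) :
  measurable_fun setT f -> (forall x, 0 <= f x) ->
  \int[prod_measure m1 m2]_x f x = \int[m2]_y \int[m1]_x f (x, y).
Proof. exact: fubini_tonelli2. Qed.

Definition phase2 (kl : Zn n * Zn n) (p : Rn R n * Rn R n) : R :=
  (2 * pi * (vdot (vec_of_Zn kl.1) p.1 + vdot (vec_of_Zn kl.2) p.2))%R.

Lemma measurable_phase2 kl : measurable_fun setT (phase2 kl).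
Proof.
by apply: measurable_funM => //; apply: measurable_funD; exact: measurable_vdot.
Qed.

Lemma torus2_measureT : TT2 setT = 1.
Proof.
by rewrite -setXTT /prod_measure product_measure1E// -[RHS]mule1;
  congr (_ * _); exact: torus_measureT.
Qed.

Lemma integral_torus2_cos (k l : Zn n) (t : R) : (k, l) != (zzero n, zzero n) ->
  \int[TT2]_x (1 + cos (phase2 (k, l) x + t))%:E = 1.
Proof.
move=> kl0; rewrite ge0_integral_prod; last 2 first.
- by apply: measurable_1cos; apply: measurable_funD => //; exact: measurable_phase2.
- by move=> x; exact: onecos_ge0.
have E x y : (phase2 (k, l) (x, y) + t = 2 * pi * vdot (vec_of_Zn l) y +
    (2 * pi * vdot (vec_of_Zn k) x + t))%R by rewrite /phase2/=; ring.
under eq_integral do under eq_integral do rewrite E.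
have [lz|lz] := eqVneq l (zzero n); last first.
  under eq_integral do rewrite integral_torus_cos//.
  by rewrite integral_cst//= torus_measureT mule1.
rewrite lz; under eq_integral.
  move=> x _; under eq_integral do rewrite vdot_zzero mulr0 add0r.
  rewrite integral_torus_cst -?lee_fin ?onecos_ge0//.
  over.
rewrite integral_torus_cos//; apply: contra_neq kl0 => ->.
by rewrite lz.
Qed.

End torus2.

(** * Approximation in weighted L^1 spaces *)

Section ereal_cvg0.
Context {R : realType}.
Implicit Types u : nat -> \bar R.

Lemma cvge0_le u : (forall n, (0 <= u n)%E) -> u @ \oo --> 0%E ->
  forall e : R, 0 < e -> exists N, forall n, (N <= n)%N -> (u n <= e%:E)%E.
Proof.
move=> u0 /fine_cvgP[[N1 _ f1] /cvgrPdist_lt H] e e0.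
have [N2 _ f2] := H _ e0.
exists (maxn N1 N2) => n; rewrite geq_max => /andP[n1 n2].
have un := f1 _ n1; rewrite -(fineK un) lee_fin; have := f2 _ n2.
by rewrite /= sub0r normrN ger0_norm ?fine_ge0// => /ltW.
Qed.

Lemma le_cvge0 u : (forall n, (0 <= u n)%E) ->
  (forall e : R, 0 < e -> exists N, forall n, (N <= n)%N -> (u n <= e%:E)%E) ->
  u @ \oo --> 0%E.
Proof.
move=> u0 H; have uf e n : (u n <= e%:E)%E -> u n \is a fin_num.
  by move=> ue; rewrite ge0_fin_numE// (le_lt_trans ue)// ltry.
apply/fine_cvgP; split.
  by have [N HN] := H _ ltr01; exists N => // n /= Nn; exact: uf (HN _ Nn).
apply/cvgrPdist_le => e e0; have [N HN] := H _ e0; exists N => // n /= Nn.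
rewrite sub0r normrN ger0_norm ?fine_ge0// -lee_fin fineK ?HN//.
exact: uf (HN _ Nn).
Qed.

End ereal_cvg0.

Lemma bernoulli_ineq (R : realType) (y : R) (n : nat) : -1 <= y ->
  1 + n%:R * y <= (1 + y) ^+ n.
Proof.
move=> y1; elim: n => [|n IH]; first by rewrite mul0r addr0 expr0.
rewrite exprS -natr1; apply: (@le_trans _ _ ((1 + y) * (1 + n%:R * y))).
  rewrite -subr_ge0 (_ : _ - _ = n%:R * y ^+ 2); last by ring.
  by rewrite mulr_ge0// sqr_ge0.
by rewrite ler_wpM2l// addrC -lerBlDr sub0r.
Qed.

(** With [t] the square root of [r], the product [j%:R * t ^+ j] stays below [(1 - t)^-1], and the
    remaining factor [t ^+ j] tends to 0. *)
Lemma cvg_natM_expr (R : realType) (r : R) : 0 <= r < 1 ->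
  (fun j : nat => j%:R * r ^+ j) @ \oo --> (0 : R).
Proof.
case/andP => r0 r1; pose t := Num.sqrt r.
have t1 : t < 1 by rewrite -sqrtr1 ltr_sqrt.
have t0 : 0 <= t by exact: sqrtr_ge0.
have rt : r = t * t by rewrite -expr2 sqr_sqrtr.
have jt (j : nat) : (1 - t) * (j%:R * t ^+ j) <= 1.
  elim: j => [|j IH]; first by rewrite mul0r mulr0.
  have tj : t ^+ j.+1 <= 1 by rewrite exprn_ile1// ltW.
  rewrite -natr1 (_ : (1 - t) * _ = t * ((1 - t) * (j%:R * t ^+ j)) + (1 - t) * t ^+ j.+1).
    by nra.
  by rewrite exprS; ring.
apply: (@squeeze_cvgr _ _ _ _ (fun=> 0) (fun j : nat => (1 - t)^-1 * t ^+ j)).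
- apply: nearW => j; rewrite mulr_ge0 ?exprn_ge0//= rt exprMn mulrA.
  rewrite ler_wpM2r ?exprn_ge0// -(@ler_pM2l _ (1 - t)) ?subr_gt0// divff//.
  by rewrite gt_eqF// subr_gt0.
- exact: cvg_cst.
- rewrite -(mulr0 (1 - t)^-1); apply: cvgM; first exact: cvg_cst.
  by apply: cvg_expr; rewrite ger0_norm.
Qed.

(* [(1 - s^j)^(j 2^j)] tends to the indicator of [s < 1/2] by Bernoulli's
   inequality. *)
Lemma bernoulli_cvg (R : realType) (s : R) : 0 <= s <= 1 ->
  (fun j : nat => (1 - s ^+ j) ^+ (j * 2 ^ j)) @ \oo --> ((s < 2^-1)%R%:R : R).
Proof.
case/andP => s0 s1; have [sh|sh] := ltrP s 2^-1.
  have r01 : 0 <= 2 * s < 1 by lra.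
  apply: (@squeeze_cvgr _ _ _ _ (fun j : nat => 1 - j%:R * (2 * s) ^+ j) (fun=> 1)).
  - apply: nearW => j; apply/andP; split; last first.
      by rewrite exprn_ile1// ?subr_ge0 ?exprn_ile1// lerBlDr lerDl exprn_ge0.
    have := @bernoulli_ineq _ (- s ^+ j) (j * 2 ^ j); rewrite lerN2 exprn_ile1// => /(_ isT).
    by rewrite mulrN natrM natrX -mulrA -exprMn.
  - rewrite -[X in _ --> X]subr0; apply: cvgB; first exact: cvg_cst.
    exact: cvg_natM_expr.
  - exact: cvg_cst.
(* Put [y = s ^+ j] and [N = j * 2 ^ j]. Since [2 * s >= 1], Bernoulli gives
   [(1 + y) ^+ N >= j + 1], while [(1 - y ^+ 2) ^+ N <= 1]; hence [(1 - y) ^+ N <= 1 / (j + 1)]. *)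
apply: (@squeeze_cvgr _ _ _ _ (fun=> 0) harmonic).
- apply: nearW => j; apply/andP; split.
    by rewrite exprn_ge0// subr_ge0 exprn_ile1.
  rewrite /harmonic/= -[leRHS]mul1r ler_pdivlMr ?ltr0n//.
  have y0 : 0 <= s ^+ j <= 1 by rewrite exprn_ge0// exprn_ile1.
  have := @bernoulli_ineq _ (s ^+ j) (j * 2 ^ j).
  have -> : -1 <= s ^+ j by lra.
  move=> /(_ isT) bi.
  have jj : j.+1%:R <= (1 + s ^+ j) ^+ (j * 2 ^ j) :> R.
    apply: le_trans bi; rewrite -nat1r lerD2l natrM natrX -mulrA -exprMn ler_peMr//.
    by rewrite exprn_ege1//; lra.
  apply: (@le_trans _ _ ((1 - s ^+ j) ^+ (j * 2 ^ j) * (1 + s ^+ j) ^+ (j * 2 ^ j))).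
    by rewrite ler_wpM2l// exprn_ge0//; lra.
  by rewrite -exprMn exprn_ile1//; nra.
- exact: cvg_cst.
- exact: cvg_harmonic.
Qed.

(** * The sigma-algebra of approximable sets *)

Section weighted_approximation.
Context d (X : measurableType d) (R : realType).
Variables (mu : {measure set X -> \bar R}) (alg : (X -> R) -> Prop).
Hypothesis alg_meas : forall p, alg p -> measurable_fun setT p.
Hypothesis alg_cst : forall c : R, alg (fun=> c).
Hypothesis algD : forall p q, alg p -> alg q -> alg (fun x => p x + q x).
Hypothesis algM : forall p q, alg p -> alg q -> alg (fun x => p x * q x).
Variable g : X -> R.
Implicit Types p q r s : X -> R.
Hypothesis mg : measurable_fun setT g.
Hypothesis g0 : forall x, 0 <= g x.
Hypothesis gy : (\int[mu]_x (g x)%:E < +oo)%E.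

Definition wdist (p q : X -> R) : \bar R := (\int[mu]_x (`|p x - q x| * g x)%:E)%E.

Lemma measurable_wdist p q : measurable_fun setT p -> measurable_fun setT q ->
  measurable_fun setT (fun x => (`|p x - q x| * g x)%:E).
Proof.
move=> mp mq; apply/measurable_EFinP; apply: measurable_funM => //.
by apply: measurableT_comp => //; exact: measurable_funB.
Qed.

Lemma wdist_ge0 p q x : (0 <= (`|p x - q x| * g x)%:E)%E.
Proof. by rewrite lee_fin mulr_ge0. Qed.

Lemma wdist_triangle p q r : measurable_fun setT p -> measurable_fun setT q ->
  measurable_fun setT r -> (wdist p r <= wdist p q + wdist q r)%E.
Proof.
move=> mp mq mr; rewrite /wdist -ge0_integralD//; last 4 first.
- by move=> x _; exact: wdist_ge0.
- exact: measurable_wdist.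
- by move=> x _; exact: wdist_ge0.
- exact: measurable_wdist.
apply: ge0_le_integral => //.
- by move=> x _; exact: wdist_ge0.
- exact: measurable_wdist.
- by apply: emeasurable_funD; exact: measurable_wdist.
- move=> x _; rewrite -EFinD lee_fin -mulrDl ler_wpM2r//.
  by rewrite (le_trans _ (ler_normD _ _))// addrA subrK.
Qed.

(* The [0, 1]-valued functions that [0, 1]-valued elements of [alg] approximate
   in L^1(g mu). *)
Definition approximable (q : X -> R) := [/\ measurable_fun setT q,
  forall x, 0 <= q x <= 1 & forall e : R, 0 < e ->
    exists p, [/\ alg p, forall x, 0 <= p x <= 1 & (wdist p q <= e%:E)%E]].

Lemma approximable_alg p : alg p -> (forall x, 0 <= p x <= 1) -> approximable p.
Proof.
move=> ap p01; split => //; first exact: alg_meas.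
move=> e e0; exists p; split => //; rewrite /wdist.
under eq_integral do rewrite subrr normr0 mul0r.
by rewrite integral0 lee_fin ltW.
Qed.

(** Values in [0, 1] make [g] itself a dominating function, so pointwise convergence is convergence
    for [wdist]. *)
Lemma approximable_lim (q_ : nat -> X -> R) q :
  (forall j, approximable (q_ j)) -> (forall x, q_ ^~ x @ \oo --> q x) ->
  approximable q.
Proof.
move=> aq cq.
have mq : measurable_fun setT q.
  by apply: (@measurable_fun_cvg _ _ _ _ q_) => // j; have [] := aq j.
have q01 x : 0 <= q x <= 1.
  apply/andP; split.
    rewrite -(cvg_lim _ (cq x))//; apply: limr_ge; first by apply/cvg_ex; exists (q x).
    by apply: nearW => n; have [_ /(_ x)/andP[]] := aq n.
  rewrite -(cvg_lim _ (cq x))//; apply: limr_le; first by apply/cvg_ex; exists (q x).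
  by apply: nearW => n; have [_ /(_ x)/andP[]] := aq n.
split => // e e0.
have e2 : 0 < e / 2 by rewrite divr_gt0.
have ig : mu.-integrable setT (EFin \o g).
  apply/integrableP; split; first exact/measurable_EFinP.
  by under eq_integral do rewrite /= ger0_norm//.
have [_ H _] : [/\ mu.-integrable setT (fun x => (q x * g x)%:E),
    [sequence \int[mu]_x `|(q_ n x * g x)%:E - (q x * g x)%:E|]_n%E @ \oo --> 0%E &
    [sequence \int[mu]_x (q_ n x * g x)%:E]_n%E @ \oo --> \int[mu]_x (q x * g x)%:E]%E.
  apply: dominated_convergence ig _ => //.
  - by move=> j; apply/measurable_EFinP; apply: measurable_funM => //; have [] := aq j.
  - by apply/measurable_EFinP; exact: measurable_funM.
  - apply: aeW => x _; apply: cvg_EFin; first exact: nearW.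
    by apply: cvgM => //; exact: cvg_cst.
  - apply: aeW => x n _; rewrite abse_EFin lee_fin normrM (ger0_norm (g0 x)).
    by rewrite ler_piMl// ger0_norm; have [_ /(_ x)/andP[]] := aq n.
have [//|N /(_ N (leqnn N)) HN] := cvge0_le _ H e2.
  by move=> n; apply: integral_ge0.
have [mN _ /(_ _ e2)[p [ap p01 pN]]] := aq N.
exists p; split => //; apply: (le_trans (wdist_triangle (alg_meas ap) mN mq)).
have -> : e%:E = ((e / 2)%:E + (e / 2)%:E)%E by rewrite -EFinD -splitr.
apply: leeD => //; apply: le_trans HN; rewrite le_eqVlt; apply/orP; left; apply/eqP.
apply: eq_integral => x _; rewrite -EFinB abse_EFin -mulrBl normrM.
by rewrite (ger0_norm (g0 x)).
Qed.

Lemma approximableC q : approximable q -> approximable (fun x => 1 - q x).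
Proof.
move=> [mq q01 aq]; split => [|x|e /aq[p [ap p01 pq]]].
- exact: measurable_funB.
- by have := q01 x; lra.
exists (fun x => 1 + (-1) * p x); split.
- by apply: algD => //; exact: algM.
- by move=> x; have := p01 x; lra.
- apply: le_trans pq; rewrite le_eqVlt; apply/orP; left; apply/eqP.
  apply: eq_integral => x _; congr (_ * _)%:E.
  by rewrite -normrN; congr `|_|; ring.
Qed.

(** The bounds by 1 give |p s - q r| <= |p - q| + |s - r|, so errors add although the weight is only
    integrable. *)
Lemma approximableM q r : approximable q -> approximable r ->
  approximable (fun x => q x * r x).
Proof.
move=> [mq q01 aq] [mr r01 ar]; split => [|x|e e0].
- exact: measurable_funM.
- by have := q01 x; have := r01 x; nra.
have e2 : 0 < e / 2 by rewrite divr_gt0.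
have [p [ap p01 pq]] := aq _ e2; have [s [as' s01 sr]] := ar _ e2.
exists (fun x => p x * s x); split; first exact: algM.
- by move=> x; have := p01 x; have := s01 x; nra.
have -> : e%:E = ((e / 2)%:E + (e / 2)%:E)%E by rewrite -EFinD -splitr.
apply: le_trans (leeD pq sr); rewrite /wdist -ge0_integralD//; last 4 first.
- by move=> x _; exact: wdist_ge0.
- by apply: measurable_wdist => //; exact: alg_meas.
- by move=> x _; exact: wdist_ge0.
- by apply: measurable_wdist => //; exact: alg_meas.
apply: ge0_le_integral => //.
- by move=> x _; rewrite lee_fin mulr_ge0.
- by apply: (@measurable_wdist (p \* s) (q \* r)); apply: measurable_funM => //; exact: alg_meas.
- by apply: emeasurable_funD; apply: measurable_wdist => //; exact: alg_meas.
move=> x _; rewrite -EFinD lee_fin -mulrDl ler_wpM2r//.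
rewrite (_ : _ - _ = (p x - q x) * s x + q x * (s x - r x)); last by ring.
apply: (le_trans (ler_normD _ _)); rewrite !normrM lerD//.
  by rewrite ler_piMr// ger0_norm; have /andP[] := s01 x.
by rewrite ler_piMl// ger0_norm; have /andP[] := q01 x.
Qed.

Definition approx_sets : set (set X) :=
  [set A | measurable A /\ approximable (\1_A)].

Lemma approx_sets_ae A B : approx_sets A -> measurable B ->
  {ae mu, forall x, A x <-> B x} -> approx_sets B.
Proof.
move=> [mA [_ _ aA]] mB AB; split => //; split; first exact: measurable_indic.
  by move=> x; rewrite indicE; case: (_ \in _); rewrite ler01 lexx.
move=> e /aA[p [ap p01 pA]]; exists p; split => //.
apply: le_trans pA; rewrite le_eqVlt; apply/orP; left; apply/eqP.
have mp := alg_meas ap.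
apply: ge0_ae_eq_integral => //.
- by apply: measurable_wdist => //; exact: measurable_indic.
- by apply: measurable_wdist => //; exact: measurable_indic.
- by move=> x _; exact: wdist_ge0.
- by move=> x _; exact: wdist_ge0.
apply: filterS AB => x AB _; rewrite !indicE.
suff -> : (x \in A) = (x \in B) by [].
by apply/idP/idP; rewrite !inE => /AB.
Qed.

Lemma approx_sets0 : approx_sets set0.
Proof.
split => //; rewrite indic0; apply: approximable_alg; first exact: alg_cst.
by move=> x; rewrite lexx ler01.
Qed.

Lemma approx_setsC A : approx_sets A -> approx_sets (~` A).
Proof.
move=> [mA aA]; split; first exact: measurableC.
suff -> : \1_(~` A) = (fun x => 1 - \1_A x) :> (X -> R) by exact: approximableC.
apply/funext => x; rewrite !indicE in_setC.
by case: (x \in A); rewrite ?subrr ?subr0.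
Qed.

Lemma approx_setsI A B : approx_sets A -> approx_sets B -> approx_sets (A `&` B).
Proof.
move=> [mA aA] [mB aB]; split; first exact: measurableI.
by rewrite indicI; exact: approximableM.
Qed.

Lemma approx_setsU A B : approx_sets A -> approx_sets B -> approx_sets (A `|` B).
Proof.
move=> aA aB; rewrite -[_ `|` _]setCK setCU.
by apply/approx_setsC/approx_setsI; exact: approx_setsC.
Qed.

Lemma approx_sets_bigcup (A_ : nat -> set X) :
  (forall i, approx_sets (A_ i)) -> approx_sets (\bigcup_i A_ i).
Proof.
move=> aA; split; first by apply: bigcup_measurable => i _; have [] := aA i.
apply: (@approximable_lim (fun n => \1_(\big[setU/set0]_(i < n) A_ i))).
  move=> n; suff [] : approx_sets (\big[setU/set0]_(i < n) A_ i) by [].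
  elim/big_ind : _ => //; [exact: approx_sets0|exact: approx_setsU].
move=> x; apply: cvg_near_cst; have [[i _ Aix]|nA] := pselect ((\bigcup_i A_ i) x).
  exists i.+1 => // n /= ni; rewrite !indicE !mem_set//; first by exists i.
  by rewrite -bigcup_mkord; exists i.
apply: nearW => n; rewrite !indicE !memNset// -bigcup_mkord => -[i /= _ Aix].
by apply: nA; exists i.
Qed.

Lemma approx_sets_sigma_algebra : sigma_algebra setT approx_sets.
Proof.
split; [exact: approx_sets0| |exact: approx_sets_bigcup].
by move=> A; rewrite setTD; exact: approx_setsC.
Qed.

Lemma alg_exp p n : alg p -> alg (fun x => p x ^+ n).
Proof.
move=> ap; elim: n => [|n IH].
  by under eq_fun do rewrite expr0; exact: alg_cst.
by under eq_fun do rewrite exprS; exact: algM.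
Qed.

(** The functions of [bernoulli_cvg], composed with [s], are elements of [alg] with values in [0, 1]
    that converge pointwise to the indicator. *)
Lemma approx_sets_lt_half (s : X -> R) : alg s -> (forall x, 0 <= s x <= 1) ->
  approx_sets [set x | s x < 2^-1].
Proof.
move=> as' s01; have ms := alg_meas as'.
split.
  rewrite -[X in measurable X]setTI; apply: measurable_fun_ltr => //; exact: measurable_cst.
apply: (@approximable_lim (fun j x => (1 - s x ^+ j) ^+ (j * 2 ^ j))).
  move=> j; apply: approximable_alg.
    apply: (@alg_exp (fun x => 1 - s x ^+ j)).
    under eq_fun do rewrite -mulN1r; apply: algD => //; apply: algM => //.
    exact: alg_exp.
  move=> x; have /andP[s0 s1] := s01 x.
  have h : 0 <= 1 - s x ^+ j <= 1.
    by rewrite subr_ge0 exprn_ile1//= lerBlDr lerDl exprn_ge0.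
  by case/andP: h => h0 h1; rewrite exprn_ge0//= exprn_ile1.
move=> x; have := bernoulli_cvg (s01 x); rewrite indicE.
by rewrite (_ : (x \in _) = (s x < 2^-1))//; apply/idP/idP; rewrite inE.
Qed.

End weighted_approximation.

(** * From cosines to all Borel sets *)

Section torus_generation.
Context d (X : measurableType d) (R : realType) (n : nat).
Variables (mu : {measure set X -> \bar R}) (alg : (X -> R) -> Prop).
Hypothesis alg_meas : forall p, alg p -> measurable_fun setT p.
Hypothesis alg_cst : forall c : R, alg (fun=> c).
Hypothesis algD : forall p q, alg p -> alg q -> alg (fun x => p x + q x).
Hypothesis algM : forall p q, alg p -> alg q -> alg (fun x => p x * q x).
Variable g : X -> R.
Hypothesis mg : measurable_fun setT g.
Hypothesis g0 : forall x, 0 <= g x.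
Hypothesis gy : (\int[mu]_x (g x)%:E < +oo)%E.
Variable h : X -> Rn R n.
Hypothesis mh : measurable_fun setT h.
Hypothesis h_cube : {ae mu, forall x, unit_cube (h x)}.
Hypothesis alg_cos : forall i (t : R), alg (fun x => cos (2 * pi * (tnth (h x) i : R) - t)).
Local Notation approx_sets := (approx_sets mu alg g).

(* cos (2 pi x - pi c) - cos (pi c) = - 2 sin (pi x) sin (pi (x - c)) *)
Lemma cos_lt_arc (x c : R) : 0 <= x < 1 -> 0 <= c < 1 ->
  (cos (2 * pi * x - pi * c) < cos (pi * c)) = (c < x).
Proof.
move=> /andP[x0 x1] /andP[c0 c1]; have p0 := @pi_gt0 R.
have -> : 2 * pi * x - pi * c = pi * x + pi * (x - c) by ring.
have -> : pi * c = pi * x - pi * (x - c) by ring.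
rewrite cosD cosB -subr_gt0.
rewrite (_ : _ - _ = 2 * (sin (pi * x) * sin (pi * (x - c)))); last by ring.
rewrite pmulr_rgt0//.
have sx0 : 0 <= sin (pi * x) by apply: sin_ge0_pi; nra.
have [cx|xc] := ltrP c x.
  rewrite mulr_gt0//; apply: sin_gt0_pi; nra.
apply/negbTE; rewrite -leNgt mulr_ge0_le0//.
rewrite -(opprB c) mulrN sinN oppr_le0.
by apply: sin_ge0_pi; nra.
Qed.

Let aux_ae A B : approx_sets A -> measurable B ->
  {ae mu, forall x, A x <-> B x} -> approx_sets B.
Proof. exact: approx_sets_ae. Qed.

Let aux0 : approx_sets set0.
Proof. exact: approx_sets0. Qed.

(** On the unit cube this is the arc from [c] to 1, which one shifted cosine cuts out by
    [cos_lt_arc]. For [c] outside [0, 1) the set is null or has null complement. *)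
Lemma approx_sets_coord i (c : R) :
  approx_sets [set x | c < (tnth (h x) i : R)].
Proof.
have mc : measurable [set x | c < (tnth (h x) i : R)].
  rewrite -[X in measurable X]setTI; apply: measurable_fun_ltr => //.
  exact: measurable_tnth_comp.
have [c1|c1] := leP 1 c.
  apply: aux_ae aux0 mc _.
  apply: filterS h_cube => x /(_ i)/andP[_ x1]; split => //=.
  by move=> cx; have := lt_trans x1 (le_lt_trans c1 cx); rewrite ltxx.
have [c0|c0] := ltP c 0.
  apply: (@aux_ae setT _ _ mc); last first.
    apply: filterS h_cube => x /(_ i)/andP[x0 _]; split; last by move=> _; exact: (I : setT x).
    by move=> _ /=; exact: lt_le_trans c0 x0.
  by rewrite -setC0; apply: approx_setsC => //; exact: aux0.
(* The difference of cosines lies in [-2, 2]; this affine map sends it into [0, 1] and moves its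
   sign change to [2^-1]. *)
pose s x := 2^-1 + 4^-1 * (cos (2 * pi * (tnth (h x) i : R) - pi * c) + - cos (pi * c)).
have as' : alg s.
  by apply: algD => //; apply: algM => //; exact: algD.
apply: (@aux_ae [set x | s x < 2^-1] _ _ mc).
  apply: approx_sets_lt_half => // x.
   have := cos_le1 (2 * pi * (tnth (h x) i : R) - pi * c).
  have := cos_geN1 (2 * pi * (tnth (h x) i : R) - pi * c).
  by have := cos_le1 (pi * c); have := cos_geN1 (pi * c); rewrite /s; lra.
apply: filterS h_cube => x /(_ i) x01 /=.
rewrite -(cos_lt_arc x01); last by rewrite c0.
by rewrite /s; split; lra.
Qed.

(** Once [X] carries the sigma-algebra [approx_sets], the claim is measurability of [h], which can
    be tested on coordinates and open rays. *)
Lemma approx_sets_preimage (A : set (Rn R n)) : measurable A ->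
  approx_sets (h @^-1` A).
Proof.
pose SX := g_sigma_algebraType approx_sets.
have sa : sigma_algebra setT approx_sets by exact: approx_sets_sigma_algebra.
have SXE : @measurable _ SX = approx_sets by exact: sigma_algebra_id.
move=> mA; rewrite -[X in X _]SXE -[X in measurable X]setTI.
suff : measurable_fun (setT : set SX) h by apply.
apply/measurable_fun_tnthP => i.
apply: (measurability _ (RGenOInfty.measurableE R)) => _ [_ [c ->] <-].
rewrite setTI [X in X _]SXE (_ : _ @^-1` _ = [set x | c < (tnth (h x) i : R)]).
  exact: approx_sets_coord.
by apply/seteqP; split => x /=; rewrite in_itv/= andbT.
Qed.

End torus_generation.

Section pair_generation.
Context d (X : measurableType d) d1 (Y : measurableType d1) d2 (Z : measurableType d2).

(** If [S] makes both projections measurable, it makes the identity into the product sigma-algebra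
    measurable. *)
Lemma sigma_algebra_prod (S : set (set (Y * Z))) : sigma_algebra setT S ->
  (forall A, measurable A -> S (fst @^-1` A)) ->
  (forall A, measurable A -> S (snd @^-1` A)) ->
  forall A, measurable A -> S A.
Proof.
move=> sS S1 S2 A mA; pose SX := g_sigma_algebraType S.
have SXE : @measurable _ SX = S by exact: sigma_algebra_id.
have m1 : measurable_fun (setT : set SX) (fst : SX -> Y).
  by move=> _ B mB; rewrite setTI SXE; exact: S1.
have m2 : measurable_fun (setT : set SX) (snd : SX -> Z).
  by move=> _ B mB; rewrite setTI SXE; exact: S2.
have : measurable_fun (setT : set SX) (fun x : SX => (fst x, snd x)).
  exact: measurable_fun_pair.
move=> /(_ measurableT _ mA); rewrite setTI SXE.
by rewrite (_ : _ @^-1` A = A)//; apply/seteqP; split => -[].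
Qed.

End pair_generation.

(** * Orthonormal systems and trigonometric polynomials *)

Section cintegral_theory.
Context d (X : measurableType d) (R : realType).
Variable mu : {measure set X -> \bar R}.
Implicit Types f g : X -> R[i].

Definition cintegrable f := mu.-integrable setT (EFin \o (fun x => complex.Re (f x))) /\
  mu.-integrable setT (EFin \o (fun x => complex.Im (f x))).

Lemma cintegrableD f g : cintegrable f -> cintegrable g -> cintegrable (fun x => f x + g x).
Proof.
move=> [f1 f2] [g1 g2]; split; rewrite /comp.
  under eq_fun do rewrite ReD EFinD; exact: integrableD.
under eq_fun do rewrite ImD EFinD; exact: integrableD.
Qed.

Lemma cintegrableZ (c : R[i]) f : cintegrable f -> cintegrable (fun x => c * f x).
Proof.
move=> [f1 f2]; split; rewrite /comp.
  under eq_fun do rewrite ReM EFinB !EFinM.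
  by apply: integrableB => //; exact: integrableZl.
under eq_fun do rewrite ImM EFinD !EFinM.
by apply: integrableD => //; exact: integrableZl.
Qed.

Lemma cintegrableN f : cintegrable f -> cintegrable (fun x => - f x).
Proof. by move=> /(cintegrableZ (-1)); under eq_fun do rewrite mulN1r. Qed.

Lemma cintegrableB f g : cintegrable f -> cintegrable g -> cintegrable (fun x => f x - g x).
Proof. by move=> cf cg; apply: cintegrableD => //; exact: cintegrableN. Qed.

Lemma cintegrable0 : cintegrable (fun=> 0).
Proof. by split; exact: integrable0. Qed.

Lemma cintegrable_sum (I : Type) (r : seq I) (F : I -> X -> R[i]) :
  (forall i, cintegrable (F i)) -> cintegrable (fun x => \sum_(i <- r) F i x).
Proof.
move=> cF; elim: r => [|i r IH].
  by under eq_fun do rewrite big_nil; exact: cintegrable0.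
by under eq_fun do rewrite big_cons; exact: cintegrableD.
Qed.

Lemma cintegralD f g : cintegrable f -> cintegrable g ->
  cintegral mu (fun x => f x + g x) = cintegral mu f + cintegral mu g.
Proof.
move=> [f1 f2] [g1 g2]; rewrite /cintegral; apply: complexP => /=.
  under eq_Rintegral do rewrite ReD; exact: RintegralD.
under eq_Rintegral do rewrite ImD; exact: RintegralD.
Qed.

Lemma cintegralZ (c : R[i]) f : cintegrable f ->
  cintegral mu (fun x => c * f x) = c * cintegral mu f.
Proof.
move=> [f1 f2]; rewrite /cintegral; apply: complexP; rewrite ?ReM ?ImM /=.
  under eq_Rintegral do rewrite ReM.
  rewrite RintegralB// ?RintegralZl//.
  - by rewrite /comp; under eq_fun do rewrite EFinM; exact: integrableZl.
  - by rewrite /comp; under eq_fun do rewrite EFinM; exact: integrableZl.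
under eq_Rintegral do rewrite ImM.
rewrite RintegralD// ?RintegralZl//.
- by rewrite /comp; under eq_fun do rewrite EFinM; exact: integrableZl.
- by rewrite /comp; under eq_fun do rewrite EFinM; exact: integrableZl.
Qed.

Lemma cintegralN f : cintegrable f ->
  cintegral mu (fun x => - f x) = - cintegral mu f.
Proof.
move=> cf; rewrite -mulN1r -cintegralZ//; congr (cintegral mu _).
by apply/funext => x; rewrite mulN1r.
Qed.

Lemma cintegralB f g : cintegrable f -> cintegrable g ->
  cintegral mu (fun x => f x - g x) = cintegral mu f - cintegral mu g.
Proof.
by move=> cf cg; rewrite cintegralD// ?cintegralN//; exact: cintegrableN.
Qed.

Lemma cintegral0 : cintegral mu (fun=> 0) = 0.
Proof.
by rewrite /cintegral /Rintegral integral0.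
Qed.

Lemma cintegral_sum (I : Type) (r : seq I) (F : I -> X -> R[i]) :
  (forall i, cintegrable (F i)) ->
  cintegral mu (fun x => \sum_(i <- r) F i x) = \sum_(i <- r) cintegral mu (F i).
Proof.
move=> cF; elim: r => [|i r IH].
  rewrite big_nil; under [X in cintegral _ X]eq_fun do rewrite big_nil; exact: cintegral0.
rewrite big_cons -IH -cintegralD//; last exact: cintegrable_sum.
by congr (cintegral mu _); apply/funext => x; rewrite big_cons.
Qed.

Lemma cintegralJ f : cintegrable f ->
  cintegral mu (fun x => (f x)^*) = (cintegral mu f)^*.
Proof.
move=> [f1 f2]; apply: complexP; rewrite ?ReJ ?ImJ /cintegral/=.
  by apply: eq_Rintegral => x _; rewrite ReJ.
under eq_Rintegral do rewrite ImJ -mulN1r.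
by rewrite RintegralZl// mulN1r.
Qed.

Lemma cintegrable_le f (h : X -> R) : cmeasurable f ->
  mu.-integrable setT (EFin \o h) -> (forall x, Normc.normc (f x) <= h x) ->
  cintegrable f.
Proof.
move=> [f1 f2] ih fh; split.
  apply: le_integrable ih => //; first exact/measurable_EFinP.
  move=> x _; rewrite lee_fin (le_trans (normc_Re _))// (le_trans (fh x))//.
  exact: ler_norm.
apply: le_integrable ih => //; first exact/measurable_EFinP.
move=> x _; rewrite lee_fin (le_trans (normc_Im _))// (le_trans (fh x))//.
exact: ler_norm.
Qed.

Lemma integrable_sqc f : cmeasurable f -> (nsq mu f < +oo)%E ->
  mu.-integrable setT (EFin \o (fun x => sqc (f x))).
Proof.
move=> mf fy; apply/integrableP; split; first exact: emeasurable_sqc.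
under eq_integral do rewrite /= ger0_norm ?sqc_ge0//.
exact: fy.
Qed.

Lemma cintegrable_mulJ f g : cmeasurable f -> cmeasurable g ->
  (nsq mu f < +oo)%E -> (nsq mu g < +oo)%E -> cintegrable (fun x => f x * (g x)^*).
Proof.
move=> mf mg fy gy; apply: (cintegrable_le (h := fun x => sqc (f x) + sqc (g x))).
- by apply: cmeasurableM => //; exact: cmeasurableJ.
- rewrite /comp; under eq_fun do rewrite EFinD.
  by apply: integrableD => //; exact: integrable_sqc.
- move=> x; rewrite Normc.normcM (_ : Normc.normc (g x)^* = Normc.normc (g x)).
    rewrite -!normc_sqr; have := normc_ge0 (f x); have := normc_ge0 (g x).
    by have := sqr_ge0 (Normc.normc (f x) - Normc.normc (g x)); nra.
  by rewrite !normc_sqrt sqcJ.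
Qed.

Lemma cintegral_sqc f : cmeasurable f ->
  cintegral mu (fun x => f x * (f x)^*) = (fine (nsq mu f))%:C.
Proof.
move=> mf; apply: complexP => /=.
  by rewrite /nsq; congr fine; apply: eq_integral => x _; rewrite sqcE.
rewrite /Rintegral (_ : (\int[mu]_x _)%E = 0%E)//.
by apply: integral0_eq => x _; rewrite sqcE.
Qed.

End cintegral_theory.

Section count_enum.
Context {J : countType}.

(** An increasing exhaustion of [J] by finite sets. It links series indexed by [nat] through
    [pickle_inv] with sums over finite sets. *)
Definition enumF (N : nat) : {fset J} :=
  [fset j | j in pmap (@pickle_inv J) (iota 0 N)]%fset.

Lemma mem_enumF j N : (j \in enumF N) = (choice.pickle j < N)%N.
Proof.
rewrite /enumF inE mem_pmap; apply/mapP/idP => [[k]|jN].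
  rewrite mem_iota add0n => /andP[_ kN] /esym pk.
  by have := @pickle_invK J k; rewrite pk /= => ->.
by exists (choice.pickle j); [rewrite mem_iota|rewrite pickleK_inv].
Qed.

Lemma pmap_pickle_inv_uniq s : uniq s -> uniq (pmap (@pickle_inv J) s).
Proof. by apply: pmap_uniq; exact: pickle_invK. Qed.

Lemma sum_enumF (V : nmodType) (a : J -> V) N :
  \sum_(0 <= i < N) oapp a 0 (pickle_inv i) = \sum_(j <- enumF N) a j.
Proof.
transitivity (\sum_(j <- pmap (@pickle_inv J) (iota 0 N)) a j).
  rewrite /index_iota subn0; elim: (iota 0 N) => [|i s IH]; first by rewrite !big_nil.
  by rewrite big_cons/= IH; case: pickle_inv => //= [j|]; rewrite ?big_cons ?add0r.
apply: perm_big; apply: uniq_perm; first exact/pmap_pickle_inv_uniq/iota_uniq.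
  exact: fset_uniq.
by move=> j; rewrite /enumF inE.
Qed.

Lemma enumF_mono M N : (M <= N)%N -> (enumF M `<=` enumF N)%fset.
Proof. by move=> MN; apply/fsubsetP => j; rewrite !mem_enumF => /leq_trans; apply. Qed.

Lemma enumF_exhaust (F : {fset J}) : exists N, (F `<=` enumF N)%fset.
Proof.
exists (\max_(j <- F) (choice.pickle j).+1)%N; apply/fsubsetP => j jF.
rewrite mem_enumF.
exact: (@leq_bigmax_seq J (enum_fset F) xpredT (fun j => (choice.pickle j).+1) j jF isT).
Qed.

End count_enum.

(** * Bessel's inequality and Parseval's identity *)

Section orthonormal_system.
Context d (X : measurableType d) (R : realType).
Variable mu : {measure set X -> \bar R}.
Variables (J : choiceType) (e : J -> X -> R[i]).
Hypothesis me : forall j, cmeasurable (e j).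
Hypothesis e_lty : forall j, (nsq mu (e j) < +oo)%E.
Hypothesis orthonormal : forall j k,
  cintegral mu (fun x => e j x * (e k x)^*) = (j == k)%:R.
Implicit Types (f g : X -> R[i]) (F : {fset J}) (c : J -> R[i]).

Definition fcoef f j := cintegral mu (fun x => f x * (e j x)^*).

Lemma cmeasurable_lin_comb F c : cmeasurable (lin_comb e F c).
Proof.
by apply: cmeasurable_sum => j; apply: cmeasurableM => //; exact: cmeasurable_cst.
Qed.

Lemma lin_comb_lty F c : (nsq mu (lin_comb e F c) < +oo)%E.
Proof.
apply: nsq_sum_lty => j; first by apply: cmeasurableM => //; exact: cmeasurable_cst.
exact: nsqZ_lty.
Qed.

Lemma fcoefB f g k : cmeasurable f -> cmeasurable g ->
  (nsq mu f < +oo)%E -> (nsq mu g < +oo)%E ->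
  fcoef (fun x => f x - g x) k = fcoef f k - fcoef g k.
Proof.
move=> mf mg fy gy; rewrite /fcoef -cintegralB; last 2 first.
- exact: cintegrable_mulJ.
- exact: cintegrable_mulJ.
by congr (cintegral mu _); apply/funext => x; rewrite mulrBl.
Qed.

(** Completing the square in [a]. *)
Lemma nsq_sub1 f (a : R[i]) k : cmeasurable f -> (nsq mu f < +oo)%E ->
  fine (nsq mu (fun x => f x - a * e k x)%R) =
  fine (nsq mu f) - sqc (fcoef f k) + sqc (a - fcoef f k).
Proof.
move=> mf fy.
have mae : cmeasurable (fun x => a * e k x).
  by apply: cmeasurableM => //; exact: cmeasurable_cst.
have aey : (nsq mu (fun x => a * e k x)%R < +oo)%E by exact: nsqZ_lty.
apply: (@complexI R); rewrite -cintegral_sqc; last exact: cmeasurableB.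
rewrite raddfD raddfB /= -!sqcE -cintegral_sqc//.
have E1 : (fun x => (f x - a * e k x) * (f x - a * e k x)^*) =
   (fun x => f x * (f x)^* - a^* * (f x * (e k x)^*)
     - (a * ((f x * (e k x)^*)^*) - a * a^* * (e k x * (e k x)^*))).
  by apply/funext => x; rewrite conjB !conjM conjK; ring.
have i1 : cintegrable mu (fun x => f x * (e k x)^*) by exact: cintegrable_mulJ.
have i2 : cintegrable mu (fun x => (f x * (e k x)^*)^*).
  under eq_fun do rewrite conjM conjK mulrC.
  exact: cintegrable_mulJ.
have i3 : cintegrable mu (fun x => e k x * (e k x)^*) by exact: cintegrable_mulJ.
have i4 : cintegrable mu (fun x => f x * (f x)^*) by exact: cintegrable_mulJ.
rewrite E1 !cintegralB ?cintegralZ//; first last.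
- by apply: cintegrableB; exact: cintegrableZ.
- by apply: cintegrableB => //; exact: cintegrableZ.
- exact: cintegrableZ.
- exact: cintegrableZ.
- exact: cintegrableZ.
rewrite cintegralJ// orthonormal eqxx mulr1 -/(fcoef f k) conjB; ring.
Qed.

Lemma fcoef_sum (r : seq J) c k : k \notin r ->
  fcoef (fun x => \sum_(j <- r) c j * e j x) k = 0.
Proof.
move=> kr; rewrite /fcoef.
under [X in cintegral _ X]eq_fun do rewrite mulr_suml.
rewrite cintegral_sum; last first.
  move=> j; under eq_fun do rewrite -mulrA; apply: cintegrableZ; exact: cintegrable_mulJ.
rewrite big_seq big1// => j jr.
under [X in cintegral _ X]eq_fun do rewrite -mulrA.
rewrite cintegralZ ?orthonormal; last exact: cintegrable_mulJ.
by case: eqP => [jk|_]; rewrite ?mulr0//; move: kr; rewrite -jk jr.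
Qed.

(** Terms are peeled off one at a time, since subtracting the others leaves the [k]-th coefficient
    unchanged. The identity has three uses: [f = 0] gives the norm of a combination, [c = fcoef f]
    Bessel's inequality, and arbitrary [c] the lower bound in Parseval's identity. *)
Lemma nsq_best f F c : cmeasurable f -> (nsq mu f < +oo)%E ->
  fine (nsq mu (fun x => f x - lin_comb e F c x)%R) =
  fine (nsq mu f) - \sum_(j <- F) sqc (fcoef f j)
    + \sum_(j <- F) sqc (c j - fcoef f j).
Proof.
move=> mf fy; rewrite /lin_comb; have := fset_uniq F; elim: (enum_fset F) => [|k r IH].
  by rewrite !big_nil subr0 addr0; under eq_fun do rewrite big_nil subr0.
rewrite cons_uniq => /andP[kr ur]; rewrite !big_cons.
pose S x := \sum_(j <- r) c j * e j x.
have mS : cmeasurable S.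
  by apply: cmeasurable_sum => j; apply: cmeasurableM => //; exact: cmeasurable_cst.
have Sy : (nsq mu S < +oo)%E.
  apply: nsq_sum_lty => j; last exact: nsqZ_lty.
  by apply: cmeasurableM => //; exact: cmeasurable_cst.
have -> : (fun x => f x - \sum_(j <- k :: r) c j * e j x) =
    (fun x => (f x - S x) - c k * e k x).
  by apply/funext => x; rewrite big_cons /S; ring.
rewrite nsq_sub1; [|exact: cmeasurableB|exact: nsqB_lty].
by rewrite (IH ur) fcoefB// (fcoef_sum c kr) subr0; ring.
Qed.

Lemma nsq_lin_comb F c :
  nsq mu (lin_comb e F c) = (\sum_(j <- F) sqc (c j))%:E.
Proof.
have m0 : cmeasurable (fun _ : X => 0 : R[i]) by exact: cmeasurable_cst.
have n0 : nsq mu (fun=> 0%R) = 0%E.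
  by rewrite /nsq; under eq_integral do rewrite sqc0; exact: integral0.
have f0 j : fcoef (fun=> 0) j = 0.
  rewrite /fcoef; under [X in cintegral _ X]eq_fun do rewrite mul0r.
  exact: cintegral0.
have := @nsq_best (fun=> 0) F c m0; rewrite n0 => /(_ (ltry _)).
under [X in nsq _ X]eq_fun do rewrite sub0r.
rewrite nsqN; under eq_bigr do rewrite f0 sqc0.
rewrite big1// subr0 add0r; under eq_bigr do rewrite f0 subr0.
by move=> <-; rewrite fineK// ge0_fin_numE ?nsq_ge0// lin_comb_lty.
Qed.

Definition L2_dense := forall f, cmeasurable f -> (nsq mu f < +oo)%E ->
  forall eps : R, 0 < eps ->
  exists F c, (nsq mu (fun x => f x - lin_comb e F c x)%R <= eps%:E)%E.

Lemma bessel f F : cmeasurable f -> (nsq mu f < +oo)%E ->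
  \sum_(j <- F) sqc (fcoef f j) <= fine (nsq mu f).
Proof.
move=> mf fy; have := @nsq_best f F (fcoef f) mf fy.
rewrite [X in _ = _ + X]big1; last by move=> j _; rewrite subrr sqc0.
rewrite addr0 => H; rewrite -subr_ge0 -H fine_ge0// nsq_ge0//.
Qed.

End orthonormal_system.

Lemma le_sum_fsubset (R : numDomainType) (J : choiceType) (F G : {fset J}) (a : J -> R) :
  (F `<=` G)%fset -> (forall j, 0 <= a j) -> \sum_(j <- F) a j <= \sum_(j <- G) a j.
Proof.
move=> FG a0; rewrite (big_fsetID _ (mem F) G)/= -[leLHS]addr0 lerD//.
  rewrite le_eqVlt; apply/orP; left; apply/eqP; apply: eq_fbigl => j.
  rewrite !inE/=; apply/idP/idP => [jF|/andP[]//].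
  by rewrite jF andbT (fsubsetP FG).
exact: sumr_ge0.
Qed.

(** Bessel's inequality bounds the partial sums. Conversely, by [nsq_best], the defect of a finite
    set is at most the squared distance from [f] to any combination over that set, and density makes
    this small. *)
Lemma parseval d (X : measurableType d) (R : realType)
    (mu : {measure set X -> \bar R}) (J : countType) (e : J -> X -> R[i])
    (f : X -> R[i]) :
  (forall j, cmeasurable (e j)) -> (forall j, (nsq mu (e j) < +oo)%E) ->
  (forall j k, cintegral mu (fun x => e j x * (e k x)^*) = (j == k)%:R) ->
  L2_dense mu e -> cmeasurable f -> (nsq mu f < +oo)%E ->
  (\sum_(i <oo) oapp (fun j => (sqc (fcoef mu e f j))%:E) 0%E (pickle_inv i) =
   nsq mu f)%E.
Proof.
move=> me ey orth dense mf fy.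
pose a (i : nat) := oapp (fun j => (sqc (fcoef mu e f j))%:E) 0%E (@pickle_inv J i).
have a0 i : (0 <= a i)%E.
  by rewrite /a; case: pickle_inv => //= j; rewrite lee_fin sqc_ge0.
have aS N : (\sum_(0 <= i < N) a i)%E = (\sum_(j <- @enumF J N) sqc (fcoef mu e f j))%:E.
  by rewrite -sumEFin -sum_enumF.
have nf : nsq mu f = (fine (nsq mu f))%:E by rewrite fineK// ge0_fin_numE ?nsq_ge0.
rewrite -[LHS]/(\sum_(i <oo) a i)%E.
apply/eqP; rewrite eq_le; apply/andP; split.
  apply: lime_le; first by apply: is_cvg_nneseries.
  by apply: nearW => N; rewrite aS nf lee_fin; exact: bessel.
apply/lee_addgt0Pr => eps eps0.
have [F [c Fc]] := dense _ mf fy _ eps0.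
have [N FN] := @enumF_exhaust J F.
apply: (@le_trans _ _ (\sum_(0 <= i < N) a i + eps%:E)%E); last first.
  by rewrite leeD2r//; exact: nneseries_lim_ge.
rewrite aS nf -EFinD lee_fin.
have hF : \sum_(j <- F) sqc (fcoef mu e f j) <= \sum_(j <- enumF N) sqc (fcoef mu e f j).
  by apply: le_sum_fsubset => // j; exact: sqc_ge0.
have := @nsq_best _ _ _ _ _ _ me ey orth f F c mf fy => H.
have : fine (nsq mu (fun x => f x - lin_comb e F c x)%R) <= eps.
  rewrite -lee_fin fineK// ge0_fin_numE ?nsq_ge0//; exact: le_lt_trans Fc (ltry _).
have : 0 <= \sum_(j <- F) sqc (c j - fcoef mu e f j).
  by apply: sumr_ge0 => j _; exact: sqc_ge0.
by rewrite H; lra.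
Qed.

(** * Trigonometric polynomials: positivity test and density *)

Section trigonometric_polynomials.
Import HBNNSimple.
Context d (X : measurableType d) (R : realType).
Variable mu : {measure set X -> \bar R}.
Variables (J : choiceType) (th : J -> X -> R).
Hypothesis mth : forall j, measurable_fun setT (th j).
Hypothesis thD : forall j k, exists l, forall x, th j x + th k x = th l x.
Hypothesis thN : forall j, exists l, forall x, th l x = - th j x.
Hypothesis th0 : exists j, forall x, th j x = 0.
Local Notation e := (fun j x => expi (th j x)).

(** The phases are closed under sums and opposites, so the functions [e j] behave as a group of
    characters. The inductive form makes closure under products an induction; the normal form over a
    finite set comes back in [tpoly_lin_comb]. *)
Inductive tpoly : (X -> R[i]) -> Prop :=
| tpoly_e j : tpoly (e j)
| tpolyZ (c : R[i]) p : tpoly p -> tpoly (fun x => c * p x)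
| tpolyD p q : tpoly p -> tpoly q -> tpoly (fun x => p x + q x).

Lemma cmeasurable_tpoly p : tpoly p -> cmeasurable p.
Proof.
elim=> [j|c q _ IH|q r _ IH1 _ IH2]; first exact: cmeasurable_expi.
  by apply: cmeasurableM => //; exact: cmeasurable_cst.
exact: cmeasurableD.
Qed.

Lemma tpoly_lin_comb p : tpoly p -> exists F c, p = lin_comb e F c.
Proof.
(* Padding with zero coefficients, so that two combinations can share one index set. *)
have ext (F G : {fset J}) c : (F `<=` G)%fset ->
    lin_comb e F c = lin_comb e G (fun j => if j \in F then c j else 0).
  move=> FG; apply/funext => x; rewrite /lin_comb (big_fsetID _ (mem F) G)/=.
  rewrite [X in _ = _ + X]big1_fset ?addr0; last first.
    by move=> j; rewrite !inE => /andP[_ /negbTE ->] _; rewrite mul0r.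
  have -> : [fset x0 in G | x0 \in F]%fset = F.
    apply/fsetP => j; rewrite !inE/=; apply/idP/idP => [/andP[]//|jF].
    by rewrite jF (fsubsetP FG).
  by rewrite big_seq [RHS]big_seq; apply: eq_bigr => j ->.
elim=> [j|c q _ [F [a ->]]|q r _ [F [a ->]] _ [G [b ->]]].
- exists [fset j]%fset, (fun=> 1); apply/funext => x.
  by rewrite /lin_comb big_seq_fset1 mul1r.
- exists F, (fun j => c * a j); apply/funext => x.
  by rewrite /lin_comb mulr_sumr; apply: eq_bigr => j _; rewrite mulrA.
- exists (F `|` G)%fset, (fun j => (if j \in F then a j else 0) + (if j \in G then b j else 0)).
  apply/funext => x; rewrite (ext F (F `|` G)%fset) ?fsubsetUl//.
  rewrite (ext G (F `|` G)%fset) ?fsubsetUr// /lin_comb -big_split/=.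
  by apply: eq_bigr => j _; rewrite mulrDl.
Qed.

Lemma tpoly_cst (c : R[i]) : tpoly (fun=> c).
Proof.
have [j0 j0E] := th0; have := tpolyZ c (tpoly_e j0).
by congr tpoly; apply/funext => x; rewrite j0E expi0 mulr1.
Qed.

Lemma tpolyM p q : tpoly p -> tpoly q -> tpoly (fun x => p x * q x).
Proof.
move=> tp tq; elim: tp => [j|c r _ IH|r s _ IH1 _ IH2].
- elim: tq => [k|c r _ IH|r s _ IH1 _ IH2].
  + have [l lE] := thD j k; have := tpoly_e l.
    by congr tpoly; apply/funext => x; rewrite -expiD lE.
  + by have := tpolyZ c IH; congr tpoly; apply/funext => x; rewrite mulrCA.
  + by have := tpolyD IH1 IH2; congr tpoly; apply/funext => x; rewrite mulrDr.
- by have := tpolyZ c IH; congr tpoly; apply/funext => x; rewrite mulrA.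
- by have := tpolyD IH1 IH2; congr tpoly; apply/funext => x; rewrite mulrDl.
Qed.

Definition rtpoly (p : X -> R) := tpoly (fun x => (p x)%:C).

Lemma measurable_rtpoly p : rtpoly p -> measurable_fun setT p.
Proof. by move=> /cmeasurable_tpoly[]. Qed.

Lemma rtpoly_cst c : rtpoly (fun=> c). Proof. exact: tpoly_cst. Qed.

Lemma rtpolyD p q : rtpoly p -> rtpoly q -> rtpoly (fun x => p x + q x).
Proof.
move=> tp tq; have := tpolyD tp tq; congr tpoly; apply/funext => x.
by rewrite raddfD.
Qed.

Lemma rtpolyM p q : rtpoly p -> rtpoly q -> rtpoly (fun x => p x * q x).
Proof.
move=> tp tq; have := tpolyM tp tq; congr tpoly; apply/funext => x.
by rewrite rmorphM.
Qed.

Lemma rtpoly_cos j (t : R) : rtpoly (fun x => cos (th j x - t)).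
Proof.
have [l lE] := thN j.
have := tpolyD (tpolyZ (2^-1%:C * expi (- t)) (tpoly_e j)) (tpolyZ (2^-1%:C * expi t) (tpoly_e l)).
congr tpoly; apply/funext => x; rewrite lE -!mulrA -!expiD.
apply: complexP; rewrite ?ReD ?ImD ?ReM ?ImM /=.
  by rewrite (addrC (- t)) -(opprB (th j x) t) cosN; lra.
by rewrite (addrC (- t)) -(opprB (th j x) t) sinN; lra.
Qed.

Hypothesis approx : forall g : X -> R, measurable_fun setT g ->
  (forall x, 0 <= g x) -> (\int[mu]_x (g x)%:E < +oo)%E ->
  forall A, measurable A -> approx_sets mu rtpoly g A.
Hypothesis mu_fin : (mu setT < +oo)%E.

Lemma ae_ge0_of_tpoly (u : X -> R) : mu.-integrable setT (EFin \o u) ->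
  (forall p, rtpoly p -> (0 <= \int[mu]_x (p x ^+ 2 * u x)%:E)%E) ->
  {ae mu, forall x, 0 <= u x}.
Proof.
move=> iu pu; have mu' : measurable_fun setT u by apply/measurable_EFinP; exact: measurable_int iu.
pose g x : R := `|u x|.
have mg : measurable_fun setT g by exact: measurableT_comp.
have gy : (\int[mu]_x (g x)%:E < +oo)%E by have /integrableP[] := iu.
pose E := [set x | u x < 0].
have mE : measurable E.
  rewrite -[X in measurable X]setTI; apply: measurable_fun_ltr => //.
have [_ [mE1 _ aE]] := approx mg (fun x => normr_ge0 _) gy mE.
pose v x : R := \1_E x * g x.
have v0 x : 0 <= v x by rewrite mulr_ge0 ?normr_ge0// indicE; case: (_ \in _).
have mv : measurable_fun setT (EFin \o v) by apply/measurable_EFinP; exact: measurable_funM.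
have vle (eps : R) : 0 < eps -> (\int[mu]_x (v x)%:E <= 0 + eps%:E)%E.
  move=> e0; have e2 : 0 < eps / 2 by rewrite divr_gt0.
  have [p [tp p01 pE]] := aE _ e2; have mp := measurable_rtpoly tp.
  have ig : mu.-integrable setT (EFin \o g) by exact: integrable_norm.
  have i1 : mu.-integrable setT (fun x => (p x ^+ 2 * u x)%:E).
    apply: le_integrable ig => //.
      by apply/measurable_EFinP; apply: measurable_funM => //; exact: measurable_funX.
    move=> x _; rewrite lee_fin normrM (normr_id (u x)) ler_piMl//.
    by have := p01 x; rewrite ger0_norm ?sqr_ge0//; nra.
  have i2 : mu.-integrable setT (fun x => (`|p x - \1_E x| * g x)%:E).
    apply: le_integrable ig => //; first exact: measurable_wdist.
    move=> x _; rewrite lee_fin normrM normr_id normr_id ler_piMl//.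
    by have := p01 x; rewrite indicE; case: (x \in E) => /=; case: ler0P; lra.
  (* Pointwise, |u| 1_E <= 2 |p - 1_E| |u| - p^2 u. On [E] the difference of the two sides is -u (1
     - p)^2; off [E] the left side vanishes and the right one is p u (2 - p). After integration the
     term in p^2 u is at most 0 by hypothesis. *)
  apply: (@le_trans _ _ (\int[mu]_x ((-1)%:E * (p x ^+ 2 * u x)%:E + 2%:E * (`|p x - \1_E x| * g x)%:E))%E).
    apply: ge0_le_integral => //.
    - by move=> x _; rewrite lee_fin.
    - apply: emeasurable_funD; apply: measurable_funeM.
        exact: measurable_int i1.
      exact: measurable_int i2.
    move=> x _; rewrite -!EFinM -EFinD lee_fin /v /g.
    have := p01 x; have := normr_ge0 (u x); rewrite indicE.
    have [xE|xE] := boolP (x \in E); rewrite /= ?mul1r ?mul0r ?subr0.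
      move: xE; rewrite inE /E/= => ux; rewrite ltr0_norm// => _ /andP[p0 p1].
      rewrite distrC ger0_norm ?subr_ge0// -subr_ge0.
      rewrite (_ : _ - _ = - u x * (1 - p x) ^+ 2); last by ring.
      by rewrite mulr_ge0 ?sqr_ge0// oppr_ge0 ltW.
    move: xE; rewrite notin_setE /E/= => /negP; rewrite -leNgt => ux.
    move=> _ /andP[p0 p1]; rewrite !ger0_norm//.
    rewrite (_ : _ + _ = p x * u x * (2 - p x)); last by ring.
    by rewrite !mulr_ge0//; lra.
  rewrite integralD//; [|exact: integrableZl|exact: integrableZl].
  rewrite !integralZl//; apply: leeD.
    by rewrite EFinN mulN1e oppe_le0; exact: pu.
  have -> : eps%:E = (2%:E * (eps / 2)%:E)%E by rewrite -EFinM mulrCA divff ?mulr1.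
  by rewrite lee_pmul2l.
have : (\int[mu]_x `|(EFin \o v) x| = 0)%E.
  apply/eqP; rewrite eq_le integral_ge0// andbT.
  under eq_integral do rewrite /= ger0_norm//.
  exact/lee_addgt0Pr.
move/(ae_eq_integral_abs mu measurableT mv); apply: filterS => x /(_ I) /= [].
rewrite /v /g indicE; have [//|ux] := leP 0 (u x).
rewrite mem_set//= mul1r => /normr0_eq0 u0.
by move: ux; rewrite u0 ltxx.
Qed.

(** For the weight 1, the L^1 approximation of indicators is an L^2 one, because |p - 1_A| <= 1
    makes the square no larger than the modulus. The closure [D] is then climbed from indicators to
    simple, nonnegative, real and complex functions. *)
Lemma L2_dense_tpoly : L2_dense mu e.
Proof.
pose D (f : X -> R[i]) := cmeasurable f /\ forall eps : R, 0 < eps ->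
  exists p, tpoly p /\ (nsq mu (fun x => f x - p x)%R <= eps%:E)%E.
have DD f g : D f -> D g -> D (fun x => f x + g x).
  move=> [mf Df] [mg Dg]; split => [|eps e0]; first exact: cmeasurableD.
  have e4 : 0 < eps / 4 by rewrite divr_gt0.
  have [p [tp pf]] := Df _ e4; have [q [tq qg]] := Dg _ e4.
  exists (fun x => p x + q x); split; first exact: tpolyD.
  have mp := cmeasurable_tpoly tp; have mq := cmeasurable_tpoly tq.
  under [X in nsq _ X]eq_fun do rewrite opprD addrACA.
  apply: (le_trans (nsqD2 mu (cmeasurableB mf mp) (cmeasurableB mg mq))).
  have -> : eps%:E = (2%:E * ((eps / 4)%:E + (eps / 4)%:E))%E.
    by rewrite -EFinD -EFinM; congr EFin; field.
  by rewrite lee_pmul2l//; exact: leeD.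
have DZ (c : R[i]) f : D f -> D (fun x => c * f x).
  move=> [mf Df]; split => [|eps e0].
    by apply: cmeasurableM => //; exact: cmeasurable_cst.
  have c1 : 0 < 1 + sqc c by have := sqc_ge0 c; lra.
  have [p [tp pf]] := Df _ (divr_gt0 e0 c1).
  exists (fun x => c * p x); split; first exact: tpolyZ.
  under [X in nsq _ X]eq_fun do rewrite -mulrBr.
  rewrite nsqZ; last by apply: cmeasurableB => //; exact: cmeasurable_tpoly.
  apply: (@le_trans _ _ ((sqc c)%:E * (eps / (1 + sqc c))%:E)%E).
    by rewrite lee_wpmul2l// lee_fin sqc_ge0.
  rewrite -EFinM lee_fin mulrA ler_pdivrMr// mulrC ler_pM2l//.
  by rewrite lerDr.
have Dlim f : cmeasurable f -> (forall eps : R, 0 < eps ->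
    exists2 g, D g & (nsq mu (fun x => f x - g x)%R <= eps%:E)%E) -> D f.
  move=> mf H; split => // eps e0.
  have e4 : 0 < eps / 4 by rewrite divr_gt0.
  have [g [mg Dg] fg] := H _ e4; have [p [tp gp]] := Dg _ e4.
  exists p; split => //.
  apply: (le_trans (nsq_triangle mu mf mg (cmeasurable_tpoly tp))).
  have -> : eps%:E = (2%:E * ((eps / 4)%:E + (eps / 4)%:E))%E.
    by rewrite -EFinD -EFinM; congr EFin; field.
  by rewrite lee_pmul2l//; exact: leeD.
have Dind A : measurable A -> D (fun x => (\1_A x)%:C).
  move=> mA; split => [|eps e0].
    by apply: cmeasurable_real; exact: measurable_indic.
  have [_ [_ _ /(_ _ e0)[p [tp p01 pA]]]] : approx_sets mu rtpoly (fun=> 1) A.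
    by apply: approx => //; rewrite integral_cst// mul1e.
  exists (fun x => (p x)%:C); split => //; apply: le_trans pA.
  have mp := measurable_rtpoly tp.
  apply: ge0_le_integral => //.
  - by move=> x _; rewrite lee_fin sqc_ge0.
  - by apply: emeasurable_sqc; apply: cmeasurableB; apply: cmeasurable_real.
  - exact: measurable_wdist.
  move=> x _; rewrite lee_fin mulr1 -raddfB sqc_real.
  have := p01 x; rewrite indicE -real_normK ?num_real// distrC.
  by case: (x \in A) => /= /andP[p0 p1]; rewrite ?subr0;
    [rewrite -normrN opprB|]; rewrite ger0_norm ?subr_ge0//; nra.
have Dsum (s : seq R) (A : R -> set X) (a : R -> R) : (forall y, measurable (A y)) ->
    D (fun x => (\sum_(y <- s) a y * \1_(A y) x)%:C).
  move=> mA; elim: s => [|y s IH].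
    have := DZ 0 _ (Dind set0 measurable0); congr D; apply/funext => x.
    by rewrite mul0r big_nil.
  under eq_fun do rewrite big_cons raddfD /= rmorphM /=; apply: DD => //.
  exact/DZ/Dind.
have Dnn (f : X -> R) : measurable_fun setT f -> (forall x, 0 <= f x) ->
    (nsq mu (fun x => (f x)%:C) < +oo)%E -> D (fun x => (f x)%:C).
  move=> mf f0 fy; apply: Dlim; first exact: cmeasurable_real.
  have mef : measurable_fun setT (EFin \o f) by exact/measurable_EFinP.
  pose f_ := nnsfun_approx measurableT mef.
  have f_f x : (fun j => (f_ j x)%:E) @ \oo --> (f x)%:E.
    by apply: cvg_nnsfun_approx => // y _; rewrite lee_fin.
  have f_le j x : f_ j x <= f x.
    have /fine_cvgP[_ cx] := f_f x; rewrite -(cvg_lim _ cx)//.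
    apply: (nondecreasing_cvgn_le (u_ := fun j => f_ j x)).
      by move=> a b ab; exact/lefP/nd_nnsfun_approx.
    by apply/cvg_ex; exists (f x).
  have mf_ j : measurable_fun setT (f_ j) by [].
  have [_ H _] : [/\ mu.-integrable setT (fun x : X => 0%E : \bar R),
    [sequence \int[mu]_x `|(sqc ((f x)%:C - (f_ j x)%:C))%:E - 0|]_j%E @ \oo --> 0%E &
    [sequence \int[mu]_x (sqc ((f x)%:C - (f_ j x)%:C))%:E]_j%E @ \oo --> \int[mu]_x 0%E]%E.
    apply: dominated_convergence => //.
    - move=> j; apply: emeasurable_sqc.
      by apply: cmeasurableB; apply: cmeasurable_real.
    - apply: aeW => x _; apply: cvg_EFin; first exact: nearW.
      have /fine_cvgP[_ cx] := f_f x.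
      under eq_fun do rewrite -raddfB sqc_real expr2.
      rewrite (_ : 0 = 0 * 0); last by rewrite mulr0.
      by apply: cvgM; rewrite -(subrr (f x)); apply: cvgB => //; exact: cvg_cst.
    - exact: (integrable_sqc (cmeasurable_real mf) fy).
    - apply: aeW => x j _; rewrite abse_EFin lee_fin ger0_norm ?sqc_ge0//.
      rewrite -raddfB !sqc_real ler_sqr ?nnegrE ?subr_ge0//.
      by rewrite lerBlDr lerDl.
  move=> eps e0; have [|N HN] := cvge0_le _ H e0.
    by move=> j; apply: integral_ge0.
  exists (fun x => (f_ N x)%:C); last first.
    apply: le_trans (HN _ (leqnn N)); rewrite le_eqVlt; apply/orP; left; apply/eqP.
    by apply: eq_integral => x _; rewrite sube0 abse_EFin ger0_norm ?sqc_ge0.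
  have := Dsum (fset_set (range (f_ N))) (fun y => f_ N @^-1` [set y]) id (fun y => measurable_funPTI (f_ N) (measurable_set1 y)).
  congr D; apply/funext => x; congr (_%:C).
  rewrite [RHS]fimfunE (fsbig_finite _ _ (fimfunP _))//=.
have Dreal (f : X -> R) : measurable_fun setT f ->
    (nsq mu (fun x => (f x)%:C) < +oo)%E -> D (fun x => (f x)%:C).
  move=> mf fy.
  have sq_le (h : X -> R) : measurable_fun setT h -> (forall x, `|h x| <= `|f x|) ->
      (nsq mu (fun x => (h x)%:C) < +oo)%E.
    move=> mh hf; apply: le_lt_trans fy; apply: le_nsq; try exact: cmeasurable_real.
    move=> x; rewrite !sqc_real -(real_normK (num_real (h x))) -(real_normK (num_real (f x))).
    by rewrite ler_sqr ?nnegrE.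
  have mp : measurable_fun setT f^\+ by exact: measurable_funrpos.
  have mn : measurable_fun setT f^\- by exact: measurable_funrneg.
  have D1 : D (fun x => (f^\+ x)%:C).
    apply: Dnn => //; apply: sq_le => // x; rewrite /funrpos.
    by rewrite /Num.max; case: ifP => //; rewrite normr0.
  have D2 : D (fun x => (f^\- x)%:C).
    apply: Dnn => //; apply: sq_le => // x; rewrite /funrneg.
    by rewrite /Num.max; case: ifP => // _; rewrite ?normrN// normr0.
  have := DD _ _ D1 (DZ (-1) _ D2); congr D; apply/funext => x.
  by rewrite mulN1r -raddfB; congr (_%:C); have := funrposBneg f; move/(congr1 (@^~ x)).
move=> f [m1 m2] fy.
have D1 : D (fun x => (complex.Re (f x))%:C).
  apply: Dreal => //; apply: le_lt_trans fy; apply: le_nsq; [exact: cmeasurable_real|by []|].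
  by move=> x; rewrite sqc_real lerDl sqr_ge0.
have D2 : D (fun x => (complex.Im (f x))%:C).
  apply: Dreal => //; apply: le_lt_trans fy; apply: le_nsq; [exact: cmeasurable_real|by []|].
  by move=> x; rewrite sqc_real lerDr sqr_ge0.
have [_ Df] : D f.
  have := DD _ _ D1 (DZ (0 +i* 1) _ D2); congr D; apply/funext => x.
  by apply: complexP; rewrite ?ReD ?ImD ?ReM ?ImM/=; ring.
move=> eps /Df[p [/tpoly_lin_comb[F [c ->]] pf]].
by exists F, c.
Qed.

End trigonometric_polynomials.

Section orthonormal_phases.
Context d (X : measurableType d) (R : realType).
Variable mu : {measure set X -> \bar R}.
Variables (J : choiceType) (th : J -> X -> R).
Hypothesis mth : forall j, measurable_fun setT (th j).
Hypothesis mu1 : mu setT = 1%E.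
Hypothesis cos_th : forall j k t, j != k ->
  (\int[mu]_x (1 + cos (th j x - th k x + t))%:E = 1)%E.

Lemma nsq_expi (f : X -> R) : nsq mu (fun x => expi (f x)) = 1%E.
Proof.
by rewrite /nsq; under eq_integral do rewrite sqc_expi; rewrite integral_cst// mul1e.
Qed.

Lemma Rintegral_cos_phase j k t : j != k ->
  \int[mu]_x cos (th j x - th k x + t) = 0.
Proof.
move=> jk.
have mc : measurable_fun setT (fun x => cos (th j x - th k x + t)).
  apply: measurableT_comp; first by apply: continuous_measurable_fun; exact: continuous_cos.
  by apply: measurable_funD => //; exact: measurable_funB.
have i1 : mu.-integrable setT (EFin \o (fun=> 1 : R)).
  apply/integrableP; split; first exact: measurable_cst.
  under eq_integral do rewrite /= normr1.
  by rewrite integral_cst// mul1e mu1 ltry.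
have i2 : mu.-integrable setT (EFin \o (fun x => cos (th j x - th k x + t))).
  apply: le_integrable i1 => //; first exact/measurable_EFinP.
  by move=> x _; rewrite lee_fin normr1 ler_norml cos_le1 cos_geN1.
have := cos_th t jk => /(congr1 fine) H.
have : \int[mu]_x (1 + cos (th j x - th k x + t)) = 1 by [].
rewrite RintegralD// Rintegral_cst// mu1 mul1r => /eqP.
by rewrite -subr_eq0 addrAC subrr add0r => /eqP.
Qed.

Lemma orthonormal_expi j k :
  cintegral mu (fun x => expi (th j x) * (expi (th k x))^*) = (j == k)%:R.
Proof.
have [->|jk] := eqVneq j k.
  rewrite cintegral_sqc; last exact: cmeasurable_expi.
  by rewrite nsq_expi.
rewrite (_ : (fun x => _) = (fun x => expi (th j x - th k x))); last first.
  by apply/funext => x; rewrite expiD expiN.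
apply: complexP; rewrite /cintegral/=.
  rewrite -[RHS](Rintegral_cos_phase 0 jk); apply: eq_Rintegral => x _.
  by rewrite addr0.
(* A sine is a cosine with phase [- (pi / 2)]. *)
rewrite -[RHS](Rintegral_cos_phase (- (pi / 2)) jk); apply: eq_Rintegral => x _.
by rewrite cosBpihalf.
Qed.

End orthonormal_phases.

(** * The exponential systems on the torus and on its square *)

Section torus_systems.
Context {R : realType} {n : nat}.
Local Notation TT := (torus_measure R n).
Local Notation TT2 := (prod_measure TT TT).

(** The sign is that of the Zak series, whose [m]-th term carries the character
    [expi (phase1 m xi')]. *)
Definition phase1 (k : Zn n) (x : Rn R n) : R := - (2 * pi * vdot (vec_of_Zn k) x).

Lemma measurable_phase1 k : measurable_fun setT (phase1 k).
Proof. by apply: measurableT_comp => //; exact: measurable_phase. Qed.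

Lemma zsub_eq0 (j k : Zn n) : zsub j k = zzero n -> j = k.
Proof.
move=> h; apply: eq_from_tnth => i; apply/eqP; rewrite -subr_eq0.
by have := congr1 (fun t => tnth t i) h; rewrite !tnth_mktuple => ->.
Qed.

Lemma phase1_orthonormal (j k : Zn n) :
  cintegral TT (fun x => expi (phase1 j x) * (expi (phase1 k x))^*) = (j == k)%:R.
Proof.
apply: orthonormal_expi; [exact: measurable_phase1|exact: torus_measureT|].
move=> {}j {}k t jk; rewrite -[RHS](@integral_torus_cos R n (zsub j k) (- t)).
  apply: eq_integral => x _; congr (1 + _)%:E.
  rewrite -[RHS]cosN; congr cos; rewrite /phase1 vec_zsub vdotBl; ring.
by apply: contra_neq jk => /zsub_eq0.
Qed.

Lemma phase2_orthonormal (j k : Zn n * Zn n) :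
  cintegral TT2 (fun x => expi (phase2 j x) * (expi (phase2 k x))^*) = (j == k)%:R.
Proof.
apply: orthonormal_expi; [exact: measurable_phase2|exact: torus2_measureT|].
move=> {}j {}k t jk; rewrite -[RHS](@integral_torus2_cos R n (zsub j.1 k.1) (zsub j.2 k.2) t).
  apply: eq_integral => x _; congr (1 + cos _)%:E.
  by rewrite /phase2 !vec_zsub !vdotBl/=; ring.
apply: contra_neq jk => h.
have /zsub_eq0 h1 := congr1 fst h; have /zsub_eq0 h2 := congr1 snd h.
by rewrite (surjective_pairing j) h1 h2 -surjective_pairing.
Qed.

Lemma vdot_zadd (j k : Zn n) (x : Rn R n) :
  vdot (vec_of_Zn (zadd j k)) x = vdot (vec_of_Zn j) x + vdot (vec_of_Zn k) x.
Proof. by rewrite vec_zadd vdotDl. Qed.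

Definition zdelta (i : 'I_n) : Zn n := [tuple ((j == i)%:R : int) | j < n].

Lemma vdot_zdelta i (x : Rn R n) : vdot (vec_of_Zn (zdelta i)) x = (tnth x i : R).
Proof.
rewrite /vdot (bigD1 i)//= big1 ?addr0.
  by rewrite vE tnth_mktuple eqxx mul1r.
by move=> j /negbTE ji; rewrite vE tnth_mktuple ji mul0r.
Qed.

Lemma vdot_zopp (k : Zn n) (x : Rn R n) :
  vdot (vec_of_Zn (zsub (zzero n) k)) x = - vdot (vec_of_Zn k) x.
Proof. by rewrite vec_zsub vdotBl vdot_zzero sub0r. Qed.

Let mTT_ae (A : set (Rn R n)) : measurable A -> TT (~` A) = 0%E ->
  {ae TT, forall x, A x}.
Proof. by move=> mA A0; exists (~` A); split => //; exact: measurableC. Qed.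

Lemma torus_setC_cube : TT (~` @unit_cube R n) = 0%E.
Proof. by rewrite /= /torus_measure /mrestr setICl measure0. Qed.

Lemma torus_ae_cube : {ae TT, forall x, @unit_cube R n x}.
Proof. apply: mTT_ae; [exact: measurable_unit_cube|exact: torus_setC_cube]. Qed.

Lemma torus2_ae_cube1 : {ae TT2, forall x, @unit_cube R n x.1}.
Proof.
have mC : measurable (~` @unit_cube R n) by apply: measurableC; exact: measurable_unit_cube.
exists ((~` @unit_cube R n) `*` setT); split.
- exact: measurableX.
- rewrite /prod_measure product_measure1E//.
  by rewrite [X in (X * _)%E]torus_setC_cube mul0e.
- by move=> x /= h; split.
Qed.

Lemma torus2_ae_cube2 : {ae TT2, forall x, @unit_cube R n x.2}.
Proof.
have mC : measurable (~` @unit_cube R n) by apply: measurableC; exact: measurable_unit_cube.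
exists (setT `*` (~` @unit_cube R n)); split.
- exact: measurableX.
- rewrite /prod_measure product_measure1E//.
  by rewrite [X in (_ * X)%E]torus_setC_cube mule0.
- by move=> x /= h; split.
Qed.

Let phase1D (j k : Zn n) : exists l, forall x, phase1 j x + phase1 k x = phase1 l x.
Proof. by exists (zadd j k) => x; rewrite /phase1 vdot_zadd; ring. Qed.
Let phase1N (j : Zn n) : exists l, forall x, phase1 l x = - phase1 j x.
Proof. by exists (zsub (zzero n) j) => x; rewrite /phase1 vdot_zopp; ring. Qed.
Let phase10 : exists j : Zn n, forall x, phase1 j x = 0.
Proof. by exists (zzero n) => x; rewrite /phase1 vdot_zzero mulr0 oppr0. Qed.
Let phase2D (j k : Zn n * Zn n) : exists l, forall x : Rn R n * Rn R n, phase2 j x + phase2 k x = phase2 l x.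
Proof. by exists (zadd j.1 k.1, zadd j.2 k.2) => x; rewrite /phase2/= !vdot_zadd; ring. Qed.
Let phase2N (j : Zn n * Zn n) : exists l, forall x : Rn R n * Rn R n, phase2 l x = - phase2 j x.
Proof.
by exists (zsub (zzero n) j.1, zsub (zzero n) j.2) => x; rewrite /phase2/= !vdot_zopp; ring.
Qed.
Let phase20 : exists j : Zn n * Zn n, forall x : Rn R n * Rn R n, phase2 j x = 0.
Proof. by exists (zzero n, zzero n) => x; rewrite /phase2/= !vdot_zzero addr0 mulr0. Qed.

Lemma phase1_dense : L2_dense TT (fun (k : Zn n) x => expi (phase1 k x)).
Proof.
apply: L2_dense_tpoly; [exact: measurable_phase1| |]; last first.
  by rewrite [ltLHS]torus_measureT ltry.
move=> g mg g0 gy A mA.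
apply: (@approx_sets_preimage _ _ R n TT (rtpoly phase1) (measurable_rtpoly measurable_phase1)
  (rtpoly_cst phase10) (@rtpolyD _ _ _ _ phase1) (rtpolyM phase1D) g mg g0 gy id) => //.
- exact: torus_ae_cube.
- move=> i t; have := rtpoly_cos phase1N (zdelta i) (- t).
  congr rtpoly; apply/funext => x; rewrite -[RHS]cosN; congr cos.
  by rewrite /phase1 vdot_zdelta; ring.
Qed.

Lemma phase2_approx (g : Rn R n * Rn R n -> R) : measurable_fun setT g ->
  (forall x, 0 <= g x) -> (\int[TT2]_x (g x)%:E < +oo)%E ->
  forall A, measurable A -> approx_sets TT2 (rtpoly (@phase2 R n)) g A.
Proof.
move=> mg g0 gy.
have rm := measurable_rtpoly (@measurable_phase2 R n).
have rc := rtpoly_cst phase20; have rM := rtpolyM phase2D.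
have aux := @approx_sets_preimage _ _ R n TT2 _ rm rc (@rtpolyD _ _ _ _ _) rM g mg g0 gy.
apply: sigma_algebra_prod.
- by apply: approx_sets_sigma_algebra => //; exact: rtpolyD.
- move=> A mA; apply: (aux fst) => //; first exact: torus2_ae_cube1.
  move=> i t; have := rtpoly_cos phase2N (zdelta i, zzero n) t.
  congr rtpoly; apply/funext => x; congr cos.
  by rewrite /phase2/= vdot_zdelta vdot_zzero addr0.
- move=> A mA; apply: (aux snd) => //; first exact: torus2_ae_cube2.
  move=> i t; have := rtpoly_cos phase2N (zzero n, zdelta i) t.
  congr rtpoly; apply/funext => x; congr cos.
  by rewrite /phase2/= vdot_zdelta vdot_zzero add0r.
Qed.

Lemma phase2_ae_ge0 (u : Rn R n * Rn R n -> R) : TT2.-integrable setT (EFin \o u) ->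
  (forall F c, (0 <= \int[TT2]_x (sqc (lin_comb (fun kl x => expi (phase2 kl x)) F c x) * u x)%:E)%E) ->
  {ae TT2, forall x, 0 <= u x}.
Proof.
move=> iu H; apply: (ae_ge0_of_tpoly (th := @phase2 R n)) => //.
- exact: measurable_phase2.
- exact: phase2_approx.
- move=> p /tpoly_lin_comb[F [c pE]]; apply: (le_trans (H F c)).
  rewrite le_eqVlt; apply/orP; left; apply/eqP; apply: eq_integral => x _.
  by rewrite -(congr1 (@^~ x) pE) sqc_real.
Qed.

End torus_systems.

(** * Plancherel's theorem *)

Section parametric_integral.
Context d1 d2 (T1 : measurableType d1) (T2 : measurableType d2) (R : realType).
Variable m2 : {sigma_finite_measure set T2 -> \bar R}.

Lemma measurable_parametric_integral (f : T1 * T2 -> \bar R) :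
  measurable_fun setT f -> measurable_fun setT (fun x => \int[m2]_y f (x, y))%E.
Proof.
move=> mf; rewrite (_ : (fun x => _) =
    (fun x => \int[m2]_y f^\+ (x, y) - \int[m2]_y f^\- (x, y))%E); last first.
  apply/funext => x; rewrite integralE; congr (_ - _)%E.
    by apply: eq_integral => y _; rewrite !funeposE.
  by apply: eq_integral => y _; rewrite !funenegE.
apply: emeasurable_funB.
  exact: (measurable_fun_fubini_tonelli_F (m2 := m2) (f^\+)%E (measurable_funepos mf) (fun x => funepos_ge0 f x)).
exact: (measurable_fun_fubini_tonelli_F (m2 := m2) (f^\-)%E (measurable_funeneg mf) (fun x => funeneg_ge0 f x)).
Qed.

Lemma cmeasurable_parametric_integral (f : T1 * T2 -> R[i]) :
  cmeasurable f -> cmeasurable (fun x => cintegral m2 (fun y => f (x, y))).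
Proof.
move=> [f1 f2]; split; rewrite /= /Rintegral.
  apply: (measurableT_comp (fine_measurable measurableT)).
  by apply: (@measurable_parametric_integral (fun p => (complex.Re (f p))%:E)); exact/measurable_EFinP.
apply: (measurableT_comp (fine_measurable measurableT)).
by apply: (@measurable_parametric_integral (fun p => (complex.Im (f p))%:E)); exact/measurable_EFinP.
Qed.

End parametric_integral.

Section finite_unfolding.
Context {R : realType} {n : nat}.
Local Notation lam := (lebesgue_tuple R n).
Local Notation TT := (torus_measure R n).
Local Notation shift k := (fun x : Rn R n => vadd x (vec_of_Zn k)).

Lemma measurable_shift (k : Zn n) : measurable_fun setT (shift k).
Proof. exact: measurable_vadd. Qed.

Lemma integral_cube (f : Rn R n -> \bar R) k : measurable_fun setT f ->
  (\int[lam]_(x in cube k) f x = \int[TT]_x f (vadd x (vec_of_Zn k)))%E.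
Proof.
move=> mf; rewrite integralE [RHS]integralE; congr (_ - _)%E.
  rewrite (ge0_integral_cube k (measurable_funepos mf) (funepos_ge0 f)).
  by apply: eq_integral => x _; rewrite !funeposE.
rewrite (ge0_integral_cube k (measurable_funeneg mf) (funeneg_ge0 f)).
by apply: eq_integral => x _; rewrite !funenegE.
Qed.

(** The finite counterpart of [unfolding]: with finitely many cubes no sign condition is required,
    so complex integrals are within reach. *)
Lemma integral_off_cubes (f : Rn R n -> R) (F : {fset Zn n}) :
  measurable_fun setT f ->
  (forall x, (forall k, k \in F -> ~ cube k x) -> f x = 0) ->
  (\int[lam]_x (f x)%:E = \sum_(k <- F) \int[TT]_x (f (vadd x (vec_of_Zn k)))%:E)%E.
Proof.
move=> mf fF; pose D := \big[setU/set0]_(k <- F) (@cube R n k).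
have mef : measurable_fun setT (EFin \o f) by exact/measurable_EFinP.
have -> : (\int[lam]_x (f x)%:E = \int[lam]_(x in D) (f x)%:E)%E.
  rewrite [RHS]integral_mkcond; apply: eq_integral => x _; rewrite patchE.
  case: ifPn => // xD; rewrite fF// => k kF kx; move/negP: xD; apply; rewrite inE.
  by rewrite /D -bigcup_seq; exists k.
rewrite integral_bigsetU_EFin; last 4 first.
- by move=> k; exact: measurable_cube.
- exact: fset_uniq.
- by move=> k l _ _ [x [kx lx]]; exact: cube_inj kx lx.
- exact: measurable_funTS.
by apply: eq_bigr => k _; rewrite (@integral_cube (EFin \o f)).
Qed.

Lemma Rintegral_off_cubes (f : Rn R n -> R) (F : {fset Zn n}) :
  measurable_fun setT f -> lam.-integrable setT (EFin \o f) ->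
  (forall x, (forall k, k \in F -> ~ cube k x) -> f x = 0) ->
  \int[lam]_x f x = \sum_(k <- F) \int[TT]_x f (vadd x (vec_of_Zn k)).
Proof.
move=> mf lf fF; rewrite /Rintegral (integral_off_cubes mf fF).
rewrite -[RHS]/(fine (_)%:E) -sumEFin; congr fine; apply: eq_bigr => k _.
rewrite fineK// -(@integral_cube (EFin \o f)); last exact/measurable_EFinP.
apply: integrable_fin_num; first exact: measurable_cube.
by apply: integrableS lf => //; exact: measurable_cube.
Qed.

Lemma cintegral_off_cubes (f : Rn R n -> R[i]) (F : {fset Zn n}) :
  cmeasurable f -> cintegrable lam f ->
  (forall x, (forall k, k \in F -> ~ cube k x) -> f x = 0) ->
  cintegral lam f = \sum_(k <- F) cintegral TT (fun x => f (vadd x (vec_of_Zn k))).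
Proof.
move=> [f1 f2] [i1 i2] fF; apply: complexP.
  rewrite Re_sum/=; apply: Rintegral_off_cubes => // x /fF -> //.
rewrite Im_sum/=; apply: Rintegral_off_cubes => // x /fF -> //.
Qed.

Lemma ge0_nsq_off_cubes (f : Rn R n -> R[i]) (F : {fset Zn n}) :
  cmeasurable f ->
  (forall x, (forall k, k \in F -> ~ cube k x) -> f x = 0) ->
  (nsq lam f = \sum_(k <- F) nsq TT (fun x => f (vadd x (vec_of_Zn k)))%R)%E.
Proof.
move=> mf fF; apply: (@integral_off_cubes (fun x => sqc (f x))).
  exact: measurable_sqc.
by move=> x /fF ->; rewrite sqc0.
Qed.

Lemma cbounded_nsq_torus (f : Rn R n -> R[i]) (M : R) : cmeasurable f ->
  (forall x, sqc (f x) <= M) -> (nsq TT f < +oo)%E.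
Proof.
move=> mf fM; apply: (@le_lt_trans _ _ (\int[TT]_x M%:E)%E).
  apply: ge0_le_integral => //.
  - by move=> x _; rewrite lee_fin sqc_ge0.
  - exact: emeasurable_sqc.
  - by move=> x _; rewrite lee_fin.
by rewrite integral_cst//= torus_measureT mule1 ltry.
Qed.

Lemma cbounded_cintegrable_torus (f : Rn R n -> R[i]) (M : R) : cmeasurable f ->
  (forall x, sqc (f x) <= M) -> cintegrable TT f.
Proof.
move=> mf fM.
have m1 : cmeasurable (fun _ : Rn R n => 1 : R[i]) by exact: cmeasurable_cst.
have := cintegrable_mulJ mf m1 (cbounded_nsq_torus mf fM)
  (cbounded_nsq_torus m1 (fun=> lexx (sqc 1))).
congr cintegrable; apply/funext => x.
by apply: complexP; rewrite ?ReM ?ImM ReJ ImJ/=; ring.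
Qed.

End finite_unfolding.
Arguments measurable_shift {R n} k.

Section plancherel.
Context {R : realType} {n : nat}.
Local Notation lam := (lebesgue_tuple R n).
Local Notation TT := (torus_measure R n).
Implicit Types g : Rn R n -> R[i].

Definition ft g (v : Rn R n) : R[i] :=
  cintegral lam (fun x => g x * expi (2 * pi * vdot x v)).

Lemma cmeasurable_ftker g : cmeasurable g ->
  cmeasurable (fun p : Rn R n * Rn R n => g p.2 * expi (2 * pi * vdot p.2 p.1)).
Proof.
move=> mg; apply: cmeasurableM; first exact: cmeasurable_comp.
by apply: cmeasurable_expi; apply: measurable_funM => //; exact: measurable_vdot.
Qed.

Lemma cmeasurable_ft g : cmeasurable g -> cmeasurable (ft g).
Proof. by move=> /cmeasurable_ftker/cmeasurable_parametric_integral; apply. Qed.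

Lemma cmeasurable_ftker1 g v : cmeasurable g ->
  cmeasurable (fun x => g x * expi (2 * pi * vdot x v)).
Proof.
move=> mg; apply: cmeasurableM => //.
by apply: cmeasurable_expi; apply: measurable_funM => //; exact: measurable_vdot.
Qed.

Lemma normc_expi (t : R) : Normc.normc (expi t) = 1.
Proof. by rewrite normc_sqrt sqc_expi sqrtr1. Qed.

Definition L1 g := lam.-integrable setT (fun x => (Normc.normc (g x))%:E).

Lemma cintegrable_ftker g v : cmeasurable g -> L1 g ->
  cintegrable lam (fun x => g x * expi (2 * pi * vdot x v)).
Proof.
move=> mg ig; apply: (cintegrable_le (h := fun x => Normc.normc (g x))) => //.
  exact: cmeasurable_ftker1.
by move=> x; rewrite Normc.normcM normc_expi mulr1.
Qed.

Lemma ftB f g v : cmeasurable f -> cmeasurable g -> L1 f -> L1 g ->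
  ft (fun x => f x - g x) v = ft f v - ft g v.
Proof.
move=> mf mg lf lg; rewrite /ft -cintegralB; last 2 first.
- exact: cintegrable_ftker.
- exact: cintegrable_ftker.
by congr (cintegral _ _); apply/funext => x; rewrite mulrBl.
Qed.

Section bounded_support.
Variables (g : Rn R n -> R[i]) (F : {fset Zn n}) (M : R).
Hypothesis mg : cmeasurable g.
Hypothesis ig : L1 g.
Hypothesis gM : forall x, sqc (g x) <= M.
Hypothesis gF : forall x, (forall k, k \in F -> ~ cube k x) -> g x = 0.

(* The quasi-periodization of [g]: its Fourier coefficients on the torus are
   the values of [ft g] on the coset [v + Z^n]. *)
Let G (v x : Rn R n) := \sum_(k <- F) g (vadd x (vec_of_Zn k)) *
    expi (2 * pi * vdot (vadd x (vec_of_Zn k)) v).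

Let mgk k : cmeasurable (fun x => g (vadd x (vec_of_Zn k))).
Proof. exact: cmeasurable_comp mg (measurable_shift k). Qed.

Let mG v : cmeasurable (G v).
Proof.
apply: cmeasurable_sum => k; exact: (cmeasurable_comp (cmeasurable_ftker1 v mg) (measurable_shift k)).
Qed.

Let mGterm k : cmeasurable (fun p : Rn R n * Rn R n => g (vadd p.2 (vec_of_Zn k)) *
    expi (2 * pi * vdot (vadd p.2 (vec_of_Zn k)) p.1)).
Proof.
apply: (cmeasurable_comp (f := fun p : Rn R n * Rn R n => g p.2 * expi (2 * pi * vdot p.2 p.1))
  (h := fun p => (p.1, vadd p.2 (vec_of_Zn k)))).
  exact: cmeasurable_ftker.
by apply: measurable_fun_pair => //; exact: measurable_vadd.
Qed.

Let mG2 : cmeasurable (fun p : Rn R n * Rn R n => G p.1 p.2).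
Proof. exact: cmeasurable_sum. Qed.

Let Gy v : (nsq TT (G v) < +oo)%E.
Proof.
apply: nsq_sum_lty => k.
  exact: (cmeasurable_comp (cmeasurable_ftker1 v mg) (measurable_shift k)).
apply: (@cbounded_nsq_torus _ _ _ M).
  exact: (cmeasurable_comp (cmeasurable_ftker1 v mg) (measurable_shift k)).
by move=> x; rewrite sqcM sqc_expi mulr1.
Qed.

Let ft_coset v j : ft g (vadd v (vec_of_Zn j)) = fcoef TT (fun k x => expi (phase1 k x)) (G v) j.
Proof.
rewrite /ft (@cintegral_off_cubes _ _ _ F); last 3 first.
- exact: cmeasurable_ftker1.
- exact: cintegrable_ftker.
- by move=> x /gF ->; rewrite mul0r.
rewrite /fcoef /G; under [X in _ = cintegral _ X]eq_fun do rewrite mulr_suml.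
rewrite cintegral_sum; last first.
  move=> k; apply: (@cbounded_cintegrable_torus _ _ _ M).
    apply: cmeasurableM.
      exact: (cmeasurable_comp (cmeasurable_ftker1 v mg) (measurable_shift k)).
    by apply/cmeasurableJ/cmeasurable_expi; exact: measurable_phase1.
  by move=> x; rewrite !sqcM [X in _ * X](_ : _ = 1) ?sqc_expi ?mulr1// -expiN sqc_expi.
apply: eq_bigr => k _; congr (cintegral _ _); apply/funext => x.
rewrite -[RHS]mulrA -expiN /phase1 opprK -expiD; congr (_ * _).
(* Up to the last summand, a multiple of [2 * pi], the phase splits into that of [G v] and a
   character that depends on [x] alone. *)
rewrite (_ : 2 * pi * _ = 2 * pi * vdot (vadd x (vec_of_Zn k)) v +
    2 * pi * vdot (vec_of_Zn j) x + 2 * pi * vdot (vec_of_Zn k) (vec_of_Zn j)).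
  by rewrite [LHS]expiD (expi_2pi_vdot_int k j) mulr1.
by rewrite !vdotDr !vdotDl (vdotC x (vec_of_Zn j)); ring.
Qed.

Let nsq_ft_coset v :
  (\sum_(i <oo) oapp (fun j : Zn n => (sqc (ft g (vadd v (vec_of_Zn j))))%:E) 0%E (pickle_inv i) =
  nsq TT (G v))%E.
Proof.
rewrite -(@parseval _ _ _ TT (Zn n) (fun k x => expi (phase1 k x)) (G v)); last first.
- exact: Gy.
- exact: mG.
- exact: phase1_dense.
- exact: phase1_orthonormal.
- by move=> j; apply: (@cbounded_nsq_torus _ _ _ 1) => [|x]; [apply: cmeasurable_expi; exact: measurable_phase1|rewrite sqc_expi].
- by move=> j; apply: cmeasurable_expi; exact: measurable_phase1.
by apply: eq_eseriesr => i _; case: pickle_inv => //= j; rewrite ft_coset.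
Qed.

(** As a function of [v], and up to a unimodular factor and a conjugation, [G v x] is a
    trigonometric polynomial whose coefficients are the conjugated values of [g] on the coset of
    [x]. *)
Let nsq_G_swap x : (\int[TT]_v (sqc (G v x))%:E = \sum_(k <- F) (sqc (g (vadd x (vec_of_Zn k))))%:E)%E.
Proof.
pose c k := (g (vadd x (vec_of_Zn k)))^*.
have -> : (\int[TT]_v (sqc (G v x))%:E = nsq TT (lin_comb (fun k v => expi (phase1 k v)) F c))%E.
  apply: eq_integral => v _; congr (_%:E).
  have -> : G v x = expi (2 * pi * vdot x v) * (lin_comb (fun k v => expi (phase1 k v)) F c v)^*.
    rewrite /G /lin_comb -[in RHS]/(Num.conj _) rmorph_sum/= mulr_sumr; apply: eq_bigr => k _.
    rewrite conjM conjK mulrCA; congr (_ * _).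
    by rewrite -expiN /phase1 opprK -expiD -mulrDr vdotDl.
  by rewrite sqcM sqc_expi mul1r sqcJ.
rewrite nsq_lin_comb; last 3 first.
- by move=> j; apply: cmeasurable_expi; exact: measurable_phase1.
- by move=> j; apply: (@cbounded_nsq_torus _ _ _ 1) => [|y]; [apply: cmeasurable_expi; exact: measurable_phase1|rewrite sqc_expi].
- exact: phase1_orthonormal.
by rewrite -sumEFin; apply: eq_bigr => k _; rewrite sqcJ.
Qed.

(** Orthonormality acts in each variable: Parseval in [x] at fixed [v] turns the sum over the coset
    of [v] into the norm of [G v], and after Tonelli the characters in [v] at fixed [x] give back
    the values of [g]. *)
Lemma plancherel_bounded_support : nsq lam (ft g) = nsq lam g.
Proof.
rewrite {1}/nsq unfolding; last 2 first.
- by apply: emeasurable_sqc; exact: cmeasurable_ft.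
- by move=> x; rewrite lee_fin sqc_ge0.
have ms (j : Zn n) : measurable_fun setT (fun v => (sqc (ft g (vadd v (vec_of_Zn j))))%:E).
  by apply: emeasurable_sqc; exact: (cmeasurable_comp (cmeasurable_ft mg) (measurable_shift j)).
transitivity (\int[TT]_v nsq TT (G v))%E.
  under [RHS]eq_integral do rewrite -nsq_ft_coset.
  rewrite integral_nneseries//; last 2 first.
  - by move=> i; case: pickle_inv => //=.
  - by move=> i x _; case: pickle_inv => //= j; rewrite lee_fin sqc_ge0.
  apply: eq_eseriesr => i _; case: pickle_inv => //=.
  by rewrite integral0.
rewrite /nsq (fubini_tonelli (fun p => (sqc (G p.1 p.2))%:E)); last 2 first.
- exact: emeasurable_sqc.
- by move=> p; rewrite lee_fin sqc_ge0.
transitivity (\int[TT]_x (\sum_(k <- F) (sqc (g (vadd x (vec_of_Zn k))))%:E))%E.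
  by apply: eq_integral => x _; exact: nsq_G_swap.
rewrite ge0_integral_sum//; last 2 first.
- by move=> k; exact: emeasurable_sqc.
- by move=> k x _; rewrite lee_fin sqc_ge0.
by rewrite -(ge0_nsq_off_cubes mg gF).
Qed.

End bounded_support.
End plancherel.

Section dominated_truncation.
Context d (X : measurableType d) (R : realType).
Variable mu : {measure set X -> \bar R}.

Lemma nsq_cvg_truncation (f_ : nat -> X -> R[i]) (f : X -> R[i]) :
  (forall N, cmeasurable (f_ N)) -> cmeasurable f -> (nsq mu f < +oo)%E ->
  (forall x, \forall N \near \oo, f_ N x = f x) ->
  (forall N x, sqc (f x - f_ N x) <= sqc (f x)) -> nsq_cvg mu f_ f.
Proof.
move=> mf_ mf fy cf lf e e0.
have [_ _ H] : [/\ mu.-integrable setT (fun x : X => 0%E : \bar R),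
    [sequence \int[mu]_x `|(sqc (f x - f_ N x))%:E - 0|]_N%E @ \oo --> 0%E &
    [sequence \int[mu]_x (sqc (f x - f_ N x))%:E]_N%E @ \oo --> \int[mu]_x 0%E]%E.
  apply: dominated_convergence => //.
  - by move=> N; apply: emeasurable_sqc; exact: cmeasurableB.
  - apply: aeW => x _; apply: cvg_near_cst; apply: filterS (cf x) => N ->.
    by rewrite subrr sqc0.
  - exact: (integrable_sqc mf fy).
  - by apply: aeW => x N _; rewrite abse_EFin lee_fin ger0_norm ?sqc_ge0//.
move: H; rewrite integral0 => H; apply: cvge0_le H _ e0.
by move=> N; exact: nsq_ge0.
Qed.

Lemma cvg_Rintegral_truncation (f_ : nat -> X -> R) (f h : X -> R) :
  (forall N, measurable_fun setT (f_ N)) -> measurable_fun setT f ->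
  mu.-integrable setT (EFin \o h) ->
  (forall x, \forall N \near \oo, f_ N x = f x) ->
  (forall N x, `|f_ N x| <= h x) ->
  (fun N => \int[mu]_x f_ N x) @ \oo --> \int[mu]_x f x.
Proof.
move=> mf_ mf ih cf lf.
have [i1 _ H] : [/\ mu.-integrable setT (EFin \o f),
    [sequence \int[mu]_x `|(f_ N x)%:E - (f x)%:E|]_N%E @ \oo --> 0%E &
    [sequence \int[mu]_x (f_ N x)%:E]_N%E @ \oo --> \int[mu]_x (f x)%:E]%E.
  apply: dominated_convergence => //.
  - by move=> N; exact/measurable_EFinP.
  - exact/measurable_EFinP.
  - by apply: aeW => x _; apply: cvg_near_cst; apply: filterS (cf x) => N /= ->.
  - exact: ih.
  - by apply: aeW => x N _; rewrite abse_EFin lee_fin.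
apply: fine_cvg; rewrite /Rintegral fineK//.
exact: integrable_fin_num.
Qed.

End dominated_truncation.

Section plancherel_theorem.
Context {R : realType} {n : nat}.
Local Notation lam := (lebesgue_tuple R n).
Variable g : Rn R n -> R[i].
Hypothesis mg : cmeasurable g.
Hypothesis ig : L1 g.
Hypothesis gy : (nsq lam g < +oo)%E.

(** Truncation both in size and to the first cubes of the enumeration, so that
    [plancherel_bounded_support] applies to [gN N]. Every point eventually lies in [A N]. *)
Let A N := [set x | sqc (g x) <= N%:R] `&` \big[setU/set0]_(k <- @enumF (Zn n) N) @cube R n k.
Let gN N x := (\1_(A N) x)%:C * g x.

Let mA N : measurable (A N).
Proof.
apply: measurableI.
  rewrite -[X in measurable X]setTI; apply: measurable_fun_ler => //.
  exact: measurable_sqc.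
by apply: bigsetU_measurable => k _; exact: measurable_cube.
Qed.

Let gNE N x : gN N x = if x \in A N then g x else 0.
Proof. by rewrite /gN indicE; case: (x \in A N); rewrite ?mul1r ?mul0r. Qed.

Let mgN N : cmeasurable (gN N).
Proof.
by apply: cmeasurableM => //; apply: cmeasurable_real; exact: measurable_indic.
Qed.

Let A_mono M N : (M <= N)%N -> A M `<=` A N.
Proof.
move=> MN x [/= xM]; rewrite -!bigcup_seq => -[k /= kM kx]; split => /=.
  by rewrite (le_trans xM)// ler_nat.
by rewrite -bigcup_seq; exists k => //=; apply: (fsubsetP (enumF_mono MN)).
Qed.

Let gN_cvg x : \forall N \near \oo, gN N x = g x.
Proof.
pose k : Zn n := [tuple Num.floor (tnth x i : R) | i < n].
exists (maxn (Num.truncn (sqc (g x))).+1 (choice.pickle k).+1) => // N /=.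
rewrite geq_max => /andP[N1 N2]; rewrite gNE mem_set//; split => /=.
  rewrite (le_trans (ltW (truncnS_gt _)))// ler_nat//.
rewrite -bigcup_seq; exists k; last exact: cube_floor.
by rewrite /= mem_enumF.
Qed.

Let sqc_gN N x : sqc (gN N x) <= sqc (g x).
Proof. by rewrite gNE; case: ifP => //; rewrite sqc0 sqc_ge0. Qed.

Let normc_gN N x : Normc.normc (gN N x) <= Normc.normc (g x).
Proof. by rewrite !normc_sqrt ler_wsqrtr. Qed.

Let L1_of_le (f : Rn R n -> R[i]) (C : R) : cmeasurable f ->
  (forall x, Normc.normc (f x) <= C * Normc.normc (g x)) -> L1 f.
Proof.
move=> mf fg; have ic := integrableZl measurableT C ig.
apply: le_integrable ic => //.
  by apply/measurable_EFinP; exact: measurable_normc.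
move=> x _; rewrite -EFinM lee_fin [leLHS]ger0_norm ?normc_ge0// (le_trans (fg x))//.
exact: ler_norm.
Qed.

Let igN N : L1 (gN N).
Proof. by apply: (@L1_of_le _ 1) => // x; rewrite mul1r. Qed.

Let nsq_cvg_gN : nsq_cvg lam gN g.
Proof.
apply: nsq_cvg_truncation => // N x; rewrite gNE; case: ifP => _.
  by rewrite subrr sqc0 sqc_ge0.
by rewrite subr0.
Qed.

Let plancherel_gN M N : nsq lam (fun v => ft (gN M) v - ft (gN N) v) =
  nsq lam (fun x => gN M x - gN N x).
Proof.
have -> : (fun v => ft (gN M) v - ft (gN N) v) = ft (fun x => gN M x - gN N x).
  by apply/funext => v; rewrite ftB.
have gb K x : sqc (gN K x) <= K%:R.
  by rewrite gNE; case: ifP => [|_]; [rewrite inE => -[]|rewrite sqc0].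
have gs K L x : (forall k : Zn n, k \in enumF (maxn K L) -> ~ cube k x) -> gN K x = 0.
  move=> H; rewrite gNE; case: ifPn => //; rewrite inE => -[_].
  rewrite -bigcup_seq => -[k /= kK kx]; case: (H k) => //.
  by apply: (fsubsetP (enumF_mono (leq_maxl K L))).
apply: (@plancherel_bounded_support _ _ _ (enumF (maxn M N)) (2 * (M%:R + N%:R))).
- exact: cmeasurableB.
- apply: (@L1_of_le _ 2); first exact: cmeasurableB.
  move=> x; rewrite (le_trans (le_normcD _ _))// normcN mulr_natl mulr2n lerD//.
- move=> x; rewrite (le_trans (sqcB2 _ _))// ler_pM2l// lerD//.
- by move=> x H; rewrite (gs M N)// (gs N M) ?subrr// maxnC.
Qed.

Let gN_le M N : (N <= M)%N -> (nsq lam (fun x => gN M x - gN N x)%R <= nsq lam (fun x => g x - gN N x)%R)%E.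
Proof.
move=> NM; apply: le_nsq; [exact: cmeasurableB|exact: cmeasurableB|].
move=> x; rewrite !gNE; case: ifPn => xM; case: ifPn => xN //.
  by rewrite sub0r sqcN subrr sqc0; move: xM; rewrite (mem_set (A_mono NM (set_mem xN))).
by rewrite subrr sqc0 sqc_ge0.
Qed.

Let ft_cvg v : (fun N => complex.Re (ft (gN N) v)) @ \oo --> complex.Re (ft g v) /\
  (fun N => complex.Im (ft (gN N) v)) @ \oo --> complex.Im (ft g v).
Proof.
have mk f : cmeasurable f -> cmeasurable (fun x : Rn R n => f x * expi (2 * pi * vdot x v)).
  by move=> mf; exact: cmeasurable_ftker1.
have bk N x : Normc.normc (gN N x * expi (2 * pi * vdot x v)) <= Normc.normc (g x).
  by rewrite Normc.normcM normc_expi mulr1.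
split; apply: (cvg_Rintegral_truncation (h := fun x => Normc.normc (g x))) => //.
- by move=> N; have [] := mk _ (mgN N).
- by have [] := mk _ mg.
- by move=> x; apply: filterS (gN_cvg x) => N ->.
- by move=> N x; apply: le_trans (normc_Re _) (bk N x).
- by move=> N; have [] := mk _ (mgN N).
- by have [] := mk _ mg.
- by move=> x; apply: filterS (gN_cvg x) => N ->.
- by move=> N x; apply: le_trans (normc_Im _) (bk N x).
Qed.

(** Integrability of [g] gives pointwise convergence of the transforms of the truncations. Fatou's
    lemma, applied to the isometry between differences of truncations, turns it into convergence in
    L^2. *)
Lemma plancherel : nsq lam (ft g) = nsq lam g.
Proof.
have mft : cmeasurable (ft g) by exact: cmeasurable_ft.
have mftN N : cmeasurable (ft (gN N)) by exact: cmeasurable_ft.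
have ft_le N : (nsq lam (fun v => ft g v - ft (gN N) v)%R <= nsq lam (fun x => g x - gN N x)%R)%E.
  apply: (@fatou_nsq _ _ _ _ (fun M v => ft (gN M) v - ft (gN N) v) _ _ N).
  - by move=> M; exact: cmeasurableB.
  - exact: cmeasurableB.
  - apply: aeW => v; have [cr ci] := ft_cvg v; split.
      rewrite ReD ReN; under eq_fun do rewrite ReD ReN.
      by apply: cvgB => //; exact: cvg_cst.
    rewrite ImD ImN; under eq_fun do rewrite ImD ImN.
    by apply: cvgB => //; exact: cvg_cst.
  - by move=> M NM; rewrite plancherel_gN gN_le.
have nftN N : nsq lam (ft (gN N)) = nsq lam (gN N).
  have gb x : sqc (gN N x) <= N%:R.
    by rewrite gNE; case: ifP => [|_]; [rewrite inE => -[]|rewrite sqc0].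
  apply: (@plancherel_bounded_support _ _ _ (enumF N) N%:R) => // x H.
  rewrite gNE; case: ifPn => //; rewrite inE => -[_].
  by rewrite -bigcup_seq => -[k /= kK kx]; case: (H k).
apply: nsq_transfer => //.
  have [N /(_ N (leqnn N)) HN] := nsq_cvg_gN ltr01.
  have -> : ft g = (fun v => (ft g v - ft (gN N) v) + ft (gN N) v).
    by apply/funext => v; rewrite subrK.
  apply: nsqD_lty => //; first exact: cmeasurableB.
    by apply: (le_lt_trans (ft_le N)); exact: le_lt_trans HN (ltry _).
  by rewrite nftN; apply: le_lt_trans gy; exact: le_nsq.
move=> e e0; have [N /(_ N (leqnn N)) HN] := nsq_cvg_gN e0.
exists (ft (gN N)), (gN N); split => //.
exact: le_trans (ft_le N) HN.
Qed.

End plancherel_theorem.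

(** * The Weyl kernel *)

Section operator_combinations.
Context d (X : measurableType d) (R : realType).
Variable mu : {measure set X -> \bar R}.
Variables (I : Type) (T : I -> (X -> R[i]) -> X -> R[i]).
Hypothesis T_meas : forall i f, cmeasurable f -> cmeasurable (T i f).
Hypothesis T_nsq : forall i f, cmeasurable f -> nsq mu (T i f) = nsq mu f.

Definition op_comb (s : seq I) (c : I -> R[i]) f x := \sum_(i <- s) c i * T i f x.

Lemma cmeasurable_op_comb s c f : cmeasurable f -> cmeasurable (op_comb s c f).
Proof.
move=> mf; apply: cmeasurable_sum => i.
by apply: cmeasurableM; [exact: cmeasurable_cst|exact: T_meas].
Qed.

(** The constant is crude: continuity for fixed [s] and [c] is the aim, see [op_comb_cvg]. *)
Lemma op_comb_bound s c : exists C : R, 0 < C /\ forall f, cmeasurable f ->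
  (nsq mu (op_comb s c f) <= C%:E * nsq mu f)%E.
Proof.
elim: s => [|i s [C [C0 HC]]].
  exists 1; split => // f mf; rewrite mul1e /op_comb /nsq.
  under eq_integral do rewrite big_nil sqc0.
  by rewrite integral0; exact: nsq_ge0.
exists (2 * (sqc (c i) + C)); split; first by rewrite mulr_gt0// ltr_wpDl// sqc_ge0.
move=> f mf; have -> : op_comb (i :: s) c f = (fun x => c i * T i f x + op_comb s c f x).
  by apply/funext => x; rewrite /op_comb big_cons.
apply: (le_trans (nsqD2 mu _ _)).
- by apply: cmeasurableM; [exact: cmeasurable_cst|exact: T_meas].
- exact: cmeasurable_op_comb.
rewrite EFinM -muleA lee_pmul2l// nsqZ ?T_nsq//; last exact: T_meas.
rewrite (EFinD (sqc (c i)) C) ge0_muleDl; last 2 first.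
- by rewrite lee_fin sqc_ge0.
- by rewrite lee_fin ltW.
by apply: leeD => //; exact: HC.
Qed.

Lemma op_comb_cvg (f_ : nat -> X -> R[i]) f s c :
  (forall i g h x, T i (fun y => g y - h y) x = T i g x - T i h x) ->
  (forall j, cmeasurable (f_ j)) -> cmeasurable f -> nsq_cvg mu f_ f ->
  nsq_cvg mu (fun j => op_comb s c (f_ j)) (op_comb s c f).
Proof.
move=> TB mf_ mf cf e e0; have [C [C0 HC]] := op_comb_bound s c.
have [N HN] := cf _ (divr_gt0 e0 C0); exists N => j /HN Hj.
have -> : (fun x => op_comb s c f x - op_comb s c (f_ j) x) =
    op_comb s c (fun x => f x - f_ j x).
  apply/funext => x; rewrite /op_comb -sumrB; apply: eq_bigr => i _.
  by rewrite TB mulrBr.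
apply: le_trans (HC _ (cmeasurableB mf (mf_ j))) _.
apply: (@le_trans _ _ (C%:E * (e / C)%:E)%E); first by rewrite lee_pmul2l ?lte_fin.
by rewrite -EFinM mulrCA divff ?mulr1// gt_eqF.
Qed.

End operator_combinations.

Section lebesgue2.
Context {R : realType} {n : nat}.
Local Notation lam := (lebesgue_tuple R n).
Local Notation lam2 := (prod_measure lam lam).
Implicit Types f g phi K : Rn R n * Rn R n -> R[i].

Lemma ge0_integral_translate2 (f : Rn R n * Rn R n -> \bar R) (a b : Rn R n) :
  measurable_fun setT f -> (forall x, (0 <= f x)%E) ->
  (\int[lam2]_p f (vadd p.1 a, vadd p.2 b) = \int[lam2]_p f p)%E.
Proof.
move=> mf f0; rewrite ge0_integral_prod//; last first.
  apply: measurableT_comp mf _; apply: measurable_fun_pair; exact: measurable_vadd.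
rewrite [RHS](ge0_integral_prod lam lam mf f0).
transitivity (\int[lam]_x \int[lam]_y f (vadd x a, y))%E.
  apply: eq_integral => x _.
  apply: (@ge0_integral_translate _ _ (fun y => f (vadd x a, y))) => //.
  exact: (measurableT_comp mf (pair1_measurable _)).
apply: (@ge0_integral_translate _ _ (fun x => \int[lam]_y f (x, y))%E).
  exact: (measurable_fun_fubini_tonelli_F (m2 := lam)).
by move=> x; apply: integral_ge0.
Qed.

Lemma nsq_translate2 f a b : cmeasurable f ->
  nsq lam2 (fun p => f (vadd p.1 a, vadd p.2 b))%R = nsq lam2 f.
Proof.
move=> mf; apply: (@ge0_integral_translate2 (fun p => (sqc (f p))%:E)).
  exact: emeasurable_sqc.
by move=> p; rewrite lee_fin sqc_ge0.
Qed.

Lemma cintegral_translate (f : Rn R n -> R[i]) a : cmeasurable f ->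
  cintegral lam (fun x => f (vadd x a)) = cintegral lam f.
Proof.
move=> [f1 f2]; apply: complexP; rewrite /= /Rintegral; congr fine.
  by apply: (@integral_translate _ _ (fun x => (complex.Re (f x))%:E)); exact/measurable_EFinP.
by apply: (@integral_translate _ _ (fun x => (complex.Im (f x))%:E)); exact/measurable_EFinP.
Qed.

(** Slices of a function on R^(2n) are well behaved only for almost every second coordinate, whereas
    the Weyl kernel evaluates them at differences. Each section of the exceptional set of pairs is a
    translate of a null set, so that set is null by Tonelli. *)
Lemma ae_difference (P : set (Rn R n)) (a : Rn R n) : {ae lam, forall u, P u} ->
  {ae lam2, forall p, P (vsub (vsub p.2 p.1) a)}.
Proof.
move=> [N [mN N0 subN]].
have mD : measurable_fun setT (fun p : Rn R n * Rn R n => vsub (vsub p.2 p.1) a).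
  by apply: measurable_vsub => //; exact: measurable_vsub.
exists ((fun p : Rn R n * Rn R n => vsub (vsub p.2 p.1) a) @^-1` N); split.
- by rewrite -[X in measurable X]setTI; exact: mD.
- set S := _ @^-1` N.
  have mS : measurable S by rewrite -[X in measurable X]setTI; exact: mD.
  transitivity (\int[lam2]_p (\1_S p : R)%:E)%E; first by rewrite integral_indic// setIT.
  rewrite ge0_integral_prod; last 2 first.
  - by apply/measurable_EFinP; exact: measurable_indic.
  - by move=> p; rewrite lee_fin indicE.
  rewrite integral0_eq// => x _.
  have -> : (fun y => (\1_S (x, y))%:E) =
      (fun y => (\1_N (vadd y (vopp (vadd x a))) : R)%:E).
    apply/funext => y; rewrite !indicE; congr ((nat_of_bool _)%:R%:E).
    suff E : vsub (vsub y x) a = vadd y (vopp (vadd x a)) by rewrite -E; apply/idP/idP; rewrite !inE.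
    by apply: eq_from_tnth => i; rewrite !vE; ring.
  rewrite (@ge0_integral_translate _ _ (fun y => (\1_N y : R)%:E))//.
    by rewrite integral_indic// setIT.
  by apply/measurable_EFinP; exact: measurable_indic.
- by move=> p /= h; apply: subN.
Qed.

Lemma inLp1P phi : inLp lam2 1%:E phi <->
  cmeasurable phi /\ (\int[lam2]_p (Normc.normc (phi p))%:E < +oo)%E.
Proof.
rewrite /inLp /cLnorm Lnorm1.
by under eq_integral do rewrite abse_EFin ger0_norm ?normc_ge0//.
Qed.

Definition L1_2 phi := cmeasurable phi /\ (\int[lam2]_p (Normc.normc (phi p))%:E < +oo)%E.
Definition L2_2 phi := cmeasurable phi /\ (nsq lam2 phi < +oo)%E.

Lemma L1_2D phi psi : L1_2 phi -> L1_2 psi -> L1_2 (fun p => phi p + psi p).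
Proof.
move=> [m1 i1] [m2 i2]; split; first exact: cmeasurableD.
apply: (@le_lt_trans _ _ (\int[lam2]_p (Normc.normc (phi p))%:E + \int[lam2]_p (Normc.normc (psi p))%:E)%E); last first.
  by rewrite lte_add_pinfty.
have mn f : cmeasurable f -> measurable_fun setT (fun p => (Normc.normc (f p))%:E).
  by move=> mf; apply/measurable_EFinP; exact: measurable_normc.
rewrite -ge0_integralD//; last 4 first.
- by move=> p _; rewrite lee_fin normc_ge0.
- exact: mn.
- by move=> p _; rewrite lee_fin normc_ge0.
- exact: mn.
apply: ge0_le_integral => //.
- by move=> p _; rewrite lee_fin normc_ge0.
- by apply: mn; exact: cmeasurableD.
- by apply: emeasurable_funD; exact: mn.
- by move=> p _; rewrite -EFinD lee_fin le_normcD.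
Qed.

Lemma L1_2Z (c : R[i]) phi : L1_2 phi -> L1_2 (fun p => c * phi p).
Proof.
move=> [m1 i1]; split; first by apply: cmeasurableM => //; exact: cmeasurable_cst.
under eq_integral do rewrite Normc.normcM EFinM.
rewrite ge0_integralZl//; last 3 first.
- by apply/measurable_EFinP; exact: measurable_normc.
- by move=> p _; rewrite lee_fin normc_ge0.
- by rewrite lee_fin normc_ge0.
by rewrite lte_mul_pinfty// lee_fin normc_ge0.
Qed.

Lemma L1_2_sum (I : Type) (s : seq I) (F : I -> Rn R n * Rn R n -> R[i]) :
  (forall i, L1_2 (F i)) -> L1_2 (fun p => \sum_(i <- s) F i p).
Proof.
move=> LF; elim: s => [|i s IH].
  under eq_fun do rewrite big_nil; split; first exact: cmeasurable_cst.
  under eq_integral do rewrite Normc.normc0.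
  by rewrite integral0 ltry.
by under eq_fun do rewrite big_cons; exact: L1_2D.
Qed.

Lemma L1_2_slice phi : L1_2 phi -> {ae lam, forall u, L1 (fun x => phi (x, u))}.
Proof.
move=> [mphi iy].
have mn : measurable_fun setT (fun p => (Normc.normc (phi p))%:E).
  by apply/measurable_EFinP; exact: measurable_normc.
have n0 p : (0 <= (Normc.normc (phi p))%:E)%E by rewrite lee_fin normc_ge0.
move: iy; rewrite ge0_integral_prod2// => iy.
have := ae_lty_integral (mu := lam) (measurable_fun_fubini_tonelli_G (m1 := lam) _ mn n0).
move=> /(_ (fun u => @integral_ge0 _ _ _ lam setT _ (fun x _ => n0 _)) iy).
apply: filterS => u uy; apply/integrableP; split.
  exact: (measurableT_comp mn (pair2_measurable _)).
under eq_integral do rewrite abse_EFin ger0_norm ?normc_ge0//.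
exact: uy.
Qed.

Lemma L2_2_slice phi : L2_2 phi -> {ae lam, forall u, (nsq lam (fun x => phi (x, u)) < +oo)%E}.
Proof.
move=> [mphi iy].
have mn : measurable_fun setT (fun p => (sqc (phi p))%:E) by exact: emeasurable_sqc.
have n0 p : (0 <= (sqc (phi p))%:E)%E by rewrite lee_fin sqc_ge0.
move: iy; rewrite /nsq ge0_integral_prod2// => iy.
have := ae_lty_integral (mu := lam) (measurable_fun_fubini_tonelli_G (m1 := lam) _ mn n0).
by move=> /(_ (fun u => @integral_ge0 _ _ _ lam setT _ (fun x _ => n0 _)) iy).
Qed.

End lebesgue2.

Section weyl_kernel_theory.
Context {R : realType} {n : nat}.
Local Notation lam := (lebesgue_tuple R n).
Local Notation lam2 := (prod_measure lam lam).
Implicit Types phi psi K : Rn R n * Rn R n -> R[i].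

Definition wker phi (p : Rn R n * Rn R n) (x : Rn R n) : R[i] :=
  phi (x, vsub p.2 p.1) * expi (pi * vdot x (vadd p.1 p.2)).

Lemma cmeasurable_wker2 phi : cmeasurable phi -> cmeasurable (fun q : (Rn R n * Rn R n) * Rn R n => wker phi q.1 q.2).
Proof.
move=> mphi.
have m11 : measurable_fun setT (fun q : (Rn R n * Rn R n) * Rn R n => q.1.1).
  exact: (measurableT_comp measurable_fst measurable_fst).
have m12 : measurable_fun setT (fun q : (Rn R n * Rn R n) * Rn R n => q.1.2).
  exact: (measurableT_comp measurable_snd measurable_fst).
apply: cmeasurableM.
  apply: (cmeasurable_comp (h := fun q : (Rn R n * Rn R n) * Rn R n => (q.2, vsub q.1.2 q.1.1))) mphi _.
  by apply: measurable_fun_pair => //; exact: measurable_vsub.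
apply: cmeasurable_expi; apply: measurable_funM => //.
by apply: measurable_vdot => //; exact: measurable_vadd.
Qed.

Lemma cmeasurable_wker phi p : cmeasurable phi -> cmeasurable (wker phi p).
Proof. by move=> /cmeasurable_wker2 m; exact: (cmeasurable_comp m (pair1_measurable p)). Qed.

Lemma cmeasurable_weyl phi : cmeasurable phi -> cmeasurable (weyl_integral phi).
Proof.
move=> /cmeasurable_wker2 m.
exact: (@cmeasurable_parametric_integral _ _ _ _ _ lam (fun q => wker phi q.1 q.2)).
Qed.

Lemma cintegrable_wker phi p : cmeasurable phi -> L1 (fun x => phi (x, vsub p.2 p.1)) ->
  cintegrable lam (wker phi p).
Proof.
move=> mphi L; apply: (cintegrable_le (h := fun x => Normc.normc (phi (x, vsub p.2 p.1)))) => //.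
  exact: cmeasurable_wker.
by move=> x; rewrite Normc.normcM normc_expi mulr1.
Qed.

Lemma ae_cintegrable_wker phi : L1_2 phi ->
  {ae lam2, forall p, cintegrable lam (wker phi p)}.
Proof.
move=> Lphi; have [mphi _] := Lphi.
have := ae_difference (vec_of_Zn (zzero n)) (L1_2_slice Lphi).
apply: filterS => p; have -> : vsub (vsub p.2 p.1) (vec_of_Zn (zzero n)) = vsub p.2 p.1.
  by apply: eq_from_tnth => i; rewrite !vE tnth_mktuple subr0.
exact: cintegrable_wker.
Qed.

(** Additivity of the integral requires integrable slices, hence the restriction to almost every
    point. *)
Lemma weyl_integral_lin (I : Type) (s : seq I) (c : I -> R[i]) (F : I -> Rn R n * Rn R n -> R[i]) :
  (forall i, L1_2 (F i)) ->
  {ae lam2, forall p, weyl_integral (fun q => \sum_(i <- s) c i * F i q) p =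
     \sum_(i <- s) c i * weyl_integral (F i) p}.
Proof.
move=> LF; elim: s => [|i s IH].
  apply: aeW => p; rewrite big_nil /weyl_integral.
  under [X in cintegral _ X]eq_fun do rewrite big_nil mul0r.
  exact: cintegral0.
have Ls : L1_2 (fun q => \sum_(i <- s) c i * F i q).
  by apply: L1_2_sum => j; exact: L1_2Z.
have := ae_cintegrable_wker Ls; have := ae_cintegrable_wker (LF i).
apply: filterS3 IH => p IH h1 h2; rewrite big_cons -IH.
have -> : weyl_integral (fun q => \sum_(i0 <- i :: s) c i0 * F i0 q) p =
    cintegral lam (fun x => c i * wker (F i) p x + wker (fun q => \sum_(i <- s) c i * F i q) p x).
  congr (cintegral _ _); apply/funext => x; rewrite /wker big_cons.
  by rewrite mulrDl mulrA.
by rewrite cintegralD// ?cintegralZ//; exact: cintegrableZ.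
Qed.

Lemma weyl_integralB phi psi : L1_2 phi -> L1_2 psi ->
  {ae lam2, forall p, weyl_integral (fun q => phi q - psi q) p =
     weyl_integral phi p - weyl_integral psi p}.
Proof.
move=> L1' L2; have := ae_cintegrable_wker L1'; have := ae_cintegrable_wker L2.
apply: filterS2 => p h2 h1; rewrite /weyl_integral -cintegralB//.
by congr (cintegral _ _); apply/funext => x; rewrite mulrBl.
Qed.

(** For [eta = u + xi] the phase [pi x.(xi + eta)] is [2 pi x.xi + pi x.u], and the second part is a
    unimodular factor of the slice. *)
Lemma weyl_integral_ft phi xi u :
  weyl_integral phi (xi, vadd u xi) = ft (fun x => phi (x, u) * expi (pi * vdot x u)) xi.
Proof.
congr (cintegral _ _); apply/funext => x /=; rewrite vaddK -mulrA -expiD.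
congr (_ * expi _); rewrite !vdotDr; ring.
Qed.

Lemma weyl_isometry phi : L1_2 phi -> L2_2 phi ->
  nsq lam2 (weyl_integral phi) = nsq lam2 phi.
Proof.
move=> Lphi Kphi; have [mphi _] := Lphi.
have mW := cmeasurable_weyl mphi.
have mWs : cmeasurable (fun p => weyl_integral phi (p.1, vadd p.2 p.1)).
  apply: cmeasurable_comp mW _.
  by apply: measurable_fun_pair => //; exact: measurable_vadd.
have mphiu u : cmeasurable (fun x => phi (x, u)) by exact: cmeasurable_comp mphi (pair2_measurable u).
(* Translating the inner variable by [xi] passes to the coordinates [(xi, u)]; Tonelli then
   isolates, at fixed [u], a Fourier transform in [xi]. *)
transitivity (\int[lam]_xi \int[lam]_u (sqc (weyl_integral phi (xi, vadd u xi)))%:E)%E.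
  rewrite /nsq ge0_integral_prod; last 2 first.
  - exact: emeasurable_sqc.
  - by move=> p; rewrite lee_fin sqc_ge0.
  apply: eq_integral => xi _; apply/esym.
  apply: (@ge0_integral_translate _ _ (fun y => (sqc (weyl_integral phi (xi, y)))%:E)).
    by apply: emeasurable_sqc; exact: cmeasurable_comp mW (pair1_measurable xi).
  by move=> y; rewrite lee_fin sqc_ge0.
rewrite (fubini_tonelli (fun p => (sqc (weyl_integral phi (p.1, vadd p.2 p.1)))%:E)); last 2 first.
- exact: emeasurable_sqc.
- by move=> p; rewrite lee_fin sqc_ge0.
rewrite [RHS]/nsq ge0_integral_prod2; last 2 first.
- exact: emeasurable_sqc.
- by move=> p; rewrite lee_fin sqc_ge0.
apply: ge0_ae_eq_integral => //.
- exact: (measurable_fun_fubini_tonelli_G (m1 := lam) _ (emeasurable_sqc mWs) (fun p => sqc_ge0 _)).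
- exact: (measurable_fun_fubini_tonelli_G (m1 := lam) _ (emeasurable_sqc mphi) (fun p => sqc_ge0 _)).
- by move=> u _; apply: integral_ge0 => x _; rewrite lee_fin sqc_ge0.
- by move=> u _; apply: integral_ge0 => x _; rewrite lee_fin sqc_ge0.
have := L1_2_slice Lphi; have := L2_2_slice Kphi; apply: filterS2 => u u2 u1 _ /=.
under eq_integral do rewrite weyl_integral_ft.
have mg : cmeasurable (fun x => phi (x, u) * expi (pi * vdot x u)).
  apply: cmeasurableM => //; apply: cmeasurable_expi; apply: measurable_funM => //.
  exact: measurable_vdot.
have sg x : sqc (phi (x, u) * expi (pi * vdot x u)) = sqc (phi (x, u)).
  by rewrite sqcM sqc_expi mulr1.
rewrite -[LHS]/(nsq lam (ft _)) plancherel//.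
- by apply: eq_integral => x _; rewrite sg.
- rewrite /L1; under eq_fun do rewrite Normc.normcM normc_expi mulr1.
  exact: u1.
- by rewrite (eq_nsq _ sg).
Qed.

(** The operator on kernels that corresponds to the twisted translation by [kl], see
    [weyl_integral_twisted]. *)
Definition kernel_shift (kl : Zn n * Zn n) K : Rn R n * Rn R n -> R[i] :=
  fun p => expi (pi * vdot (vec_of_Zn kl.1) (vec_of_Zn kl.2)
                 + 2 * pi * vdot (vec_of_Zn kl.1) p.1)
           * K (vadd p.1 (vec_of_Zn kl.2), p.2).

Lemma cmeasurable_twisted kl phi : cmeasurable phi -> cmeasurable (twisted_translation kl phi).
Proof.
move=> mphi; apply: cmeasurableM.
  apply: cmeasurable_expi; apply: measurable_funM => //.
  by apply: measurable_funB; exact: measurable_vdot.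
apply: (cmeasurable_comp (h := fun p : Rn R n * Rn R n => (vsub p.1 (vec_of_Zn kl.1), vsub p.2 (vec_of_Zn kl.2)))) mphi _.
by apply: measurable_fun_pair; exact: measurable_vsub.
Qed.

Lemma weyl_integral_twisted kl phi : L1_2 phi ->
  {ae lam2, forall p, weyl_integral (twisted_translation kl phi) p =
     kernel_shift kl (weyl_integral phi) p}.
Proof.
move=> Lphi; have [mphi _] := Lphi.
have := ae_difference (vec_of_Zn kl.2) (L1_2_slice Lphi).
apply: filterS => -[xi eta] /= Lp.
pose k : Rn R n := vec_of_Zn kl.1; pose l : Rn R n := vec_of_Zn kl.2; rewrite -/l in Lp.
have El : vsub (vsub eta xi) l = vsub eta (vadd xi l).
  by apply: eq_from_tnth => i; rewrite !vE; ring.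
rewrite El in Lp.
have mT : cmeasurable (fun x => twisted_translation kl phi (x, vsub eta xi) * expi (pi * vdot x (vadd xi eta))).
  apply: cmeasurableM; last first.
    by apply: cmeasurable_expi; apply: measurable_funM => //; exact: measurable_vdot.
  exact: cmeasurable_comp (cmeasurable_twisted kl mphi) (pair2_measurable _).
(* After the substitution of [x + k] for [x], the slice at [eta - xi - l] is the one that the kernel
   uses at [(xi + l, eta)]; only phases remain to be compared. *)
rewrite /weyl_integral /= -(cintegral_translate k mT).
rewrite /kernel_shift /= -cintegralZ; last first.
  exact: (cintegrable_wker (p := (vadd xi l, eta))).
congr (cintegral _ _); apply/funext => x.
rewrite /twisted_translation /= -/k -/l vaddK El.
rewrite mulrAC -expiD [RHS]mulrCA [RHS]mulrC -[in RHS]expiD.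
congr (expi _ * _).
rewrite !vdotDl !vdotDr !vdotBl (vdotC xi k) (vdotC eta k); ring.
Qed.

Lemma nsq_twisted kl phi : cmeasurable phi ->
  nsq lam2 (twisted_translation kl phi) = nsq lam2 phi.
Proof.
move=> mphi; rewrite -(nsq_translate2 (vopp (vec_of_Zn kl.1)) (vopp (vec_of_Zn kl.2)) mphi).
by apply: eq_nsq => p; rewrite sqcM sqc_expi mul1r -!vsubE.
Qed.

Lemma L1_2_twisted kl phi : L1_2 phi -> L1_2 (twisted_translation kl phi).
Proof.
move=> [mphi iy]; split; first exact: cmeasurable_twisted.
under eq_integral do rewrite Normc.normcM normc_expi mul1r !vsubE.
rewrite (@ge0_integral_translate2 _ _ (fun p => (Normc.normc (phi p))%:E))//.
  by apply/measurable_EFinP; exact: measurable_normc.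
by move=> p; rewrite lee_fin normc_ge0.
Qed.

Lemma cmeasurable_kernel_shift kl K : cmeasurable K -> cmeasurable (kernel_shift kl K).
Proof.
move=> mK; apply: cmeasurableM.
  apply: cmeasurable_expi; apply: measurable_funD => //; apply: measurable_funM => //.
  exact: measurable_vdot.
apply: (cmeasurable_comp (h := fun p : Rn R n * Rn R n => (vadd p.1 (vec_of_Zn kl.2), p.2))) mK _.
by apply: measurable_fun_pair => //; exact: measurable_vadd.
Qed.

Lemma nsq_kernel_shift kl K : cmeasurable K -> nsq lam2 (kernel_shift kl K) = nsq lam2 K.
Proof.
move=> mK; rewrite -(nsq_translate2 (vec_of_Zn kl.2) (vec_of_Zn (zzero n)) mK).
apply: eq_nsq => p; rewrite sqcM sqc_expi mul1r; congr (sqc (K (_, _))).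
by apply: eq_from_tnth => i; rewrite !vE tnth_mktuple addr0.
Qed.

Lemma nsq_weyl_comb (s : seq (Zn n * Zn n)) c phi : L1_2 phi -> L2_2 phi ->
  nsq lam2 (op_comb kernel_shift s c (weyl_integral phi)) =
  nsq lam2 (op_comb twisted_translation s c phi).
Proof.
move=> L Kp; have [mphi phiy] := Kp.
have LT kl : L1_2 (twisted_translation kl phi) by exact: L1_2_twisted.
have Lc : L1_2 (op_comb twisted_translation s c phi).
  by apply: L1_2_sum => kl; exact: L1_2Z.
have mop : cmeasurable (op_comb twisted_translation s c phi) by have [] := Lc.
rewrite -[RHS]weyl_isometry//; last first.
  split => //; apply: nsq_sum_lty => kl.
    by apply: cmeasurableM; [exact: cmeasurable_cst|exact: cmeasurable_twisted].
  apply: nsqZ_lty; first exact: cmeasurable_twisted.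
  by rewrite nsq_twisted.
apply: ae_eq_nsq.
- apply: cmeasurable_op_comb; first exact: cmeasurable_kernel_shift.
  exact: cmeasurable_weyl.
- exact: cmeasurable_weyl.
have H : {ae lam2, forall p, \sum_(kl <- s) c kl * weyl_integral (twisted_translation kl phi) p =
    op_comb kernel_shift s c (weyl_integral phi) p}.
  rewrite /op_comb; elim: s {Lc mop} => [|kl s IH].
    by apply: aeW => p; rewrite !big_nil.
  apply: filterS2 (weyl_integral_twisted kl L) IH => p h1 h2.
  by rewrite !big_cons h1 h2.
apply: filterS2 H (weyl_integral_lin s c LT) => p h1 h2.
by rewrite -h1 -h2.
Qed.

Lemma L1_approx phi : L2_2 phi -> exists phi_ : nat -> Rn R n * Rn R n -> R[i],
  [/\ forall j, L1_2 (phi_ j), forall j, L2_2 (phi_ j) & nsq_cvg lam2 phi_ phi].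
Proof.
move=> [mphi phiy].
(* On [A j] one has |phi| <= (j + 1) |phi|^2, so the truncation is integrable; a point outside every
   [A j] is a zero of [phi]. *)
pose A (j : nat) := [set p | (j.+1%:R)^-1 <= sqc (phi p)].
have mA j : measurable (A j).
  rewrite -[X in measurable X]setTI; apply: measurable_fun_ler => //.
  exact: measurable_sqc.
pose f (j : nat) p := (\1_(A j) p)%:C * phi p.
have fE j p : f j p = if p \in A j then phi p else 0.
  by rewrite /f indicE; case: (p \in A j); rewrite ?mul1r ?mul0r.
have mf j : cmeasurable (f j).
  by apply: cmeasurableM => //; apply: cmeasurable_real; exact: measurable_indic.
exists f; split.
- move=> j; split => //.
  apply: (@le_lt_trans _ _ (j.+1%:R%:E * nsq lam2 phi)%E); last first.
    by rewrite lte_mul_pinfty.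
  rewrite /nsq -ge0_integralZl//; last 2 first.
  + exact: emeasurable_sqc.
  + by move=> p _; rewrite lee_fin sqc_ge0.
  apply: ge0_le_integral => //.
  + by move=> p _; rewrite lee_fin normc_ge0.
  + by apply/measurable_EFinP; exact: measurable_normc.
  + by apply: measurable_funeM; exact: emeasurable_sqc.
  move=> p _; rewrite -EFinM lee_fin fE; case: ifPn => [|_]; last first.
    by rewrite Normc.normc0 mulr_ge0// sqc_ge0.
  rewrite inE /A/= => h.
  have : 1 <= j.+1%:R * sqc (phi p).
    by rewrite -(@ler_pM2l _ (j.+1%:R)^-1) ?invr_gt0 ?ltr0n// mulrA mulVf ?mul1r ?mulr1 ?pnatr_eq0.
  have j1 : 1 <= j.+1%:R :> R by rewrite ler1n.
  rewrite -normc_sqr; have := normc_ge0 (phi p); move: (Normc.normc _) => t t0 h'.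
  by have [t1|t1] := leP t 1; nra.
- move=> j; split => //; apply: le_lt_trans phiy; apply: le_nsq => // p.
  by rewrite fE; case: ifP => //; rewrite sqc0 sqc_ge0.
- apply: nsq_cvg_truncation => //.
    move=> p; have [/sqc_eq0 p0|p0] := eqVneq (sqc (phi p)) 0.
      by apply: nearW => j; rewrite fE p0; case: ifP.
    have pp : 0 < sqc (phi p) by rewrite lt_neqAle eq_sym p0 sqc_ge0.
    exists (Num.truncn (sqc (phi p))^-1).+1 => // j /= jN; rewrite fE mem_set//=.
    rewrite /A/= invf_ple ?posrE ?ltr0n//; apply: (le_trans (ltW (truncnS_gt _))).
    by rewrite ler_nat (leq_trans jN).
  move=> j p; rewrite fE; case: ifP => _; first by rewrite subrr sqc0 sqc_ge0.
  by rewrite subr0.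
Qed.

Lemma cLnorm2_cvg0 d (X : measurableType d) (mu : {measure set X -> \bar R})
    (f_ : nat -> X -> R[i]) :
  (fun j => cLnorm mu 2%:E (f_ j)) @ \oo --> 0%E <->
  (forall e : R, 0 < e -> exists N, forall j, (N <= j)%N -> (nsq mu (f_ j) <= e%:E)%E).
Proof.
have c0 j : (0 <= cLnorm mu 2%:E (f_ j))%E by exact: Lnorm_ge0.
split => [/(cvge0_le c0) H e e0|H].
  have se : 0 < Num.sqrt e by rewrite sqrtr_gt0.
  have [N HN] := H _ (divr_gt0 se (@ltr0Sn R 1)); exists N => j /HN Hj.
  have : (cLnorm mu 2%:E (f_ j) < (Num.sqrt e)%:E)%E.
    by apply: le_lt_trans Hj _; rewrite lte_fin ltr_pdivrMr// ltr_pMr// ltr1n.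
  by rewrite cLnorm2_lt// (sqr_sqrtr (ltW e0)) => /ltW.
apply: le_cvge0 => // e e0; have e2 : 0 < e ^+ 2 / 2 by rewrite divr_gt0// exprn_gt0.
have [N HN] := H _ e2; exists N => j /HN Hj; apply/ltW.
rewrite cLnorm2_lt//; apply: le_lt_trans Hj _.
by rewrite lte_fin ltr_pdivrMr// ltr_pMr ?ltr1n// exprn_gt0.
Qed.

(** Needed to get past the default value of [weyl_kernel]. By the isometry, the Weyl integrals of
    approximants in L^1 and L^2 form a Cauchy sequence. *)
Lemma weyl_kernel_exists phi : L2_2 phi -> exists K, is_weyl_kernel phi K.
Proof.
move=> Kphi; have [mphi phiy] := Kphi.
have [phi_ [L1j L2j cphi]] := L1_approx Kphi.
have mj j : cmeasurable (phi_ j) by have [] := L1j j.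
have mWj j : cmeasurable (weyl_integral (phi_ j)) by exact: cmeasurable_weyl.
have cau : nsq_cauchy lam2 (fun j => weyl_integral (phi_ j)).
  move=> e e0; have e4 : 0 < e / 4 by rewrite divr_gt0.
  have [N HN] := cphi _ e4; exists N => j k /HN Hj /HN Hk.
  rewrite -(@ae_eq_nsq _ _ _ lam2 (weyl_integral (fun q => phi_ j q - phi_ k q))); last 3 first.
  - by apply: cmeasurable_weyl; exact: cmeasurableB.
  - exact: cmeasurableB.
  - exact: weyl_integralB.
  rewrite weyl_isometry; last 2 first.
  - have := L1_2D (L1j j) (L1_2Z (-1) (L1j k)).
    by congr L1_2; apply/funext => q; rewrite mulN1r.
  - split; first exact: cmeasurableB.
    by have [_ jy] := L2j j; have [_ ky] := L2j k; exact: nsqB_lty.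
  apply: (le_trans (nsq_triangle lam2 (mj j) mphi (mj k))).
  have -> : e%:E = (2%:E * ((e / 4)%:E + (e / 4)%:E))%E.
    by rewrite -EFinD -EFinM; congr EFin; field.
  by rewrite lee_pmul2l//; apply: leeD => //; rewrite nsqC.
have [K [mK cK _]] := nsq_complete mWj cau.
exists K; split.
  apply/inLp2P; split => //.
  have [N /(_ N (leqnn N)) HN] := cK _ ltr01.
  have -> : K = (fun p => (K p - weyl_integral (phi_ N) p) + weyl_integral (phi_ N) p).
    by apply/funext => p; rewrite subrK.
  apply: nsqD_lty => //; first exact: cmeasurableB.
    exact: le_lt_trans HN (ltry _).
  by rewrite weyl_isometry//; have [] := L2j N.
exists phi_; split.
- by move=> j; split; [apply/inLp1P; exact: L1j|apply/inLp2P; exact: L2j].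
- apply/cLnorm2_cvg0 => e e0; have [N HN] := cphi _ e0.
  by exists N => j /HN; rewrite nsqC.
- apply/cLnorm2_cvg0 => e e0; have [N HN] := cK _ e0.
  by exists N => j /HN; rewrite nsqC.
Qed.

Lemma weyl_kernelP phi : L2_2 phi ->
  L2_2 (weyl_kernel phi) /\
  exists phi_ : nat -> Rn R n * Rn R n -> R[i],
  [/\ forall j, L1_2 (phi_ j), forall j, L2_2 (phi_ j), nsq_cvg lam2 phi_ phi &
      nsq_cvg lam2 (fun j => weyl_integral (phi_ j)) (weyl_kernel phi)].
Proof.
move=> /weyl_kernel_exists[K0 K0P].
have [] : is_weyl_kernel phi (weyl_kernel phi) by exact: (xgetPex _ (ex_intro _ K0 K0P)).
move=> /inLp2P LK [phi_ [Lj c1 c2]]; split => //; exists phi_; split.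
- by move=> j; have [/inLp1P] := Lj j.
- by move=> j; have [_ /inLp2P] := Lj j.
- by move=> e e0; have [N HN] := (cLnorm2_cvg0 _ _).1 c1 _ e0; exists N => j /HN; rewrite nsqC.
- by move=> e e0; have [N HN] := (cLnorm2_cvg0 _ _).1 c2 _ e0; exists N => j /HN; rewrite nsqC.
Qed.

Lemma nsq_twisted_comb phi (s : seq (Zn n * Zn n)) c : L2_2 phi ->
  nsq lam2 (op_comb twisted_translation s c phi) =
  nsq lam2 (op_comb kernel_shift s c (weyl_kernel phi)).
Proof.
move=> Kphi; have [mphi phiy] := Kphi.
have [[mK Ky] [phi_ [L1j L2j c1 c2]]] := weyl_kernelP Kphi.
have mj j : cmeasurable (phi_ j) by have [] := L1j j.
have mWj j : cmeasurable (weyl_integral (phi_ j)) by exact: cmeasurable_weyl.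
have d1 : nsq_cvg lam2 (fun j => op_comb twisted_translation s c (phi_ j))
    (op_comb twisted_translation s c phi).
  apply: op_comb_cvg => //; [exact: cmeasurable_twisted|exact: nsq_twisted|].
  by move=> kl g h p; rewrite /twisted_translation mulrBr.
have d2 : nsq_cvg lam2 (fun j => op_comb kernel_shift s c (weyl_integral (phi_ j)))
    (op_comb kernel_shift s c (weyl_kernel phi)).
  apply: op_comb_cvg => //; [exact: cmeasurable_kernel_shift|exact: nsq_kernel_shift|].
  by move=> kl g h p; rewrite /kernel_shift mulrBr.
have mT f : cmeasurable f -> cmeasurable (op_comb twisted_translation s c f).
  by apply: cmeasurable_op_comb; exact: cmeasurable_twisted.
have mS f : cmeasurable f -> cmeasurable (op_comb kernel_shift s c f).
  by apply: cmeasurable_op_comb; exact: cmeasurable_kernel_shift.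
apply: nsq_transfer; [exact: mT|exact: mS| | |].
- have [C [C0 HC]] := op_comb_bound (mu := lam2) cmeasurable_twisted nsq_twisted s c.
  by apply: (le_lt_trans (HC _ mphi)); rewrite lte_mul_pinfty// lee_fin ltW.
- have [C [C0 HC]] := op_comb_bound (mu := lam2) cmeasurable_kernel_shift nsq_kernel_shift s c.
  by apply: (le_lt_trans (HC _ mK)); rewrite lte_mul_pinfty// lee_fin ltW.
move=> e e0; have [N1 H1] := d1 _ e0; have [N2 H2] := d2 _ e0.
exists (op_comb twisted_translation s c (phi_ (maxn N1 N2))),
  (op_comb kernel_shift s c (weyl_integral (phi_ (maxn N1 N2)))); split.
- exact: mT.
- exact: mS.
- by apply: H1; exact: leq_maxl.
- by apply: H2; exact: leq_maxr.
- by rewrite nsq_weyl_comb.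
Qed.

End weyl_kernel_theory.

(** * The Weyl-Zak transform *)

(** Differs from [nsq_transfer] in that the norms of the approximants merely approach the target
    value from below, as those of partial Zak sums do. *)
Lemma nsq_eq_of_approx d (X : measurableType d) (R : realType)
    (mu : {measure set X -> \bar R}) (f : X -> R[i]) (kap : R) :
  cmeasurable f -> 0 <= kap ->
  (forall e : R, 0 < e -> exists g, [/\ cmeasurable g,
     (nsq mu (fun x => f x - g x)%R <= e%:E)%E, (nsq mu g <= kap%:E)%E &
     (kap%:E <= nsq mu g + e%:E)%E]) -> nsq mu f = kap%:E.
Proof.
move=> mf kap0 H.
have fin_g g : (nsq mu g <= kap%:E)%E -> nsq mu g = (fine (nsq mu g))%:E.
  by move=> gk; rewrite fineK// ge0_fin_numE ?nsq_ge0// (le_lt_trans gk)// ltry.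
have one_le (e : R) : 0 < e < 1 -> 1 <= 1 + e /\ 1 <= 1 + e^-1.
  by move=> /andP[e0 e1]; split; rewrite lerDl ?invr_ge0 ltW.
have up (e k : R) : 0 < e < 1 -> 0 < k ->
    (nsq mu f <= ((1 + e) * kap + (1 + e^-1) * k)%:E)%E.
  move=> e01 k0; have /andP[e0 _] := e01.
  have [g [mg fg gk kg]] := H _ k0.
  have -> : f = (fun x => g x + (f x - g x)) by apply/funext => x; rewrite addrC subrK.
  apply: le_trans (nsqD_eps mu mg (cmeasurableB mf mg) e0) _.
  have [e1 e2] := one_le _ e01.
  rewrite [leRHS]EFinD (EFinM (1 + e) kap) (EFinM (1 + e^-1) k).
  by apply: leeD; rewrite lee_pmul2l// lte_fin; lra.
have fy : nsq mu f = (fine (nsq mu f))%:E.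
  rewrite fineK// ge0_fin_numE ?nsq_ge0//.
  by apply: le_lt_trans (@up 2^-1 1 _ ltr01) (ltry _); lra.
(* Brings the bounds at hand, with their extra summand [k], into the shape required by
   [ler_addeps2]. *)
have kp x : 0 <= x -> forall e k : R, 0 < e < 1 -> 0 < k ->
    (1 + e) * x + (1 + e^-1) * k + k <= (1 + e) * ((1 + e) * x + (1 + e^-1) * k) + (1 + e^-1) * k.
  move=> x0 e k e01 k0; have [e1 e2] := one_le _ e01; rewrite mulrDr.
  apply: lerD; last by rewrite ler_peMl// ltW.
  apply: lerD; rewrite ler_peMl//; last by rewrite mulr_ge0//; lra.
  by rewrite mulr_ge0//; lra.
rewrite fy; congr EFin; apply/eqP; rewrite eq_le; apply/andP; split.
  apply: ler_addeps2 => // e k e01 k0; apply: le_trans (kp _ kap0 _ _ e01 k0).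
  by rewrite -lee_fin -fy (le_trans (up _ _ e01 k0))// lee_fin lerDl ltW.
apply: ler_addeps2 => [|e k e01 k0]; first by rewrite fine_ge0// nsq_ge0.
apply: le_trans (kp _ (fine_ge0 (nsq_ge0 mu f)) _ _ e01 k0).
have /andP[e0 _] := e01; have [g [mg fg gk kg]] := H _ k0.
rewrite -lee_fin (le_trans kg)// [leRHS]EFinD leeD2r//.
have -> : g = (fun x => f x + (g x - f x)) by apply/funext => x; rewrite addrC subrK.
apply: le_trans (nsqD_eps mu mf (cmeasurableB mg mf) e0) _.
have [e1 e2] := one_le _ e01.
rewrite [leRHS]EFinD (EFinM (1 + e)) (EFinM (1 + e^-1) k) -fy leeD2l// lee_pmul2l//; last by rewrite lte_fin; lra.
by rewrite nsqC.
Qed.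

(** * Partial Zak sums, their limit, and the effect of kernel shifts *)

Section zak_transform.
Context {R : realType} {n : nat}.
Local Notation lam := (lebesgue_tuple R n).
Local Notation lam2 := (prod_measure lam lam).
Local Notation TT := (torus_measure R n).
Local Notation TT2 := (prod_measure TT TT).
Local Notation mu3 := (prod_measure TT2 lam).
Implicit Types (K : Rn R n * Rn R n -> R[i]) (F G : {fset Zn n}).

Definition zak_sum K F (p : Rn R n * Rn R n * Rn R n) := \sum_(m <- F) zak_term K m p.

Lemma zak_termE K m p : zak_term K m p =
  K (vadd (vec_of_Zn m) p.1.1, p.2) * expi (phase1 m p.1.2).
Proof. by case: p => [[xi xi'] eta]. Qed.

Lemma measurable_fst3 : measurable_fun setT (fun p : Rn R n * Rn R n * Rn R n => p.1.1).
Proof. exact: (measurableT_comp measurable_fst measurable_fst). Qed.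

Lemma measurable_snd3 : measurable_fun setT (fun p : Rn R n * Rn R n * Rn R n => p.1.2).
Proof. exact: (measurableT_comp measurable_snd measurable_fst). Qed.

Lemma cmeasurable_zak_term K m : cmeasurable K -> cmeasurable (zak_term K m).
Proof.
move=> mK; rewrite (_ : zak_term K m = fun p => K (vadd (vec_of_Zn m) p.1.1, p.2) * expi (phase1 m p.1.2)); last first.
  by apply/funext => p; exact: zak_termE.
apply: cmeasurableM.
  apply: (cmeasurable_comp (h := fun p : Rn R n * Rn R n * Rn R n => (vadd (vec_of_Zn m) p.1.1, p.2))) mK _.
  apply: measurable_fun_pair => //; apply: measurable_vadd => //; exact: measurable_fst3.
by apply: cmeasurable_expi; exact: (measurableT_comp (measurable_phase1 m) measurable_snd3).
Qed.

Lemma cmeasurable_zak_sum K F : cmeasurable K -> cmeasurable (zak_sum K F).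
Proof. by move=> mK; apply: cmeasurable_sum => m; exact: cmeasurable_zak_term. Qed.

(** The mass of |K|^2 on the product of [cube m] with R^n. Orthonormality in [xi'] makes it the
    squared norm of the [m]-th Zak term, and [unfolding] makes these masses add up to that of
    [K]. *)
Definition zak_mass K (m : Zn n) : \bar R :=
  (\int[lam]_eta \int[TT]_xi (sqc (K (vadd xi (vec_of_Zn m), eta)))%:E)%E.

Lemma zak_mass_ge0 K m : (0 <= zak_mass K m)%E.
Proof. by apply: integral_ge0 => eta _; apply: integral_ge0 => xi _; rewrite lee_fin sqc_ge0. Qed.

Lemma cmeasurable_zak_shift K m : cmeasurable K ->
  cmeasurable (fun p : Rn R n * Rn R n => K (vadd p.1 (vec_of_Zn m), p.2)).
Proof.
move=> mK; apply: (cmeasurable_comp (h := fun p : Rn R n * Rn R n => (vadd p.1 (vec_of_Zn m), p.2))) mK _.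
by apply: measurable_fun_pair => //; exact: measurable_vadd.
Qed.

Lemma measurable_zak_inner K m : cmeasurable K ->
  measurable_fun setT (fun eta => \int[TT]_xi (sqc (K (vadd xi (vec_of_Zn m), eta)))%:E)%E.
Proof.
move=> mK; exact: (measurable_fun_fubini_tonelli_G (m1 := TT)
  (fun p => (sqc (K (vadd p.1 (vec_of_Zn m), p.2)))%:E)
  (emeasurable_sqc (cmeasurable_zak_shift m mK)) (fun p => sqc_ge0 _)).
Qed.

Lemma nsq_zak_sum K F : cmeasurable K ->
  nsq mu3 (zak_sum K F) = (\sum_(m <- F) zak_mass K m)%E.
Proof.
move=> mK; have mS := cmeasurable_zak_sum F mK.
rewrite /nsq ge0_integral_prod2; last 2 first.
- exact: emeasurable_sqc.
- by move=> p; rewrite lee_fin sqc_ge0.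
rewrite /zak_mass -ge0_integral_sum//; last 2 first.
- by move=> m; exact: measurable_zak_inner.
- by move=> m eta _; apply: integral_ge0 => xi _; rewrite lee_fin sqc_ge0.
apply: eq_integral => eta _.
rewrite ge0_integral_prod; last 2 first.
- by apply: emeasurable_sqc; exact: cmeasurable_comp mS (pair2_measurable eta).
- by move=> p; rewrite lee_fin sqc_ge0.
rewrite -ge0_integral_sum//; last 2 first.
- by move=> m; apply: emeasurable_sqc; exact: cmeasurable_comp (cmeasurable_zak_shift m mK) (pair2_measurable eta).
- by move=> m xi _; rewrite lee_fin sqc_ge0.
apply: eq_integral => xi _.
transitivity (nsq TT (lin_comb (fun m x => expi (phase1 m x)) F (fun m => K (vadd xi (vec_of_Zn m), eta)))).
  apply: eq_nsq => xi'; congr sqc; apply: eq_bigr => m _.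
  by rewrite zak_termE /= vaddC.
rewrite nsq_lin_comb; last 3 first.
- by move=> j; apply: cmeasurable_expi; exact: measurable_phase1.
- by move=> j; apply: (@cbounded_nsq_torus _ _ _ 1) => [|y]; [apply: cmeasurable_expi; exact: measurable_phase1|rewrite sqc_expi].
- exact: phase1_orthonormal.
by rewrite sumEFin.
Qed.

Lemma zak_mass_series K : cmeasurable K ->
  (\sum_(i <oo) oapp (zak_mass K) 0 (pickle_inv i) = nsq lam2 K)%E.
Proof.
move=> mK; rewrite /nsq ge0_integral_prod2; last 2 first.
- exact: emeasurable_sqc.
- by move=> p; rewrite lee_fin sqc_ge0.
transitivity (\int[lam]_eta (\sum_(i <oo) oapp (fun m : Zn n =>
    \int[TT]_xi (sqc (K (vadd xi (vec_of_Zn m), eta)))%:E) 0 (pickle_inv i)))%E.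
  rewrite integral_nneseries//; last 2 first.
  - by move=> i; case: pickle_inv => //= m; exact: measurable_zak_inner.
  - move=> i eta _; case: pickle_inv => //= m; apply: integral_ge0 => xi _.
    by rewrite lee_fin sqc_ge0.
  by apply: eq_eseriesr => i _; case: pickle_inv => //=; rewrite integral0.
apply: eq_integral => eta _; rewrite -(@unfolding _ _ (fun x => (sqc (K (x, eta)))%:E))//.
- by apply: emeasurable_sqc; exact: cmeasurable_comp mK (pair2_measurable eta).
- by move=> x; rewrite lee_fin sqc_ge0.
Qed.

Section square_integrable_kernel.
Variable K : Rn R n * Rn R n -> R[i].
Hypothesis K2 : L2_2 K.
Let mK : cmeasurable K. Proof. by case: K2. Qed.
Let Ky : (nsq lam2 K < +oo)%E. Proof. by case: K2. Qed.
Let kap := fine (nsq lam2 K).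
Let kapE : nsq lam2 K = kap%:E. Proof. by rewrite fineK// ge0_fin_numE ?nsq_ge0. Qed.
Let a m := fine (zak_mass K m).

Let partial_le N : (\sum_(m <- @enumF (Zn n) N) zak_mass K m <= nsq lam2 K)%E.
Proof.
rewrite -zak_mass_series// -(sum_enumF (zak_mass K) N).
by apply: nneseries_lim_ge => i _; case: pickle_inv => //= m _; exact: zak_mass_ge0.
Qed.

Let aE m : zak_mass K m = (a m)%:E.
Proof.
rewrite fineK// ge0_fin_numE ?zak_mass_ge0//; apply: le_lt_trans Ky.
have [N mN] := @enumF_exhaust (Zn n) [fset m]%fset.
apply: le_trans (partial_le N); rewrite (big_fsetD1 m)/=; last first.
  by apply: (fsubsetP mN); rewrite inE.
by rewrite leeDl// sume_ge0// => k _; exact: zak_mass_ge0.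
Qed.

Let a0 m : 0 <= a m. Proof. by rewrite fine_ge0// zak_mass_ge0. Qed.

Let sumaE F : (\sum_(m <- F) zak_mass K m)%E = (\sum_(m <- F) a m)%:E.
Proof. by rewrite -sumEFin; apply: eq_bigr. Qed.

Lemma nsq_zak_sumE F : nsq mu3 (zak_sum K F) = (\sum_(m <- F) a m)%:E.
Proof. by rewrite nsq_zak_sum// sumaE. Qed.

Lemma sum_zak_le F : \sum_(m <- F) a m <= kap.
Proof.
have [N FN] := enumF_exhaust F; apply: (le_trans (le_sum_fsubset FN a0)).
by rewrite -lee_fin -sumaE -kapE; exact: partial_le.
Qed.

Lemma sum_zak_ge (e : R) : 0 < e ->
  exists F0, forall F, (F0 `<=` F)%fset -> kap <= \sum_(m <- F) a m + e.
Proof.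
move=> e0.
have b0 i : (0 <= oapp (zak_mass K) 0 (@pickle_inv (Zn n) i))%E.
  by case: pickle_inv => //= m; exact: zak_mass_ge0.
have cv : (fun N => \sum_(0 <= i < N) oapp (zak_mass K) 0 (@pickle_inv (Zn n) i))%E @ \oo --> kap%:E.
  by rewrite -kapE -zak_mass_series//; apply: is_cvg_nneseries.
have [_ /cvgrPdist_le /(_ _ e0)[N _ /(_ N (leqnn N))]] := (fine_cvgP _ _).1 cv.
rewrite /= (sum_enumF (zak_mass K) N) sumaE /= => h.
exists (enumF N) => F NF; have := le_sum_fsubset NF a0.
by move: h; rewrite ler_norml => /andP[_ h1] h2; lra.
Qed.

Lemma nsq_zak_sum_diff F G : (F `<=` G)%fset ->
  nsq mu3 (fun p => zak_sum K G p - zak_sum K F p)%R = (\sum_(m <- G) a m - \sum_(m <- F) a m)%:E.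
Proof.
move=> FG.
have split_sum (V : zmodType) (h : Zn n -> V) :
    \sum_(m <- G) h m - \sum_(m <- F) h m = \sum_(m <- (G `\` F)%fset) h m.
  rewrite (big_fsetID _ (mem F) G)/= addrAC.
  have -> : [fset x in G | x \in F]%fset = F.
    apply/fsetP => j; rewrite !inE/=; apply/idP/idP => [/andP[]//|jF].
    by rewrite jF (fsubsetP FG).
  rewrite subrr add0r; apply: eq_fbigl => j; rewrite !inE/=.
  by rewrite andbC.
have -> : (fun p => zak_sum K G p - zak_sum K F p) = zak_sum K (G `\` F)%fset.
  by apply/funext => p; rewrite /zak_sum split_sum.
by rewrite nsq_zak_sumE split_sum.
Qed.

(** For nested finite sets the squared distance of the partial sums is a difference of sums of
    masses. Convergence of this nonnegative series yields a Cauchy sequence along [enumF], and then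
    convergence over all large finite sets. *)
Lemma zak_exists : exists Z, [/\ cmeasurable Z, (nsq mu3 Z < +oo)%E &
  forall e : R, 0 < e -> exists F0, forall F, (F0 `<=` F)%fset ->
    (nsq mu3 (fun p => Z p - zak_sum K F p)%R <= e%:E)%E].
Proof.
have mS F := cmeasurable_zak_sum F mK.
have small (e : R) : 0 < e -> exists F0, forall F G, (F0 `<=` F)%fset -> (F `<=` G)%fset ->
    (nsq mu3 (fun p => zak_sum K G p - zak_sum K F p)%R <= e%:E)%E.
  move=> e0; have [F0 H] := sum_zak_ge e0; exists F0 => F G F0F FG.
  rewrite nsq_zak_sum_diff// lee_fin.
  by have := H _ F0F; have := sum_zak_le G; lra.
have [|Z [mZ cZ _]] := @nsq_complete _ _ _ mu3 (fun N => zak_sum K (enumF N)) (fun N => mS _).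
  move=> e e0; have [F0 H] := small _ e0; have [N NF] := enumF_exhaust F0.
  exists N => j k Nj Nk.
  have [kj|jk] := leqP k j.
    by apply: H; [exact: fsubset_trans NF (enumF_mono Nk)|exact: enumF_mono].
  rewrite nsqC; apply: H; [exact: fsubset_trans NF (enumF_mono Nj)|].
  by apply: enumF_mono; exact: ltnW.
exists Z; split => //.
  have [N /(_ N (leqnn N)) HN] := cZ _ ltr01.
  have -> : Z = (fun p => (Z p - zak_sum K (enumF N) p) + zak_sum K (enumF N) p).
    by apply/funext => p; rewrite subrK.
  apply: nsqD_lty => //; first exact: cmeasurableB.
    exact: le_lt_trans HN (ltry _).
  by rewrite nsq_zak_sumE ltry.
move=> e e0; have e4 : 0 < e / 4 by rewrite divr_gt0.
have [F0 H] := small _ e4; have [N1 F0N] := enumF_exhaust F0; have [N2 HN] := cZ _ e4.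
pose N := maxn N1 N2.
have F0N' : (F0 `<=` enumF N)%fset by apply: fsubset_trans F0N (enumF_mono (leq_maxl _ _)).
exists (enumF N) => F NF.
apply: (le_trans (nsq_triangle mu3 mZ (mS (enumF N)) (mS F))).
have -> : e%:E = (2%:E * ((e / 4)%:E + (e / 4)%:E))%E.
  by rewrite -EFinD -EFinM; congr EFin; field.
rewrite lee_pmul2l//; apply: leeD; first by apply: HN; exact: leq_maxr.
by rewrite nsqC; exact: H.
Qed.

End square_integrable_kernel.

Lemma weyl_zakP phi : L2_2 phi -> [/\ cmeasurable (weyl_zak phi),
  (nsq mu3 (weyl_zak phi) < +oo)%E &
  forall e : R, 0 < e -> exists F0, forall F, (F0 `<=` F)%fset ->
    (nsq mu3 (fun p => weyl_zak phi p - zak_sum (weyl_kernel phi) F p)%R <= e%:E)%E].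
Proof.
move=> L2phi; have [L2K _] := weyl_kernelP L2phi.
have [Z0 [mZ0 Z0y cZ0]] := zak_exists L2K.
have HZ0 : is_weyl_zak phi Z0.
  split; first exact/inLp2P.
  move=> e e0; have e2 : 0 < e ^+ 2 / 2 by rewrite divr_gt0// exprn_gt0.
  have [F0 H] := cZ0 _ e2; exists F0 => F /H HF; rewrite cLnorm2_lt//.
  apply: le_lt_trans HF _.
  by rewrite lte_fin ltr_pdivrMr// ltr_pMr ?ltr1n// exprn_gt0.
have [/inLp2P[mZ Zy] cZ] : is_weyl_zak phi (weyl_zak phi) by exact: (xgetPex _ (ex_intro _ Z0 HZ0)).
split => // e e0; have se : 0 < Num.sqrt e by rewrite sqrtr_gt0.
have [F0 H] := cZ _ se; exists F0 => F /H.
by rewrite cLnorm2_lt// (sqr_sqrtr (ltW e0)) => /ltW.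
Qed.

Definition shift_phase (kl : Zn n * Zn n) : R[i] :=
  expi (pi * vdot (vec_of_Zn kl.1) (vec_of_Zn kl.2)).

(** The shift by [l] sends the [m]-th term to the one of index [m + l]; the part [2 pi l.xi'] of the
    character compensates the new index, and the phase [2 pi k.m] disappears. *)
Lemma zak_term_shift kl K m p : zak_term (kernel_shift kl K) m p =
  shift_phase kl * expi (phase2 kl p.1) * zak_term K (zadd m kl.2) p.
Proof.
rewrite !zak_termE /kernel_shift /=.
have -> : vadd (vadd (vec_of_Zn m) p.1.1) (vec_of_Zn kl.2) = vadd (vec_of_Zn (zadd m kl.2)) p.1.1.
  by apply: eq_from_tnth => i; rewrite vec_zadd !vE; ring.
have E : expi (pi * vdot (vec_of_Zn kl.1) (vec_of_Zn kl.2) + 2 * pi * vdot (vec_of_Zn kl.1) (vadd (vec_of_Zn m) p.1.1)) * expi (phase1 m p.1.2) =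
    shift_phase kl * expi (phase2 kl p.1) * expi (phase1 (zadd m kl.2) p.1.2).
  rewrite /shift_phase -!expiD /phase1 /phase2 vec_zadd !vdotDl vdotDr.
  rewrite -[RHS]mulr1 -(expi_2pi_vdot_int kl.1 m) -expiD; congr expi; ring.
by rewrite [LHS]mulrAC E [X in _ = _ * X]mulrC [RHS]mulrA.
Qed.

(** A partial Zak sum of the combined kernel is a combination of partial sums of [K] over translated
    index sets. Unconditional convergence makes all of these approach the same [Z], so the
    multiplier factors out in the limit. *)
Lemma nsq_zak_shifts phi (s : seq (Zn n * Zn n)) c : L2_2 phi ->
  nsq lam2 (op_comb kernel_shift s c (weyl_kernel phi)) =
  nsq mu3 (fun p => (\sum_(kl <- s) c kl * shift_phase kl * expi (phase2 kl p.1)) * weyl_zak phi p)%R.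
Proof.
move=> L2phi; have [L2K _] := weyl_kernelP L2phi; have [mK _] := L2K.
have [mZ Zy cZ] := weyl_zakP L2phi.
set K := weyl_kernel phi in L2K mK cZ *; set Z := weyl_zak phi in mZ Zy cZ *.
pose K' := op_comb kernel_shift s c K.
have mK' : cmeasurable K' by apply: cmeasurable_op_comb => //; exact: cmeasurable_kernel_shift.
have K'y : (nsq lam2 K' < +oo)%E.
  apply: nsq_sum_lty => kl.
    by apply: cmeasurableM; [exact: cmeasurable_cst|exact: cmeasurable_kernel_shift].
  apply: nsqZ_lty; first exact: cmeasurable_kernel_shift.
  by rewrite nsq_kernel_shift//; have [] := L2K.
have L2K' : L2_2 K' by split.
pose E kl (p : Rn R n * Rn R n * Rn R n) := c kl * shift_phase kl * expi (phase2 kl p.1).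
have mE kl : cmeasurable (E kl).
  apply: cmeasurableM; first exact: cmeasurable_cst.
  by apply: cmeasurable_expi; exact: (measurableT_comp (measurable_phase2 kl) measurable_fst).
pose SF F (l : Zn n) p := \sum_(m <- F) zak_term K (zadd m l) p.
have mSF F l : cmeasurable (SF F l).
  by apply: cmeasurable_sum => m; exact: cmeasurable_zak_term.
have zE F : zak_sum K' F = (fun p => \sum_(kl <- s) E kl p * SF F kl.2 p).
  apply/funext => p; rewrite /zak_sum /SF; under [RHS]eq_bigr do rewrite mulr_sumr.
  rewrite [RHS]exchange_big/=; apply: eq_bigr => m _.
  rewrite zak_termE /K' /op_comb mulr_suml; apply: eq_bigr => kl _.
  rewrite -mulrA; have := zak_term_shift kl K m p; rewrite zak_termE => ->.
  by rewrite /E !mulrA.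
have SFE F l : SF F l = zak_sum K [fset zadd m l | m in F]%fset.
  apply/funext => p; rewrite /SF /zak_sum big_imfset//= => x y _ _ h.
  by rewrite -(zaddK x l) h zaddK.
have key (r : seq (Zn n * Zn n)) (e : R) : 0 < e -> exists F0, forall F, (F0 `<=` F)%fset ->
    (nsq mu3 (fun p => \sum_(kl <- r) E kl p * (Z p - SF F kl.2 p))%R <= e%:E)%E.
  elim: r e => [|kl r IH] e e0.
    exists fset0 => F _; rewrite /nsq; under eq_integral do rewrite big_nil sqc0.
    by rewrite integral0 lee_fin ltW.
  have e4 : 0 < e / 4 by rewrite divr_gt0.
  have c1 : 0 < 1 + sqc (c kl) by have := sqc_ge0 (c kl); lra.
  have [F1 H1] := IH _ e4; have [F2 H2] := cZ _ (divr_gt0 e4 c1).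
  (* [F2] is translated back by [kl.2], so that the translate of [F] occurring in [SF F kl.2]
     contains [F2]. *)
  exists (F1 `|` [fset zsub m kl.2 | m in F2])%fset => F; rewrite fsubUset => /andP[F1F F2F].
  under [X in nsq _ X]eq_fun do rewrite big_cons.
  apply: (le_trans (nsqD2 mu3 _ _)).
  - by apply: cmeasurableM => //; exact: cmeasurableB.
  - by apply: cmeasurable_sum => kl'; apply: cmeasurableM => //; exact: cmeasurableB.
  have -> : e%:E = (2%:E * ((e / 4)%:E + (e / 4)%:E))%E.
    by rewrite -EFinD -EFinM; congr EFin; field.
  rewrite lee_pmul2l//; apply: leeD; last exact: H1.
  have -> : nsq mu3 (fun p => E kl p * (Z p - SF F kl.2 p))%R =
      nsq mu3 (fun p => c kl * (Z p - SF F kl.2 p))%R.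
    by apply: eq_nsq => p; rewrite !sqcM !sqc_expi !mulr1.
  rewrite nsqZ; last exact: cmeasurableB.
  apply: (@le_trans _ _ ((sqc (c kl))%:E * (e / 4 / (1 + sqc (c kl)))%:E)%E).
    rewrite lee_wpmul2l ?lee_fin ?sqc_ge0// SFE; apply: H2.
    apply/fsubsetP => m mF2; apply/imfsetP; exists (zsub m kl.2); last by rewrite zsubK.
    by apply: (fsubsetP F2F); apply/imfsetP; exists m.
  rewrite -EFinM lee_fin mulrA ler_pdivrMr// mulrC ler_pM2l//.
  by rewrite lerDr.
have K'E : nsq lam2 K' = (fine (nsq lam2 K'))%:E by rewrite fineK// ge0_fin_numE ?nsq_ge0.
rewrite K'E; apply/esym; apply: nsq_eq_of_approx.
- by apply: cmeasurableM => //; apply: cmeasurable_sum.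
- by rewrite fine_ge0// nsq_ge0.
move=> e e0; have [F1 H1] := key s _ e0; have [F2 H2] := sum_zak_ge L2K' e0.
exists (zak_sum K' (F1 `|` F2)%fset); split.
- exact: cmeasurable_zak_sum.
- have := H1 (F1 `|` F2)%fset (fsubsetUl _ _); rewrite zE; congr (_ <= _)%E.
  apply: eq_nsq => p; congr sqc; rewrite mulr_suml -sumrB; apply: eq_bigr => kl _.
  by rewrite mulrBr.
- by rewrite nsq_zak_sumE// lee_fin; exact: sum_zak_le.
- rewrite nsq_zak_sumE// -EFinD lee_fin; apply: H2; exact: fsubsetUr.
Qed.

End zak_transform.

(** * The bracket *)

Section riesz_bracket.
Context {R : realType} {n : nat}.
Local Notation lam := (lebesgue_tuple R n).
Local Notation lam2 := (prod_measure lam lam).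
Local Notation TT := (torus_measure R n).
Local Notation TT2 := (prod_measure TT TT).
Local Notation mu3 := (prod_measure TT2 lam).
Local Notation chi := (fun kl x => expi (phase2 kl x)).
Implicit Types phi : Rn R n * Rn R n -> R[i].

(** The bracket as a real function. Where the fibre norm is infinite, on a null set, [fine] gives 0,
    which is also the value of [bracket] there. *)
Definition bracket_weight phi (p : Rn R n * Rn R n) : R :=
  fine (nsq lam (fun eta => weyl_zak phi (p, eta))).

Lemma cmeasurable_zak_slice phi p : L2_2 phi ->
  cmeasurable (fun eta => weyl_zak phi (p, eta)).
Proof.
move=> L2phi; have [mZ _ _] := weyl_zakP L2phi.
exact: cmeasurable_comp mZ (pair1_measurable p).
Qed.

Lemma bracketE phi p : L2_2 phi -> bracket phi phi p = (bracket_weight phi p)%:C.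
Proof. by move=> L2phi; exact/cintegral_sqc/cmeasurable_zak_slice. Qed.

Lemma measurable_zak_fiber phi : L2_2 phi ->
  measurable_fun setT (fun p => nsq lam (fun eta => weyl_zak phi (p, eta))).
Proof.
move=> L2phi; have [mZ _ _] := weyl_zakP L2phi.
exact: (measurable_fun_fubini_tonelli_F (m2 := lam)
  (fun q => (sqc (weyl_zak phi q))%:E) (emeasurable_sqc mZ) (fun q => sqc_ge0 _)).
Qed.

Lemma measurable_bracket_weight phi : L2_2 phi ->
  measurable_fun setT (bracket_weight phi).
Proof.
by move=> L2phi; exact: (measurableT_comp (fine_measurable measurableT) (measurable_zak_fiber L2phi)).
Qed.

Lemma bracket_weight_ge0 phi p : 0 <= bracket_weight phi p.
Proof. by rewrite fine_ge0// nsq_ge0. Qed.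

Lemma ae_bracket_weight phi : L2_2 phi -> {ae TT2, forall p,
  nsq lam (fun eta => weyl_zak phi (p, eta)) = (bracket_weight phi p)%:E}.
Proof.
move=> L2phi; have [mZ Zy _] := weyl_zakP L2phi.
have : {ae TT2, forall p, (nsq lam (fun eta => weyl_zak phi (p, eta)) < +oo)%E}.
  apply: ae_lty_integral; [exact: measurable_zak_fiber|by move=> p; exact: nsq_ge0|].
  apply: le_lt_trans Zy; rewrite [leRHS]/nsq (ge0_integral_prod TT2 lam (f := fun q => (sqc (weyl_zak phi q))%:E)); [by []|exact: emeasurable_sqc|].
  by move=> q; rewrite lee_fin sqc_ge0.
by apply: filterS => p h; rewrite fineK// ge0_fin_numE// nsq_ge0.
Qed.

Lemma nsq_mul_zak phi (P : Rn R n * Rn R n -> R[i]) : L2_2 phi -> cmeasurable P ->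
  nsq mu3 (fun q => P q.1 * weyl_zak phi q)%R =
  (\int[TT2]_p (sqc (P p) * bracket_weight phi p)%:E)%E.
Proof.
move=> L2phi mP; have [mZ Zy _] := weyl_zakP L2phi.
have mPZ : cmeasurable (fun q : Rn R n * Rn R n * Rn R n => P q.1 * weyl_zak phi q).
  by apply: cmeasurableM => //; exact: (cmeasurable_comp mP measurable_fst).
rewrite /nsq (ge0_integral_prod TT2 lam (f := fun q => (sqc (P q.1 * weyl_zak phi q))%:E)); last 2 first.
- exact: emeasurable_sqc.
- by move=> q; rewrite lee_fin sqc_ge0.
have slice p : (\int[lam]_eta (sqc (P p * weyl_zak phi (p, eta)))%:E =
    (sqc (P p))%:E * nsq lam (fun eta => weyl_zak phi (p, eta)))%E.
  by rewrite -nsqZ//; exact: cmeasurable_zak_slice.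
under eq_integral do rewrite slice.
apply: ge0_ae_eq_integral => //.
- by apply: emeasurable_funM; [exact: emeasurable_sqc|exact: measurable_zak_fiber].
- apply/measurable_EFinP; apply: measurable_funM; [exact: measurable_sqc|exact: measurable_bracket_weight].
- by move=> p _; rewrite mule_ge0// ?lee_fin ?sqc_ge0// nsq_ge0.
- by move=> p _; rewrite lee_fin mulr_ge0// ?sqc_ge0// bracket_weight_ge0.
by apply: filterS (ae_bracket_weight L2phi) => p h _; rewrite h EFinM.
Qed.

Lemma integrable_bracket_weight phi : L2_2 phi ->
  TT2.-integrable setT (EFin \o bracket_weight phi).
Proof.
move=> L2phi; have [mZ Zy _] := weyl_zakP L2phi.
apply/integrableP; split.
  by apply/measurable_EFinP; exact: measurable_bracket_weight.
apply: le_lt_trans Zy; have := @nsq_mul_zak phi (fun=> 1) L2phi (cmeasurable_cst _ _).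
rewrite (eq_nsq mu3 (g := weyl_zak phi)); last by move=> q; rewrite mul1r.
move=> ->; rewrite le_eqVlt; apply/orP; left; apply/eqP; apply: eq_integral => p _.
by rewrite /= ger0_norm ?bracket_weight_ge0// /sqc/= expr1n expr0n addr0 mul1r.
Qed.

Lemma cmeasurable_chi_comb (F : {fset Zn n * Zn n}) (c : Zn n * Zn n -> R[i]) :
  cmeasurable (lin_comb chi F c).
Proof. by apply: cmeasurable_lin_comb => j; apply: cmeasurable_expi; exact: measurable_phase2. Qed.

Lemma nsq_chi_comb (F : {fset Zn n * Zn n}) (c : Zn n * Zn n -> R[i]) :
  nsq TT2 (lin_comb chi F c) = (\sum_(j <- F) sqc (c j))%:E.
Proof.
apply: nsq_lin_comb.
- by move=> j; apply: cmeasurable_expi; exact: measurable_phase2.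
- by move=> j; rewrite (nsq_expi torus2_measureT) ltry.
- exact: phase2_orthonormal.
Qed.

Lemma nsq_twisted_lin_comb phi (F : {fset Zn n * Zn n}) c : L2_2 phi ->
  nsq lam2 (lin_comb (fun kl => twisted_translation kl phi) F c) =
  (\int[TT2]_p (sqc (lin_comb chi F (fun kl => c kl * shift_phase kl) p) *
     bracket_weight phi p)%:E)%E.
Proof.
move=> L2phi; rewrite (nsq_twisted_comb F c L2phi) nsq_zak_shifts//.
by rewrite -nsq_mul_zak//; exact: cmeasurable_chi_comb.
Qed.

(** Cancelling the constants [shift_phase] in the coefficients lets the right side run over all
    trigonometric polynomials, as the positivity test demands. *)
Lemma nsq_twisted_lin_combJ phi (F : {fset Zn n * Zn n}) c : L2_2 phi ->
  nsq lam2 (lin_comb (fun kl => twisted_translation kl phi) F (fun kl => c kl * (shift_phase kl)^*)) =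
  (\int[TT2]_p (sqc (lin_comb chi F c p) * bracket_weight phi p)%:E)%E.
Proof.
move=> L2phi; rewrite nsq_twisted_lin_comb//; apply: eq_integral => p _; congr (sqc _ * _)%:E.
apply: eq_bigr => kl _; congr (_ * _).
by rewrite -mulrA [X in _ * X]mulrC sqcE sqc_expi mulr1.
Qed.

(** Serves both bounds, with a constant function as [u] or as [v]. Finiteness on the side of [v]
    lets the integral of the difference split. *)
Lemma ae_le_of_chi_comb (u v : Rn R n * Rn R n -> R) :
  TT2.-integrable setT (EFin \o u) -> TT2.-integrable setT (EFin \o v) ->
  (forall p, 0 <= u p) -> (forall p, 0 <= v p) ->
  (forall F c, (\int[TT2]_p (sqc (lin_comb chi F c p) * v p)%:E < +oo)%E) ->
  (forall F c, (\int[TT2]_p (sqc (lin_comb chi F c p) * u p)%:E <=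
    \int[TT2]_p (sqc (lin_comb chi F c p) * v p)%:E)%E) ->
  {ae TT2, forall p, u p <= v p}.
Proof.
move=> iu iv u0 v0 vy uv.
suff : {ae TT2, forall p, 0 <= v p - u p} by apply: filterS => p; rewrite subr_ge0.
have integ (w : Rn R n * Rn R n -> R) F c : TT2.-integrable setT (EFin \o w) -> (forall p, 0 <= w p) ->
    (\int[TT2]_p (sqc (lin_comb chi F c p) * w p)%:E < +oo)%E ->
    TT2.-integrable setT (fun p => (sqc (lin_comb chi F c p) * w p)%:E).
  move=> /measurable_int/measurable_EFinP mw w0 wy; apply/integrableP; split.
    by apply/measurable_EFinP; apply: measurable_funM => //; exact/measurable_sqc/cmeasurable_chi_comb.
  by under eq_integral do rewrite gee0_abs ?lee_fin ?mulr_ge0 ?sqc_ge0//.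
apply: phase2_ae_ge0 => [|F c].
  have -> : EFin \o (fun p => v p - u p) = ((EFin \o v) \- (EFin \o u))%E by [].
  exact: integrableB.
under eq_integral do rewrite mulrBr EFinB.
have uy := le_lt_trans (uv F c) (vy F c).
rewrite integralB//; [|exact: integ|exact: integ].
rewrite sube_ge0//; apply/orP; right.
rewrite ge0_fin_numE//; apply: integral_ge0 => p _; by rewrite lee_fin mulr_ge0// sqc_ge0.
Qed.

Lemma integral_chi_comb_cst (a : R) F (c : Zn n * Zn n -> R[i]) : 0 <= a ->
  (\int[TT2]_p (sqc (lin_comb chi F c p) * a)%:E)%E = (a * \sum_(j <- F) sqc (c j))%:E.
Proof.
move=> a0; under eq_integral do rewrite mulrC EFinM.
rewrite ge0_integralZl ?lee_fin//.
- by rewrite -/(nsq TT2 (lin_comb chi F c)) nsq_chi_comb.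
- exact/emeasurable_sqc/cmeasurable_chi_comb.
- by move=> p _; rewrite lee_fin sqc_ge0.
Qed.

Lemma integrable_torus2_cst (a : R) : TT2.-integrable setT (EFin \o (fun=> a)).
Proof.
apply/integrableP; split; first exact: measurable_cst.
under eq_integral do rewrite /=.
by rewrite integral_cst// [X in (_ * X)%E]torus2_measureT mule1 ltry.
Qed.

Lemma riesz_bound_bracket phi (A B : R) : L2_2 phi -> 0 < A -> 0 < B ->
  (forall (F : {fset Zn n * Zn n}) (c : Zn n * Zn n -> R[i]),
    ((A * \sum_(j <- F) sqc (c j))%:E <=
      nsq lam2 (lin_comb (fun kl => twisted_translation kl phi) F c) <=
     (B * \sum_(j <- F) sqc (c j))%:E)%E) <->
  {ae TT2, forall p, A <= bracket_weight phi p <= B}.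
Proof.
move=> L2phi A0 B0; have iw := integrable_bracket_weight L2phi.
have mw := measurable_bracket_weight L2phi.
split => [H|H F c].
  have {}H (F : {fset Zn n * Zn n}) (c : Zn n * Zn n -> R[i]) : ((A * \sum_(j <- F) sqc (c j))%:E <=
      \int[TT2]_p (sqc (lin_comb chi F c p) * bracket_weight phi p)%:E <=
     (B * \sum_(j <- F) sqc (c j))%:E)%E.
    rewrite -nsq_twisted_lin_combJ//; have := H F (fun kl => c kl * (shift_phase kl)^*).
    by under eq_bigr do rewrite sqcM sqcJ sqc_expi mulr1.
  have lo : {ae TT2, forall p, A <= bracket_weight phi p}.
    apply: ae_le_of_chi_comb => //.
    - exact: integrable_torus2_cst.
    - by move=> p; exact: ltW.
    - exact: bracket_weight_ge0.
    - by move=> F c; have /andP[_ /le_lt_trans] := H F c; apply; exact: ltry.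
    - by move=> F c; have /andP[h _] := H F c; rewrite integral_chi_comb_cst// ltW.
  have hi : {ae TT2, forall p, bracket_weight phi p <= B}.
    apply: ae_le_of_chi_comb => //.
    - exact: integrable_torus2_cst.
    - exact: bracket_weight_ge0.
    - by move=> p; exact: ltW.
    - by move=> F c; rewrite integral_chi_comb_cst ?ltry// ltW.
    - by move=> F c; have /andP[_ h] := H F c; rewrite integral_chi_comb_cst// ltW.
  by apply: filterS2 lo hi => p -> ->.
pose c' kl : R[i] := c kl * shift_phase kl.
have -> : \sum_(j <- F) sqc (c j) = \sum_(j <- F) sqc (c' j).
  by apply: eq_bigr => j _; rewrite sqcM sqc_expi mulr1.
rewrite nsq_twisted_lin_comb// -!integral_chi_comb_cst; [|exact: ltW|exact: ltW].
have ms : measurable_fun setT (fun p => sqc (lin_comb chi F c' p)).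
  exact/measurable_sqc/cmeasurable_chi_comb.
have s0 p : 0 <= sqc (lin_comb chi F c' p) by exact: sqc_ge0.
have me (v : Rn R n * Rn R n -> R) : measurable_fun setT v ->
    measurable_fun setT (fun p => (sqc (lin_comb chi F c' p) * v p)%:E).
  by move=> mv; apply/measurable_EFinP; exact: measurable_funM.
apply/andP; split; apply: ae_ge0_le_integral => //.
- by move=> p _; rewrite lee_fin mulr_ge0// ltW.
- exact: me.
- by move=> p _; rewrite lee_fin mulr_ge0// bracket_weight_ge0.
- exact: me.
- by apply: filterS H => p /andP[h _] _; rewrite lee_fin ler_wpM2l.
- by move=> p _; rewrite lee_fin mulr_ge0// bracket_weight_ge0.
- exact: me.
- by move=> p _; rewrite lee_fin mulr_ge0// ltW.
- exact: me.
- by apply: filterS H => p /andP[_ h] _; rewrite lee_fin ler_wpM2l.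
Qed.

End riesz_bracket.

Theorem theorem4p3 (R : realType) (n : nat)
    (phi : Rn R n * Rn R n -> R[i])
    (phi_L2 : inLp (prod_measure (lebesgue_tuple R n) (lebesgue_tuple R n))
                2%:E phi) :
  riesz_sequence (prod_measure (lebesgue_tuple R n) (lebesgue_tuple R n))
    (fun kl : Zn n * Zn n => twisted_translation kl phi)
  <->
  exists A B : R, 0 < A /\
    {ae prod_measure (torus_measure R n) (torus_measure R n),
      forall p, A%:C <= bracket phi phi p <= B%:C}.
Proof.
have L2phi : L2_2 phi by exact/inLp2P.
have normcE F (c : Zn n * Zn n -> R[i]) :
    \sum_(j <- F) Normc.normc (c j) ^+ 2 = \sum_(j <- F) sqc (c j).
  by apply: eq_bigr => j _; exact: normc_sqr.
split=> [[_ [A [B [A0 B0 H]]]]|[A [B [A0 H]]]].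
  exists A, B; split => //.
  have /(riesz_bound_bracket L2phi A0 B0) : forall (F : {fset Zn n * Zn n}) (c : Zn n * Zn n -> R[i]),
      ((A * \sum_(j <- F) sqc (c j))%:E <=
        nsq (prod_measure (lebesgue_tuple R n) (lebesgue_tuple R n))
          (lin_comb (fun kl => twisted_translation kl phi) F c) <=
       (B * \sum_(j <- F) sqc (c j))%:E)%E.
    by move=> F c; rewrite -normcE -cLnorm2_sqr; exact: H.
  by apply: filterS => p; rewrite bracketE// !lecR.
(* Completeness in the closed span is an equality by reflexivity. The given [B] comes without a
   sign, while the Riesz bounds ask for a positive constant, hence the larger one. *)
split => //; exists A, (`|B| + 1); have B0 : 0 < `|B| + 1 by have := normr_ge0 B; lra.
split => // F c; rewrite normcE cLnorm2_sqr.
apply: (riesz_bound_bracket L2phi A0 B0).2; apply: filterS H => p.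
rewrite bracketE// !lecR => /andP[-> h]; apply: (le_trans h).
by have := ler_norm B; lra.
Qed.
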